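(* Let $\Omega\subset\mathbb{C}^d$ be a bounded complete Kobayashi hyperbolic domain with Dini-smooth boundary. Suppose $\Omega$ is locally convex, and that for every $x\in\partial\Omega$, with $(\Phi_x,U_x,V_x)$ as in the definition of local convexity, the domain $\Phi_x(V_x\cap\Omega)$ has the visibility property with respect to the geodesics of its Kobayashi distance. Then for every $x\in\partial\Omega$, $o\in\Omega$ and $R>0$, $\overline{H^s_o(x,R)}\cap\partial\Omega=\overline{H^b_o(x,R)}\cap\partial\Omega=\{x\}$.
   Context: For a Kobayashi hyperbolic domain $\Omega\subset\mathbb{C}^d$ with Kobayashi distance $\mathsf{k}_\Omega$, $x\in\partial\Omega$, $o\in\Omega$, $R>0$: $H^s_o(x,R)=\{z\in\Omega:\limsup_{w\to x}(\mathsf{k}_\Omega(z,w)-\mathsf{k}_\Omega(o,w))<\tfrac12\log R\}$ and $H^b_o(x,R)=\{z\in\Omega:\liminf_{w\to x}(\mathsf{k}_\Omega(z,w)-\mathsf{k}_\Omega(o,w))<\tfrac12\log R\}$; closures in $\mathbb{C}^d$. Complete Kobayashi hyperbolic: $(\Omega,\mathsf{k}_\Omega)$ is Cauchy complete. A boundary point is Dini-smooth if near it $\partial\Omega$ is a $\mathcal{C}^1$ hypersurface whose unit normal vector field has modulus of continuity $\omega$ satisfying $\int_0^{\epsilon}\omega(t)/t\,dt<\infty$; $\Omega$ has Dini-smooth boundary if all boundary points are Dini-smooth. $\Omega$ is locally convex if for every $x\in\partial\Omega$ there exist $\mathbb{C}^d$-neighbourhoods $V_x\Subset U_x$ of $x$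 and an injective holomorphic map $\Phi_x:U_x\to\mathbb{C}^d$ such that $\Phi_x(\Omega\cap V_x)$ is an open convex set. A geodesic is a map $\gamma:I\to D$ with $\mathsf{k}_D(\gamma(s),\gamma(t))=|s-t|$. A domain $D$ (complete Kobayashi hyperbolic) has the visibility property with respect to geodesics if for any two distinct $x,y\in\partial D$ there exist disjoint neighbourhoods $U_x,U_y$ and a compact $K\subset D$ such that every geodesic starting in $U_x$ and ending in $U_y$ meets $K$. *)

(* Defs.v *)
From Stdlib Require Vectors.Fin.
From Stdlib Require Import Reals Lra.
From Coquelicot Require Import Coquelicot.
Set Implicit Arguments.
Open Scope R_scope.

Definition Cd (d : nat) : Type := Fin.t d -> C.

Fixpoint fsum (d : nat) : (Fin.t d -> R) -> R :=
  match d return (Fin.t d -> R) -> R with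
  | O => fun _ => 0
  | S n => fun f => f Fin.F1 + @fsum n (fun i => f (Fin.FS i))
  end.

Definition vadd {d} (u v : Cd d) : Cd d := fun i => Cplus (u i) (v i).
Definition vsub {d} (u v : Cd d) : Cd d := fun i => Cminus (u i) (v i).
Definition vscal {d} (c : C) (v : Cd d) : Cd d := fun i => Cmult c (v i).
Definition vrscal {d} (t : R) (v : Cd d) : Cd d := fun i => Cmult (RtoC t) (v i).
Definition vzero {d} : Cd d := fun _ => RtoC 0.

Definition vnorm {d} (v : Cd d) : R := sqrt (fsum (fun i => Cmod (v i) ^ 2)).
Definition vdist {d} (u v : Cd d) : R := vnorm (vsub u v).

Definition rinner {d} (u v : Cd d) : R :=
  fsum (fun i => Re (u i) * Re (v i) + Im (u i) * Im (v i)).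

Definition is_open {d} (A : Cd d -> Prop) : Prop :=
  forall z, A z -> exists eps, 0 < eps /\ forall w, vdist w z < eps -> A w.

Definition closure {d} (A : Cd d -> Prop) : Cd d -> Prop :=
  fun y => forall eps, 0 < eps -> exists z, A z /\ vdist z y < eps.

Definition bdry {d} (A : Cd d -> Prop) : Cd d -> Prop :=
  fun y => closure A y /\ ~ A y.

Definition is_bounded {d} (A : Cd d -> Prop) : Prop :=
  exists M, forall z, A z -> vnorm z <= M.

(** compact subsets of C^d (Heine--Borel: closed and bounded) *)
Definition is_compact {d} (K : Cd d -> Prop) : Prop :=
  is_bounded K /\ forall y, closure K y -> K y.

Definition is_connected {d} (A : Cd d -> Prop) : Prop :=
  forall P Q : Cd d -> Prop, is_open P -> is_open Q ->
    (forall z, A z -> P z \/ Q z) ->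
    (forall z, A z -> P z -> Q z -> False) ->
    (forall z, A z -> P z) \/ (forall z, A z -> Q z).

Definition is_domain {d} (A : Cd d -> Prop) : Prop :=
  (exists z, A z) /\ is_open A /\ is_connected A.

Definition is_convex {d} (A : Cd d -> Prop) : Prop :=
  forall z w t, A z -> A w -> 0 <= t <= 1 ->
    A (vadd (vrscal (1 - t) z) (vrscal t w)).

Definition holomorphic_on {d} (U : Cd d -> Prop) (F : Cd d -> Cd d) : Prop :=
  forall z, U z -> exists L : Cd d -> Cd d,
    (forall u v, L (vadd u v) = vadd (L u) (L v)) /\
    (forall c u, L (vscal c u) = vscal c (L u)) /\
    (forall eps, 0 < eps -> exists del, 0 < del /\
       forall h, vnorm h < del ->
         vnorm (vsub (vsub (F (vadd z h)) (F z)) (L h)) <= eps * vnorm h).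

Definition unit_disc (a : C) : Prop := Cmod a < 1.

Definition holo_disc {d} (D : Cd d -> Prop) (f : C -> Cd d) : Prop :=
  (forall a, unit_disc a -> D (f a)) /\
  forall a, unit_disc a -> exists v : Cd d,
    forall eps, 0 < eps -> exists del, 0 < del /\
      forall h : C, Cmod h < del ->
        vnorm (vsub (vsub (f (Cplus a h)) (f a)) (vscal h v)) <= eps * Cmod h.

Definition poincare (a b : C) : R :=
  let t := Cmod (Cminus a b) / Cmod (Cminus (RtoC 1) (Cmult (Cconj a) b)) in
  / 2 * ln ((1 + t) / (1 - t)).

Fixpoint kob_chain {d} (D : Cd d -> Prop) (z w : Cd d)
    (l : list ((C -> Cd d) * C * C)) : Prop :=
  match l with
  | nil => z = w
  | cons (f, a, b) l' =>
      holo_disc D f /\ unit_disc a /\ unit_disc b /\ f a = z /\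
      kob_chain D (f b) w l'
  end.

Fixpoint chain_length {d} (l : list ((C -> Cd d) * C * C)) : R :=
  match l with
  | nil => 0
  | cons (_, a, b) l' => poincare a b + chain_length l'
  end.

Definition kob {d} (D : Cd d -> Prop) (z w : Cd d) : R :=
  real (Glb_Rbar (fun s => exists l, kob_chain D z w l /\ s = chain_length l)).

Definition complete_kob_hyperbolic {d} (D : Cd d -> Prop) : Prop :=
  (forall z w, D z -> D w -> z <> w -> 0 < kob D z w) /\
  (forall u : nat -> Cd d, (forall n, D (u n)) ->
     (forall eps, 0 < eps -> exists N, forall m n, (N <= m)%nat -> (N <= n)%nat ->
        kob D (u m) (u n) < eps) ->
     exists p, D p /\ forall eps, 0 < eps -> exists N, forall n, (N <= n)%nat ->
        kob D (u n) p < eps).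

Definition kob_geodesic {d} (D : Cd d -> Prop) (gamma : R -> Cd d) (a b : R) : Prop :=
  a <= b /\
  (forall t, a <= t <= b -> D (gamma t)) /\
  (forall s t, a <= s <= b -> a <= t <= b -> kob D (gamma s) (gamma t) = Rabs (s - t)).

Definition visibility {d} (D : Cd d -> Prop) : Prop :=
  forall x y, bdry D x -> bdry D y -> x <> y ->
    exists (Ux Uy K : Cd d -> Prop),
      is_open Ux /\ Ux x /\ is_open Uy /\ Uy y /\
      (forall z, Ux z -> Uy z -> False) /\
      is_compact K /\ (forall z, K z -> D z) /\
      forall gamma a b, kob_geodesic D gamma a b -> Ux (gamma a) -> Uy (gamma b) ->
        exists t, a <= t <= b /\ K (gamma t).

Definition C1_on {d} (W : Cd d -> Prop) (rho : Cd d -> R) (g : Cd d -> Cd d) : Prop :=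
  (forall z, W z -> forall eps, 0 < eps -> exists del, 0 < del /\
     forall h, vnorm h < del ->
       Rabs (rho (vadd z h) - rho z - rinner (g z) h) <= eps * vnorm h) /\
  (forall z, W z -> forall eps, 0 < eps -> exists del, 0 < del /\
     forall w, W w -> vdist w z < del -> vdist (g w) (g z) < eps).

(** x in bdry Omega is Dini-smooth: near x, bdry Omega is a C^1 hypersurface
    (given by a local C^1 defining function rho with nonvanishing gradient), whose
    unit (outward) normal field nu = grad rho / |grad rho| has a modulus of
    continuity omega with  int_0^eps omega(t)/t dt < oo. *)
Definition dini_smooth_point {d} (Omega : Cd d -> Prop) (x : Cd d) : Prop :=
  exists (W : Cd d -> Prop) (rho : Cd d -> R) (g : Cd d -> Cd d),
    is_open W /\ W x /\ C1_on W rho g /\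
    (forall z, W z -> g z <> vzero) /\
    (forall z, W z -> (Omega z <-> rho z < 0)) /\
    let nu := fun p => vrscal (/ vnorm (g p)) (g p) in
    exists omega : R -> R,
      (forall s t, 0 <= s -> s <= t -> 0 <= omega s <= omega t) /\
      (forall p q, W p -> bdry Omega p -> W q -> bdry Omega q ->
         vdist (nu p) (nu q) <= omega (vdist p q)) /\
      exists eps M, 0 < eps /\
        forall del, 0 < del < eps ->
          ex_RInt (fun t => omega t / t) del eps /\
          RInt (fun t => omega t / t) del eps <= M.

Definition dini_smooth_boundary {d} (Omega : Cd d -> Prop) : Prop :=
  forall x, bdry Omega x -> dini_smooth_point Omega x.

Definition image_chart {d} (Omega V : Cd d -> Prop) (Phi : Cd d -> Cd d) : Cd d -> Prop :=
  fun y => exists z, V z /\ Omega z /\ Phi z = y.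


Definition local_convex_chart {d} (Omega : Cd d -> Prop) (x : Cd d)
    (U V : Cd d -> Prop) (Phi : Cd d -> Cd d) : Prop :=
  is_open U /\ is_open V /\ U x /\ V x /\
  is_bounded V /\ (forall z, closure V z -> U z) /\
  holomorphic_on U Phi /\
  (forall z w, U z -> U w -> Phi z = Phi w -> z = w) /\
  is_open (image_chart Omega V Phi) /\ is_convex (image_chart Omega V Phi).

Definition limsup_at {d} (Omega : Cd d -> Prop) (x : Cd d) (F : Cd d -> R) : Rbar :=
  Glb_Rbar (fun s => exists del, 0 < del /\
    Finite s = Lub_Rbar (fun y => exists w, Omega w /\ vdist w x < del /\ y = F w)).

Definition liminf_at {d} (Omega : Cd d -> Prop) (x : Cd d) (F : Cd d -> R) : Rbar :=
  Lub_Rbar (fun s => exists del, 0 < del /\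
    Finite s = Glb_Rbar (fun y => exists w, Omega w /\ vdist w x < del /\ y = F w)).

Definition horo_small {d} (Omega : Cd d -> Prop) (o x : Cd d) (Rad : R) : Cd d -> Prop :=
  fun z => Omega z /\
    Rbar_lt (limsup_at Omega x (fun w => kob Omega z w - kob Omega o w)) (/ 2 * ln Rad).

Definition horo_big {d} (Omega : Cd d -> Prop) (o x : Cd d) (Rad : R) : Cd d -> Prop :=
  fun z => Omega z /\
    Rbar_lt (liminf_at Omega x (fun w => kob Omega z w - kob Omega o w)) (/ 2 * ln Rad).

(* Main.v *)
(** Localization.  Let [D] be the convex image of [Om] near a boundary point [x], [q] a
    base point of [D].  Supporting half-spaces give
    [kob D q z >= 1/2 ln (1 / dist z (bdry D)) - C], so [D] is proper and geodesic, and
    visibility makes the Gromov product based at [q] bounded for pairs of points near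
    distinct boundary points.  A disc in [Om] based at [z] stays in the chart up to
    hyperbolic radius [s = kob Om z (complement of the chart)], which costs a factor
    [coth s]; by visibility [s] grows linearly in [kob D q z].  Hence the error is summable
    along almost minimizing chains of [Om], and
    [kob Om w z >= kob D q w + kob Om o z - C] for [w] near [x] and [z] away from [x].

    Dini smoothness.  Off-centre discs in the complex normal lines give
    [kob Om (xi - s nu) (xi - t nu) <= 1/2 ln (t / s) + C] for boundary points [xi] near
    [x].  With [t] fixed and the lower bound in [D] this yields
    [kob Om o w <= kob D q w + C], so Gromov products in [Om] of points near distinct
    boundary points are bounded, and a big horosphere at [x] cannot accumulate elsewhere.
    With [t] variable it yields [kob Om (x - t nu) w - kob Om o w <= 1/2 ln t + C] as
    [w -> x], so [x - t nu] enters every small horosphere at [x]. *)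

Require Import Defs.
From Stdlib Require Import Arith Reals Lra Lia Psatz FunctionalExtensionality Classical ClassicalEpsilon.
From Stdlib Require Vectors.Fin.
From Coquelicot Require Import Coquelicot.
Open Scope R_scope.

(** * Goursat's lemma for closed forms on rectangles *)

(** Since [kob] is an infimum over chains, a lower bound needs a function that grows along each disc
    by at most its Poincare length. All such functions below descend from Harnack's inequality for
    maps of the disc to a half-plane, applied to logarithms of distances to hyperplanes. Discs are
    only pointwise complex differentiable, with no continuity of the derivative, so Harnack's
    inequality is built up from Goursat's bisection. The obstacle is that [Phi] comes without a
    holomorphic inverse: discs of [Om] can be pushed to the convex image, but none can be pulled
    back. The reverse comparison, up to a constant, passes through the logarithm of the distance to
    the boundary, bounded above in [Om] by discs and below in the image by convexity. No
    infinitesimal metric appears. Chains are cut into steps of length at most [eta], and the factor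
    coth s is paid step by step. Its excess decays exponentially in the length separating the step
    from the vertex closest to the base point, so the sum is dominated by the increments of one
    bounded function, [potential]. The remaining relative error is chosen after the length of the
    chain is known. *)

Definition circulation (P Q : R -> R -> R) (a b c d : R) : R :=
  RInt (fun x => P x c) a b - RInt (fun x => P x d) a b
  + RInt (fun y => Q b y) c d - RInt (fun y => Q a y) c d.

(** The shared [m] is the closedness condition dP/dy = dQ/dx for the form P dx + Q dy.
    Differentiability is asked at the point alone, without continuous partial derivatives. *)
Definition closed_at (P Q : R -> R -> R) (x y : R) : Prop :=
  exists p m q, differentiable_pt_lim P x y p m /\ differentiable_pt_lim Q x y m q.

Lemma differentiable_continuous_slice1 f x y p q :
  differentiable_pt_lim f x y p q -> continuous (fun u => f u y) x.
Proof.
  intros H. apply (ex_derive_continuous (fun u => f u y)).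
  exists p. apply is_derive_Reals. intros eps He.
  destruct (H (mkposreal (eps / 2) ltac:(lra))) as [del Hd].
  exists del. intros h Hh0 Hh.
  specialize (Hd (x + h) y). simpl in Hd.
  replace (x + h - x) with h in Hd by ring.
  rewrite Rminus_diag, Rabs_R0 in Hd.
  specialize (Hd Hh (cond_pos del)).
  rewrite Rmax_left in Hd by apply Rabs_pos.
  assert (0 < Rabs h) by (apply Rabs_pos_lt; auto).
  replace ((f (x + h) y - f x y) / h - p)
    with ((f (x + h) y - f x y - (p * h + q * 0)) / h) by (field; auto).
  unfold Rdiv; rewrite Rabs_mult, Rabs_inv.
  apply (Rmult_lt_reg_r (Rabs h)); auto.
  rewrite Rmult_assoc, Rinv_l by lra. nra.
Qed.

Lemma differentiable_swap f x y p q :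
  differentiable_pt_lim f x y p q ->
  differentiable_pt_lim (fun u v => f v u) y x q p.
Proof.
  intros H eps. destruct (H eps) as [del Hd]. exists del.
  intros u v Hu Hv. rewrite Rmax_comm, (Rplus_comm (q * _)). apply Hd; auto.
Qed.

Lemma differentiable_continuous_slice2 f x y p q :
  differentiable_pt_lim f x y p q -> continuous (fun v => f x v) y.
Proof.
  intros H. apply differentiable_swap in H.
  apply (differentiable_continuous_slice1 _ _ _ _ _ H).
Qed.

Section Goursat.
Variables (P Q : R -> R -> R) (a0 b0 c0 d0 : R).
Hypothesis Hab0 : a0 <= b0.
Hypothesis Hcd0 : c0 <= d0.
Hypothesis Hcl : forall x y, a0 <= x <= b0 -> c0 <= y <= d0 -> closed_at P Q x y.

Lemma ex_RInt_row a b y : a0 <= a -> a <= b -> b <= b0 -> c0 <= y <= d0 ->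
  ex_RInt (fun x => P x y) a b.
Proof.
  intros. apply (ex_RInt_continuous (V := R_CompleteNormedModule)).
  intros z Hz. rewrite Rmin_left, Rmax_right in Hz by lra.
  destruct (Hcl z y) as (p & m & q & H3 & H4); try lra.
  apply (differentiable_continuous_slice1 _ _ _ _ _ H3).
Qed.

Lemma ex_RInt_col c d x : c0 <= c -> c <= d -> d <= d0 -> a0 <= x <= b0 ->
  ex_RInt (fun y => Q x y) c d.
Proof.
  intros. apply (ex_RInt_continuous (V := R_CompleteNormedModule)).
  intros z Hz. rewrite Rmin_left, Rmax_right in Hz by lra.
  destruct (Hcl x z) as (p & m & q & H3 & H4); try lra.
  apply (differentiable_continuous_slice2 _ _ _ _ _ H4).
Qed.

Definition rect : Type := (R * R * (R * R))%type.
Definition in_rect0 (r : rect) : Prop :=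
  let '(a, b, (c, d)) := r in a0 <= a /\ a <= b /\ b <= b0 /\ c0 <= c /\ c <= d /\ d <= d0.
Definition circ (r : rect) : R := let '(a, b, (c, d)) := r in circulation P Q a b c d.

(** Keeps a quarter that carries at least a fourth of the circulation in absolute value. The last
    quarter is a default, justified in [quarter_spec]. *)
Definition quarter (r : rect) : rect :=
  let '(a, b, (c, d)) := r in
  let m := (a + b) / 2 in
  let k := (c + d) / 2 in
  let J := Rabs (circ r) / 4 in
  if Rle_dec J (Rabs (circ (a, m, (c, k)))) then (a, m, (c, k)) else
  if Rle_dec J (Rabs (circ (m, b, (c, k)))) then (m, b, (c, k)) else
  if Rle_dec J (Rabs (circ (a, m, (k, d)))) then (a, m, (k, d)) else (m, b, (k, d)).

Lemma circ_split a b c d : in_rect0 (a, b, (c, d)) ->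
  let m := (a + b) / 2 in
  let k := (c + d) / 2 in
  circ (a, b, (c, d)) = circ (a, m, (c, k)) + circ (m, b, (c, k))
    + circ (a, m, (k, d)) + circ (m, b, (k, d)).
Proof.
  intros (H1 & H2 & H3 & H4 & H5 & H6) m k. unfold circ, circulation.
  assert (a <= m <= b /\ c <= k <= d) as [Hm Hk] by (unfold m, k; lra).
  rewrite <- (RInt_Chasles (fun x => P x c) a m b) by (apply ex_RInt_row; lra).
  rewrite <- (RInt_Chasles (fun x => P x d) a m b) by (apply ex_RInt_row; lra).
  rewrite <- (RInt_Chasles (fun y => Q a y) c k d) by (apply ex_RInt_col; lra).
  rewrite <- (RInt_Chasles (fun y => Q b y) c k d) by (apply ex_RInt_col; lra).
  unfold plus; simpl. ring.
Qed.

Lemma quarter_spec r : in_rect0 r ->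
  in_rect0 (quarter r) /\ Rabs (circ r) / 4 <= Rabs (circ (quarter r)) /\
  snd (fst (quarter r)) - fst (fst (quarter r)) = (snd (fst r) - fst (fst r)) / 2 /\
  snd (snd (quarter r)) - fst (snd (quarter r)) = (snd (snd r) - fst (snd r)) / 2 /\
  fst (fst r) <= fst (fst (quarter r)) /\ snd (fst (quarter r)) <= snd (fst r) /\
  fst (snd r) <= fst (snd (quarter r)) /\ snd (snd (quarter r)) <= snd (snd r).
Proof.
  destruct r as [[a b] [c d]]. intros Hr. pose proof (circ_split a b c d Hr) as Hs.
  destruct Hr as (H1 & H2 & H3 & H4 & H5 & H6). cbv zeta in Hs.
  unfold quarter. cbv zeta.
  set (m := (a + b) / 2) in *. set (k := (c + d) / 2) in *.
  assert (a <= m <= b /\ c <= k <= d) as [Hm Hk] by (unfold m, k; lra).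
  repeat match goal with |- context [Rle_dec ?u ?v] => destruct (Rle_dec u v) end;
  cbn [fst snd in_rect0]; (split; [ unfold in_rect0; lra | ]);
  (split; [| unfold m, k in *; lra]); try lra.
  (* Default case: three quarters carry less than a fourth each, so the triangle inequality leaves
     at least a fourth to the last one. *)
  apply Rnot_le_lt in n, n0, n1. rewrite Hs in n, n0, n1 |- *.
  set (x1 := circ (a, m, (c, k))) in *. set (x2 := circ (m, b, (c, k))) in *.
  set (x3 := circ (a, m, (k, d))) in *. set (x4 := circ (m, b, (k, d))) in *.
  pose proof (Rabs_triang (x1 + x2 + x3) x4).
  pose proof (Rabs_triang (x1 + x2) x3). pose proof (Rabs_triang x1 x2). lra.
Qed.

Fixpoint quarters (n : nat) : rect :=
  match n with O => (a0, b0, (c0, d0)) | S n => quarter (quarters n) end.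

Lemma quarters_spec n :
  in_rect0 (quarters n) /\
  Rabs (circ (a0, b0, (c0, d0))) / 4 ^ n <= Rabs (circ (quarters n)) /\
  snd (fst (quarters n)) - fst (fst (quarters n)) = (b0 - a0) / 2 ^ n /\
  snd (snd (quarters n)) - fst (snd (quarters n)) = (d0 - c0) / 2 ^ n.
Proof.
  induction n as [|n (IH1 & IH2 & IH3 & IH4)].
  - simpl. rewrite !Rdiv_1_r. repeat split; lra.
  - destruct (quarter_spec _ IH1) as (K1 & K2 & K3 & K4 & _).
    cbn [quarters]. split; auto. rewrite K3, K4, IH3, IH4.
    assert (0 < 4 ^ n) by (apply pow_lt; lra). assert (0 < 2 ^ n) by (apply pow_lt; lra).
    split; [| simpl; split; field; lra].
    apply Rle_trans with (2 := K2).
    replace (Rabs (circ (a0, b0, (c0, d0))) / 4 ^ S n)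
      with (Rabs (circ (a0, b0, (c0, d0))) / 4 ^ n / 4) by (simpl; field; lra). lra.
Qed.

Lemma nested_point (u v : nat -> R) :
  (forall n, u n <= v n) -> (forall n, u n <= u (S n)) -> (forall n, v (S n) <= v n) ->
  exists x, forall n, u n <= x <= v n.
Proof.
  intros H1 H2 H3.
  assert (Hu : forall n k, u n <= u (k + n)%nat).
  { induction k; simpl; [lra|]. eapply Rle_trans; [apply IHk|apply H2]. }
  assert (Hv : forall n k, v (k + n)%nat <= v n).
  { induction k; simpl; [lra|]. eapply Rle_trans; [apply H3|apply IHk]. }
  assert (Huv : forall n m, u n <= v m).
  { intros n m. eapply Rle_trans; [apply (Hu n m)|]. rewrite Nat.add_comm.
    eapply Rle_trans; [apply H1|]. apply Hv. }
  destruct (completeness (fun x => exists n, x = u n)) as [x [Hx1 Hx2]].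
  - exists (v 0%nat). intros x [n ->]. apply Huv.
  - exists (u 0%nat), 0%nat. reflexivity.
  - exists x. intros n. split; [apply Hx1; exists n; reflexivity|].
    apply Hx2. intros y [m ->]. apply Huv.
Qed.

Lemma quarters_point : exists x y, forall n,
  fst (fst (quarters n)) <= x <= snd (fst (quarters n)) /\
  fst (snd (quarters n)) <= y <= snd (snd (quarters n)).
Proof.
  assert (Hin : forall n, fst (fst (quarters n)) <= snd (fst (quarters n)) /\
     fst (snd (quarters n)) <= snd (snd (quarters n))).
  { intros n. destruct (quarters_spec n) as [H _].
    destruct (quarters n) as [[? ?] [? ?]]; simpl in *; lra. }
  assert (Hq : forall n, _) by (intros n; exact (quarter_spec _ (proj1 (quarters_spec n)))).
  destruct (nested_point (fun n => fst (fst (quarters n))) (fun n => snd (fst (quarters n)))) as [x Hx];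
    try (intros n; specialize (Hq n); specialize (Hin n); cbn [quarters]; lra).
  destruct (nested_point (fun n => fst (snd (quarters n))) (fun n => snd (snd (quarters n)))) as [y Hy];
    try (intros n; specialize (Hq n); specialize (Hin n); cbn [quarters]; lra).
  exists x, y. intros n. split; [apply Hx | apply Hy].
Qed.

(** The affine part of a form closed at (x, y) has zero circulation, and the remainder is small
    relative to the sides. In [E1] and [E2] the affine parts of opposite sides differ by the
    constants [m * (d - c)] and [m * (b - a)], whose integrals cancel. *)
Lemma circ_small x y : a0 <= x <= b0 -> c0 <= y <= d0 ->
  forall eps, 0 < eps -> exists del, 0 < del /\ forall a b c d,
    in_rect0 (a, b, (c, d)) -> a <= x <= b -> c <= y <= d -> b - a < del -> d - c < del ->
    Rabs (circ (a, b, (c, d))) <= eps * (b - a + (d - c)) ^ 2.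
Proof.
  intros Hx Hy eps He. destruct (Hcl x y Hx Hy) as (p & m & q & HP & HQ).
  destruct (HP (mkposreal (eps / 2) ltac:(lra))) as [d1 Hd1].
  destruct (HQ (mkposreal (eps / 2) ltac:(lra))) as [d2 Hd2]. cbn [pos] in *.
  exists (Rmin d1 d2). pose proof (cond_pos d1). pose proof (cond_pos d2).
  split; [apply Rmin_pos; auto|].
  intros a b c d (H1 & H2 & H3 & H4 & H5 & H6) Hxa Hyc Hdx Hdy.
  pose proof (Rmin_l d1 d2). pose proof (Rmin_r d1 d2).
  set (s := b - a + (d - c)).
  assert (EP : forall u v, a <= u <= b -> c <= v <= d ->
    Rabs (P u v - P x y - (p * (u - x) + m * (v - y))) <= eps / 2 * s).
  { intros u v Hu Hv. eapply Rle_trans; [apply Hd1|].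
    - apply Rabs_lt_between'; lra. - apply Rabs_lt_between'; lra.
    - apply Rmult_le_compat_l; [lra|]. unfold s.
      apply Rmax_lub; apply Rabs_le_between; lra. }
  assert (EQ : forall u v, a <= u <= b -> c <= v <= d ->
    Rabs (Q u v - Q x y - (m * (u - x) + q * (v - y))) <= eps / 2 * s).
  { intros u v Hu Hv. eapply Rle_trans; [apply Hd2|].
    - apply Rabs_lt_between'; lra. - apply Rabs_lt_between'; lra.
    - apply Rmult_le_compat_l; [lra|]. unfold s.
      apply Rmax_lub; apply Rabs_le_between; lra. }
  assert (E1 : Rabs (RInt (fun u => P u c - P u d + m * (d - c)) a b) <= (b - a) * (eps * s)).
  { apply abs_RInt_le_const; auto.
    - apply (ex_RInt_plus (V := R_NormedModule)); [|apply ex_RInt_const].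
      apply (ex_RInt_minus (V := R_NormedModule)); apply ex_RInt_row; lra.
    - intros u Hu. pose proof (EP u c Hu ltac:(lra)) as E3. pose proof (EP u d Hu ltac:(lra)) as E4.
      apply Rabs_le_between in E3. apply Rabs_le_between in E4. apply Rabs_le_between. lra. }
  assert (E2 : Rabs (RInt (fun v => Q b v - Q a v - m * (b - a)) c d) <= (d - c) * (eps * s)).
  { apply abs_RInt_le_const; auto.
    - apply (ex_RInt_minus (V := R_NormedModule)); [|apply ex_RInt_const].
      apply (ex_RInt_minus (V := R_NormedModule)); apply ex_RInt_col; lra.
    - intros v Hv. pose proof (EQ a v ltac:(lra) Hv) as E3. pose proof (EQ b v ltac:(lra) Hv) as E4.
      apply Rabs_le_between in E3. apply Rabs_le_between in E4. apply Rabs_le_between. lra. }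
  rewrite (RInt_plus (V := R_CompleteNormedModule) (fun u => P u c - P u d) (fun _ => m * (d - c))) in E1.
  2: apply (ex_RInt_minus (V := R_NormedModule)); apply ex_RInt_row; lra.
  2: apply ex_RInt_const.
  rewrite (RInt_minus (V := R_CompleteNormedModule) (fun u => P u c) (fun u => P u d)) in E1 by (apply ex_RInt_row; lra).
  rewrite RInt_const in E1.
  rewrite (RInt_minus (V := R_CompleteNormedModule) (fun v => Q b v - Q a v) (fun _ => m * (b - a))) in E2.
  2: apply (ex_RInt_minus (V := R_NormedModule)); apply ex_RInt_col; lra.
  2: apply ex_RInt_const.
  rewrite (RInt_minus (V := R_CompleteNormedModule) (fun v => Q b v) (fun v => Q a v)) in E2 by (apply ex_RInt_col; lra).
  rewrite RInt_const in E2.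
  unfold circ, circulation.
  unfold plus, minus, opp, scal in E1, E2; simpl in E1, E2. unfold mult in E1, E2; simpl in E1, E2.
  unfold plus, opp in E1, E2; simpl in E1, E2.
  apply Rabs_le_between in E1. apply Rabs_le_between in E2. apply Rabs_le_between.
  replace (eps * s ^ 2) with ((b - a) * (eps * s) + (d - c) * (eps * s)) by (unfold s; ring). lra.
Qed.

(** Each bisection keeps at least a fourth of the circulation and divides the square of width plus
    height by exactly four. A nonzero circulation then contradicts [circ_small] at the point common
    to all quarters. *)
Theorem goursat : circulation P Q a0 b0 c0 d0 = 0.
Proof.
  destruct quarters_point as (x & y & Hxy).
  destruct (Req_dec (circulation P Q a0 b0 c0 d0) 0) as [|Hne]; auto. exfalso.
  set (J := Rabs (circulation P Q a0 b0 c0 d0)).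
  assert (HJ : 0 < J) by (apply Rabs_pos_lt; auto).
  set (S0 := (b0 - a0 + (d0 - c0))). 
  pose proof (Hxy 0%nat) as H0. simpl in H0.
  set (eps := J / (2 * (S0 ^ 2 + 1))).
  assert (HS : 0 < S0 ^ 2 + 1) by nra.
  assert (He : 0 < eps) by (apply Rdiv_lt_0_compat; lra).
  destruct (circ_small x y ltac:(lra) ltac:(lra) eps He) as (del & Hdel & Hs).
  destruct (pow_lt_1_zero (1/2) ltac:(rewrite Rabs_right; lra) (del / (S0 + 1))) as [N HN].
  { apply Rdiv_lt_0_compat; auto. unfold S0; lra. }
  specialize (HN N (Nat.le_refl _)).
  rewrite Rabs_right in HN by (apply Rle_ge, pow_le; lra).
  destruct (quarters_spec N) as (K1 & K2 & K3 & K4). specialize (Hxy N).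
  destruct (quarters N) as [[a b] [c d]]. cbn [fst snd] in *.
  assert (Hp : 0 < 2 ^ N) by (apply pow_lt; lra).
  replace ((1/2)^N) with (/ 2 ^ N) in HN by (rewrite <- pow_inv; f_equal; lra).
  assert (HN' : (S0 + 1) / 2 ^ N < del).
  { apply (Rmult_lt_compat_r (S0 + 1)) in HN; [|unfold S0; lra].
    unfold Rdiv in HN |- *. rewrite Rmult_assoc, Rinv_l in HN by (unfold S0; lra). lra. }
  assert (HS1 : forall t, t <= S0 + 1 -> t / 2 ^ N < del).
  { intros t Ht. eapply Rle_lt_trans; [|apply HN']. unfold Rdiv.
    apply Rmult_le_compat_r; [left; apply Rinv_0_lt_compat; auto|auto]. }
  assert (Hcc : Rabs (circ (a, b, (c, d))) <= eps * (b - a + (d - c)) ^ 2).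
  { apply Hs; auto; try tauto.
    - rewrite K3. apply HS1. unfold S0; lra.
    - rewrite K4. apply HS1. unfold S0; lra. }
  rewrite K3, K4 in Hcc. unfold circ at 1 in K2. fold J in K2.
  assert (J / 4 ^ N <= eps * S0 ^ 2 / 4 ^ N).
  { eapply Rle_trans; [apply K2|]. eapply Rle_trans; [apply Hcc|]. right.
    replace 4 with (2 * 2) by ring. rewrite Rpow_mult_distr. unfold S0. field. lra. }
  assert (0 < 4 ^ N) by (apply pow_lt; lra).
  assert (J <= eps * S0 ^ 2).
  { apply (Rmult_le_reg_r (/ 4 ^ N)); [apply Rinv_0_lt_compat; auto|]. apply H. }
  assert (eps * (2 * (S0 ^ 2 + 1)) = J) by (unfold eps; field; lra). nra.
Qed.
End Goursat.

(** * Complex differentiability and circle means *)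

Definition cdiff (f : C -> C) (z l : C) : Prop :=
  forall eps, 0 < eps -> exists del, 0 < del /\ forall h, Cmod h < del ->
    Cmod (f (z + h) - f z - l * h)%C <= eps * Cmod h.

Notation is_Cderive := (@is_derive C_AbsRing (AbsRing_NormedModule C_AbsRing)).

(** Transfers the sum, product and chain rules of [is_derive] to [cdiff]. *)
Lemma cdiff_is_Cderive f z l : cdiff f z l <-> is_Cderive f z l.
Proof.
  split.
  - intros H. split; [apply is_linear_scal_l|]. intros x Hx eps.
    apply (is_filter_lim_locally_unique (V := AbsRing_NormedModule C_AbsRing)) in Hx. subst x.
    destruct (H eps (cond_pos eps)) as (del & Hd & K).
    exists (mkposreal del Hd). intros y' Hy. pose (y := y' : C). change y' with y in Hy |- *. clearbody y. clear y'.
    specialize (K (y - z)%C Hy). replace (z + (y - z))%C with y in K by ring.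
    unfold norm, minus, scal, plus, opp, abs; simpl. unfold abs, mult; simpl.
    replace (f y + - f z + - ((y + - z) * l))%C with (f y - f z - l * (y - z))%C by ring.
    apply K.
  - intros [_ H] eps He. specialize (H z (fun P H => H) (mkposreal eps He)).
    destruct H as [del Hd]. exists del. split; [apply cond_pos|].
    intros h Hh. specialize (Hd (z + h)%C).
    unfold norm, minus, scal, plus, opp, abs in Hd; simpl in Hd. unfold mult in Hd; simpl in Hd.
    replace (f (z + h)%C + - f z + - ((z + h + - z) * l))%C
      with (f (z + h) - f z - l * h)%C in Hd by ring.
    replace (z + h + - z)%C with h in Hd by ring. apply Hd.
    unfold ball; simpl. unfold AbsRing_ball, minus, plus, opp, abs; simpl.
    replace (z + h + - z)%C with h by ring. exact Hh.
Qed.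

Lemma cdiff_unique_eq f z l l' : cdiff f z l -> l = l' -> cdiff f z l'.
Proof. intros; subst; auto. Qed.

Lemma cdiff_const c z : cdiff (fun _ => c) z 0.
Proof.
  intros eps He. exists 1. split; [lra|]. intros h _.
  replace (c - c - 0 * h)%C with (0:C) by ring. rewrite Cmod_0.
  apply Rmult_le_pos; [lra|apply Cmod_ge_0].
Qed.

Lemma cdiff_id z : cdiff (fun w => w) z 1.
Proof.
  intros eps He. exists 1. split; [lra|]. intros h _.
  replace (z + h - z - 1 * h)%C with (0:C) by ring. rewrite Cmod_0.
  apply Rmult_le_pos; [lra|apply Cmod_ge_0].
Qed.

Lemma cdiff_plus f g z l m : cdiff f z l -> cdiff g z m ->
  cdiff (fun w => f w + g w)%C z (l + m)%C.
Proof.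
  rewrite !cdiff_is_Cderive. intros H1 H2.
  apply (is_derive_plus (K := C_AbsRing) (V := AbsRing_NormedModule C_AbsRing) f g z l m H1 H2).
Qed.

Lemma cdiff_mult f g z l m : cdiff f z l -> cdiff g z m ->
  cdiff (fun w => f w * g w)%C z (l * g z + f z * m)%C.
Proof.
  rewrite !cdiff_is_Cderive. intros H1 H2.
  apply (is_derive_mult (K := C_AbsRing) f g z l m H1 H2 Cmult_comm).
Qed.

Lemma cdiff_comp f g z l m : cdiff f (g z) l -> cdiff g z m ->
  cdiff (fun w => f (g w)) z (m * l)%C.
Proof.
  rewrite !cdiff_is_Cderive. intros H1 H2.
  apply (is_derive_comp (K := C_AbsRing) (V := AbsRing_NormedModule C_AbsRing) f g z l m H1 H2).
Qed.

Lemma cdiff_ext_loc f g z l r : 0 < r -> (forall w, Cmod (w - z)%C < r -> f w = g w) ->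
  cdiff f z l -> cdiff g z l.
Proof.
  intros Hr He H eps Hp. destruct (H eps Hp) as (del & Hd & K).
  exists (Rmin del r). split; [apply Rmin_pos; auto|]. intros h Hh.
  pose proof (Rmin_l del r). pose proof (Rmin_r del r).
  rewrite <- !He. - apply K; lra.
  - replace (z - z)%C with (0:C) by ring. rewrite Cmod_0; lra.
  - replace (z + h - z)%C with h by ring. lra.
Qed.

Lemma cdiff_inv (z : C) : z <> 0 -> cdiff (fun w => / w)%C z (- / (z * z))%C.
Proof.
  intros Hz eps He. pose proof (proj1 (Cmod_gt_0 z) Hz) as Hm. set (r := Cmod z) in *.
  exists (Rmin (r / 2) (eps * r ^ 3 / 2)).
  assert (0 < r ^ 3) by (apply pow_lt; auto).
  split; [apply Rmin_pos; nra|]. intros h Hh.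
  pose proof (Rmin_l (r / 2) (eps * r ^ 3 / 2)). pose proof (Rmin_r (r / 2) (eps * r ^ 3 / 2)).
  assert (Hzh : r / 2 <= Cmod (z + h)%C).
  { pose proof (Cmod_triangle (z + h) (- h)). replace (z + h + - h)%C with z in H2 by ring.
    rewrite Cmod_opp in H2. fold r in H2. lra. }
  assert (z + h <> 0)%C by (apply Cmod_gt_0; lra).
  replace (/ (z + h) - / z - - / (z * z) * h)%C with (h * h / (z * z * (z + h)))%C by (field; auto).
  rewrite Cmod_div by (repeat apply Cmult_neq_0; auto). rewrite !Cmod_mult. fold r.
  pose proof (Cmod_ge_0 h).
  assert (0 < r * r * Cmod (z + h)) by (repeat apply Rmult_lt_0_compat; lra).
  apply (Rmult_le_reg_r (r * r * Cmod (z + h))); auto.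
  unfold Rdiv at 1. rewrite Rmult_assoc, Rinv_l by lra. rewrite Rmult_1_r.
  apply Rle_trans with (eps * Cmod h * (r * r * (r / 2))).
  - replace (eps * Cmod h * (r * r * (r / 2))) with (Cmod h * (eps * r ^ 3 / 2)) by field.
    apply Rmult_le_compat_l; lra.
  - apply Rmult_le_compat_l; [apply Rmult_le_pos; lra|].
    apply Rmult_le_compat_l; [nra|lra].
Qed.

Lemma cdiff_continuous f z l : cdiff f z l ->
  forall eps, 0 < eps -> exists del, 0 < del /\ forall w, Cmod (w - z)%C < del -> Cmod (f w - f z)%C < eps.
Proof.
  intros H eps He. destruct (H 1 Rlt_0_1) as (del & Hd & K).
  pose proof (Cmod_ge_0 l).
  exists (Rmin del (eps / (2 + Cmod l))).
  split; [apply Rmin_pos; auto; apply Rdiv_lt_0_compat; lra|]. intros w Hw.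
  pose proof (Rmin_l del (eps / (2 + Cmod l))). pose proof (Rmin_r del (eps / (2 + Cmod l))).
  specialize (K (w - z)%C ltac:(lra)). replace (z + (w - z))%C with w in K by ring.
  pose proof (Cmod_triangle (f w - f z - l * (w - z)) (l * (w - z))) as T.
  replace (f w - f z - l * (w - z) + l * (w - z))%C with (f w - f z)%C in T by ring.
  rewrite Cmod_mult in T. pose proof (Cmod_ge_0 (w - z)%C).
  assert (Cmod (w - z)%C * (2 + Cmod l) < eps).
  { apply (Rmult_lt_reg_r (/ (2 + Cmod l))); [apply Rinv_0_lt_compat; lra|].
    rewrite Rmult_assoc, Rinv_r by lra. unfold Rdiv in *. lra. }
  lra.
Qed.

(** The complex exponential of s + i t. It is conformal, so the Cauchy-Riemann equations persist in
    (s, t), and circles about 0 become vertical segments. *)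
Definition polar (s t : R) : C := (exp s * cos t, exp s * sin t).

Lemma Cmod_polar s t : Cmod (polar s t) = exp s.
Proof.
  unfold Cmod, polar; simpl.
  replace (exp s * cos t * (exp s * cos t * 1) + exp s * sin t * (exp s * sin t * 1))
    with (exp s * exp s * (Rsqr (sin t) + Rsqr (cos t))) by (unfold Rsqr; ring).
  rewrite sin2_cos2, Rmult_1_r. apply sqrt_square. left; apply exp_pos.
Qed.

Lemma differentiable_pt_lim_mult2 x y : differentiable_pt_lim (fun u v => u * v) x y y x.
Proof.
  intros eps. exists eps. intros u v Hu Hv.
  replace (u * v - x * y - (y * (u - x) + x * (v - y))) with ((v - y) * (u - x)) by ring.
  rewrite Rabs_mult. apply Rmult_le_compat; try apply Rabs_pos; try lra. apply Rmax_l.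
Qed.

Lemma derive_exp_cos s t : differentiable_pt_lim (fun s t => exp s * cos t) s t
  (exp s * cos t) (- (exp s * sin t)).
Proof.
  replace (exp s * cos t) with (cos t * exp s + exp s * 0) at 1 by ring.
  replace (- (exp s * sin t)) with (cos t * 0 + exp s * - sin t) by ring.
  apply (differentiable_pt_lim_comp (fun u v => u * v) (fun s _ => exp s) (fun _ t => cos t)).
  - apply differentiable_pt_lim_mult2.
  - apply differentiable_pt_lim_proj1_0, derivable_pt_lim_exp.
  - apply (differentiable_swap (fun t _ => cos t)).
    apply differentiable_pt_lim_proj1_0, derivable_pt_lim_cos.
Qed.

Lemma derive_exp_sin s t : differentiable_pt_lim (fun s t => exp s * sin t) s t
  (exp s * sin t) (exp s * cos t).
Proof.
  replace (exp s * sin t) with (sin t * exp s + exp s * 0) at 1 by ring.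
  replace (exp s * cos t) with (sin t * 0 + exp s * cos t) by ring.
  apply (differentiable_pt_lim_comp (fun u v => u * v) (fun s _ => exp s) (fun _ t => sin t)).
  - apply differentiable_pt_lim_mult2.
  - apply differentiable_pt_lim_proj1_0, derivable_pt_lim_exp.
  - apply (differentiable_swap (fun t _ => sin t)).
    apply differentiable_pt_lim_proj1_0, derivable_pt_lim_sin.
Qed.

Lemma Cmod_le_2Rmax (x y : R) : Cmod (x, y) <= 2 * Rmax (Rabs x) (Rabs y).
Proof.
  eapply Rle_trans; [apply Cmod_2Rmax|]. simpl.
  apply Rmult_le_compat_r. - eapply Rle_trans; [apply Rabs_pos|apply Rmax_l].
  - rewrite <- (sqrt_square 2) at 2 by lra. apply sqrt_le_1_alt. lra.
Qed.

Lemma im_le_Cmod (c : C) : Rabs (Im c) <= Cmod c.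
Proof. eapply Rle_trans; [|apply Rmax_Cmod]. apply Rmax_r. Qed.

Lemma cdiff_differentiable f x y l : cdiff f (x, y) l ->
  differentiable_pt_lim (fun u v => Re (f (u, v))) x y (Re l) (- Im l) /\
  differentiable_pt_lim (fun u v => Im (f (u, v))) x y (Im l) (Re l).
Proof.
  intros H.
  assert (K : forall eps : posreal, locally_2d (fun u v =>
    Cmod (f (u, v) - f (x, y) - l * ((u - x)%R, (v - y)%R))%C
       <= eps * Rmax (Rabs (u - x)) (Rabs (v - y))) x y).
  { intros eps. destruct (H (eps / 2)) as (del & Hd & K); [destruct eps; simpl; lra|].
    assert (Hd2 : 0 < del / 2) by lra.
    exists (mkposreal _ Hd2). simpl. intros u v Hu Hv.
    pose proof (Cmod_le_2Rmax (u - x) (v - y)) as M.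
    specialize (K (u - x, v - y)).
    replace ((x, y) + ((u - x)%R, (v - y)%R))%C with ((u, v):C) in K
      by (apply injective_projections; simpl; ring).
    eapply Rle_trans; [apply K|].
    - eapply Rle_lt_trans; [apply M|].
      assert (Rmax (Rabs (u - x)) (Rabs (v - y)) < del / 2) by (apply Rmax_lub_lt; auto). lra.
    - destruct eps; simpl in *; nra. }
  split; intros eps; destruct (K eps) as [del Hd]; exists del; intros u v Hu Hv;
    specialize (Hd u v Hu Hv); (eapply Rle_trans; [|apply Hd]).
  - eapply Rle_trans; [|apply re_le_Cmod]. right. f_equal. unfold Re, Im, Cminus, Cplus, Copp, Cmult; simpl. ring.
  - eapply Rle_trans; [|apply im_le_Cmod]. right. f_equal. unfold Re, Im, Cminus, Cplus, Copp, Cmult; simpl. ring.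
Qed.

Lemma polar_differentiable (F : C -> R) s t a b :
  differentiable_pt_lim (fun u v => F (u, v)) (exp s * cos t) (exp s * sin t) a b ->
  differentiable_pt_lim (fun s t => F (polar s t)) s t
    (a * (exp s * cos t) + b * (exp s * sin t)) (a * - (exp s * sin t) + b * (exp s * cos t)).
Proof.
  intros H. apply (differentiable_pt_lim_comp (fun u v => F (u, v)) (fun s t => exp s * cos t)
    (fun s t => exp s * sin t)); auto using derive_exp_cos, derive_exp_sin.
Qed.

(* In the coordinates (s, t) of [polar s t] the Cauchy-Riemann equations make
   [Im f ds + Re f dt] a closed form; both horizontal sides of the period
   rectangle cancel, so the circle mean of [Re f] does not depend on the radius. *)
Lemma circle_mean_const (f : C -> C) s1 s2 : s1 <= s2 -> s2 < 0 ->
  (forall z : C, z <> 0 -> Cmod z < 1 -> exists l, cdiff f z l) ->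
  RInt (fun t => Re (f (polar s1 t))) 0 (2 * PI) = RInt (fun t => Re (f (polar s2 t))) 0 (2 * PI).
Proof.
  intros Hs Hs2 Hf. pose proof PI_RGT_0 as Hpi.
  pose proof (goursat (fun s t => Im (f (polar s t))) (fun s t => Re (f (polar s t)))
    s1 s2 0 (2 * PI) Hs ltac:(lra)) as G.
  match type of G with ?A -> _ => cut A; [intros Hcl; specialize (G Hcl)|clear G] end.
  { unfold circulation in G.
    rewrite (RInt_ext (fun x => Im (f (polar x (2 * PI)))) (fun x => Im (f (polar x 0)))) in G; [lra|].
    intros x _. unfold polar. rewrite cos_2PI, sin_2PI, cos_0, sin_0. reflexivity. }
  intros s t Hst _.
  destruct (Hf (polar s t)) as [l Hl].
  - apply Cmod_gt_0. rewrite Cmod_polar. apply exp_pos.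
  - rewrite Cmod_polar, <- exp_0. apply exp_increasing. lra.
  - destruct (cdiff_differentiable _ _ _ _ Hl) as [DR DI].
    pose proof (polar_differentiable (fun z => Re (f z)) s t _ _ DR) as PR. pose proof (polar_differentiable (fun z => Im (f z)) s t _ _ DI) as PI'.
    do 3 eexists. split; [apply PI'|].
    replace (Im l * - (exp s * sin t) + Re l * (exp s * cos t))
      with (Re l * (exp s * cos t) + - Im l * (exp s * sin t)) by ring. apply PR.
Qed.

Lemma continuous_Re_polar f s t l : cdiff f (polar s t) l ->
  continuous (fun t => Re (f (polar s t))) t.
Proof.
  intros Hl. destruct (cdiff_differentiable _ _ _ _ Hl) as [DR DI].
  apply (differentiable_continuous_slice2 _ _ _ _ _ (polar_differentiable (fun z => Re (f z)) s t _ _ DR)).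
Qed.

(** The mean of [Re f] over a small circle has the sign of [Re (f 0)] and equals the mean over the
    given circle. At 0 only continuity is asked, because the lemma is applied to a function
    containing a difference quotient at 0. *)
Lemma circle_le0_center_le0 (f : C -> C) Rad : 0 < Rad < 1 ->
  (forall z : C, z <> 0 -> Cmod z < 1 -> exists l, cdiff f z l) ->
  (forall eps, 0 < eps -> exists del, 0 < del /\ forall z, Cmod z < del -> Cmod (f z - f 0)%C < eps) ->
  (forall z, Cmod z = Rad -> Re (f z) <= 0) -> Re (f 0) <= 0.
Proof.
  intros HR Hf Hc Hle. destruct (Rle_lt_dec (Re (f 0)) 0) as [|Hpos]; auto. exfalso.
  pose proof PI_RGT_0 as Hpi.
  destruct (Hc (Re (f 0)) Hpos) as (del & Hd & K).
  set (s2 := ln Rad).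
  assert (Hs2 : s2 < 0) by (unfold s2; rewrite <- ln_1; apply ln_increasing; lra).
  (* The inner circle has radius at most [del / 2], where continuity at 0 keeps [Re f] positive. *)
  set (s1 := Rmin s2 (ln (del / 2))).
  assert (H1 : s1 <= s2) by apply Rmin_l.
  assert (exp s1 <= del / 2).
  { rewrite <- (exp_ln (del / 2)) by lra.
    destruct (Rle_lt_or_eq_dec s1 (ln (del / 2)) (Rmin_r _ _)) as [Hl|Hl].
    - left. apply exp_increasing; auto. - rewrite Hl. lra. }
  pose proof (circle_mean_const f s1 s2 H1 Hs2 Hf) as E.
  assert (C : forall s, s < 0 -> forall t, continuous (fun t => Re (f (polar s t))) t).
  { intros s Hs t. destruct (Hf (polar s t)) as [l Hl].
    - apply Cmod_gt_0. rewrite Cmod_polar. apply exp_pos.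
    - rewrite Cmod_polar, <- exp_0. apply exp_increasing. lra.
    - apply (continuous_Re_polar _ _ _ _ Hl). }
  assert (0 < RInt (fun t => Re (f (polar s1 t))) 0 (2 * PI)).
  { apply RInt_gt_0; [lra| |intros; apply C; lra]. intros t _.
    assert (Kp : Cmod (f (polar s1 t) - f 0)%C < Re (f 0)) by (apply K; rewrite Cmod_polar; lra).
    pose proof (re_le_Cmod (f (polar s1 t) - f 0)%C) as L.
    pose proof (Rle_abs (- Re (f (polar s1 t) - f 0)%C)) as L2. rewrite Rabs_Ropp in L2.
    simpl in L2, L, Kp. unfold Re in *. simpl in *. lra. }
  assert (RInt (fun t => Re (f (polar s2 t))) 0 (2 * PI) <= 0).
  { assert (Z : RInt (fun _ : R => 0) 0 (2 * PI) = 0).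
    { rewrite RInt_const. unfold scal; simpl; unfold mult; simpl. ring. }
    apply Rle_trans with (RInt (fun _ : R => 0) 0 (2 * PI)); [|rewrite Z; lra].
    apply RInt_le; [lra| | apply ex_RInt_const |].
    - apply (ex_RInt_continuous (V := R_CompleteNormedModule)). intros; apply C; auto.
    - intros t _. apply Hle. rewrite Cmod_polar. apply exp_ln; lra. }
  lra.
Qed.

(** * Harnack's inequality for holomorphic maps to a half-plane *)

Lemma Cmod_sqr (z : C) : Cmod z * Cmod z = Re z * Re z + Im z * Im z.
Proof. pose proof (Cmod2_alt z). simpl in H. lra. Qed.

Lemma Cmod_lt_sqr (z w : C) : Cmod z * Cmod z < Cmod w * Cmod w -> Cmod z < Cmod w.
Proof. intros. pose proof (Cmod_ge_0 z). pose proof (Cmod_ge_0 w). nra. Qed.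

Ltac cparts := unfold Re, Im, Cminus, Cplus, Copp, Cmult, Cconj, RtoC in *; simpl in *.

(* The function [H] of the proof has real part [(2 - 2 cos t) Re f <= 0] on the circle
   [|z| = Rad], and [H 0 = 2 f 0 - Rad l]. *)
Lemma half_plane_derivative (f : C -> C) (l : C) :
  (forall z, Cmod z < 1 -> exists l, cdiff f z l) -> (forall z, Cmod z < 1 -> Re (f z) <= 0) ->
  cdiff f 0 l -> 2 * Re (f 0) <= Re l.
Proof.
  intros Hf Hle Hl.
  assert (KR : forall Rad, 0 < Rad < 1 -> 2 * Re (f 0) <= Rad * Re l).
  { intros Rad HR.
    assert (HR0 : RtoC Rad <> 0) by (intros E; apply RtoC_inj in E; lra).
    set (Q := fun z : C => if Ceq_dec z 0 then l else ((f z + - f 0) * / z)%C).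
    (* On the circle, [Rad / z] equals [Cconj z / Rad]. The last term of [P] is chosen so that,
       added to the contribution of [f 0] in [- Rad * Q], it is purely imaginary there. *)
    set (P := fun z : C => (2 * f z + - / RtoC Rad * (z * f z) + - (Cconj (f 0) / RtoC Rad) * z)%C).
    set (H := fun z : C => (P z + - RtoC Rad * Q z)%C).
    assert (E0 : H 0 = (2 * f 0 - Rad * l)%C).
    { unfold H, P, Q. destruct (Ceq_dec 0 0); [ring|congruence]. }
    assert (HP : forall z, Cmod z < 1 -> exists m, cdiff P z m).
    { intros z Hz. destruct (Hf z Hz) as [m Hm]. eexists.
      repeat apply cdiff_plus; apply cdiff_mult; try apply cdiff_mult; eauto using cdiff_const, cdiff_id. }
    enough (Re (H 0) <= 0) by (rewrite E0 in H0; cparts; lra).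
    apply circle_le0_center_le0 with Rad; auto.
    - intros z Hz0 Hz1. destruct (HP z Hz1) as [m1 Hm1]. destruct (Hf z Hz1) as [m Hm]. eexists.
      apply cdiff_plus; [apply Hm1|]. apply cdiff_mult; [apply cdiff_const|].
      apply (cdiff_ext_loc (fun z => (f z + - f 0) * / z)%C) with (r := Cmod z).
      + apply Cmod_gt_0; auto.
      + intros w Hw. unfold Q. destruct (Ceq_dec w 0) as [->|]; auto.
        exfalso. replace (0 - z)%C with (- z)%C in Hw by ring. rewrite Cmod_opp in Hw. lra.
      + apply cdiff_mult; [apply cdiff_plus|]; eauto using cdiff_const, cdiff_inv.
    - intros eps He. destruct (HP 0) as [m Hm]; [rewrite Cmod_0; lra|].
      destruct (cdiff_continuous _ _ _ Hm (eps / 2) ltac:(lra)) as (d1 & Hd1 & K1).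
      destruct (Hl (eps / 2) ltac:(lra)) as (d2 & Hd2 & K2).
      exists (Rmin d1 d2). split; [apply Rmin_pos; auto|]. intros z Hz.
      pose proof (Rmin_l d1 d2). pose proof (Rmin_r d1 d2).
      specialize (K1 z). specialize (K2 z).
      replace (z - 0)%C with z in K1 by ring. replace (0 + z)%C with z in K2 by ring.
      specialize (K1 ltac:(lra)). specialize (K2 ltac:(lra)).
      assert (HQ : Cmod (Q z - l) <= eps / 2).
      { unfold Q. destruct (Ceq_dec z 0) as [Hz0|Hz0].
        - replace (l - l)%C with (0 : C) by ring. rewrite Cmod_0; lra.
        - replace ((f z + - f 0) * / z - l)%C with ((f z - f 0 - l * z) / z)%C by (field; auto).
          rewrite Cmod_div by auto. apply Rle_div_l; auto. apply Rlt_gt, Cmod_gt_0; auto. }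
      assert (EQ : (H z - H 0 = (P z - P 0) + - RtoC Rad * (Q z - l))%C).
      { unfold H. replace (Q 0) with l; [ring|]. unfold Q. destruct (Ceq_dec 0 0); congruence. }
      rewrite EQ. eapply Rle_lt_trans; [apply Cmod_triangle|].
      rewrite Cmod_mult, Cmod_opp, Cmod_R, Rabs_right by lra. pose proof (Cmod_ge_0 (Q z - l)). nra.
    - intros z Hz. pose proof (Cmod_sqr z) as Hzz. rewrite Hz in Hzz.
      unfold H, Q. destruct (Ceq_dec z 0) as [->|Hz0]; [rewrite Cmod_0 in Hz; lra|].
      assert (Ez : (/ z = Cconj z * / (RtoC Rad * RtoC Rad))%C).
      { assert (Hc0 : Cconj z <> 0).
        { apply Cmod_gt_0. rewrite Cmod_conj. apply Cmod_gt_0. auto. }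
        replace (RtoC Rad * RtoC Rad)%C with (z * Cconj z)%C; [field; auto|].
        apply injective_projections; cparts; lra. }
      rewrite Ez. unfold P.
      specialize (Hle z ltac:(lra)).
      match goal with |- Re ?X <= 0 => assert (E : Re X = Re (f z) * (2 - 2 * (Re z / Rad))) end.
      { unfold Cdiv. rewrite <- RtoC_inv. - cparts. field. lra. - lra. }
      rewrite E. pose proof (re_le_Cmod z) as Hre. rewrite Hz in Hre.
      apply Rabs_le_between in Hre.
      assert (Re z / Rad <= 1) by (apply Rle_div_l; lra).
      nra. }
  (* [Rad] tends to 1: if the inequality failed, the radius halfway between u / g and 1 would
     violate [KR]. *)
  destruct (Rle_lt_dec (2 * Re (f 0)) (Re l)) as [|Hgt]; auto. exfalso.
  specialize (Hle 0 ltac:(rewrite Cmod_0; lra)).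
  set (g := Re l) in *. set (u := 2 * Re (f 0)) in *. assert (u <= 0) by (unfold u; lra).
  assert (g < 0) by lra.
  assert (Hgu : 0 < (u / g + 1) / 2 < 1).
  { assert (u / g < 1). { apply (Rmult_lt_reg_r (- g)); [lra|]. unfold Rdiv. replace (u * / g * - g) with (- u) by (field; lra). lra. }
    assert (0 <= u / g).
    { unfold Rdiv. replace (u * / g) with ((- u) * / (- g)) by (field; lra). apply Rmult_le_pos; [lra|]. left; apply Rinv_0_lt_compat; lra. }
    lra. }
  specialize (KR _ Hgu). replace ((u / g + 1) / 2 * g) with ((u + g) / 2) in KR by (field; lra). lra.
Qed.

(** For a unimodular [c], the rotation by [c] followed by the automorphism of the disc that moves 0
    to [a]. *)
Definition moebius (a c z : C) : C := ((c * z + a) * / (1 + Cconj a * (c * z)))%C.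

Lemma moebius_denom a z : Cmod a < 1 -> Cmod z < 1 -> (1 + Cconj a * z)%C <> 0.
Proof.
  intros Ha Hz E. assert (E2 : Cmod (Cconj a * z)%C = 1).
  { replace (Cconj a * z)%C with (- (1))%C.
    - apply Cmod_m1. - replace (Cconj a * z)%C with ((1 + Cconj a * z) - 1)%C by ring. rewrite E. ring. }
  rewrite Cmod_mult, Cmod_conj in E2. pose proof (Cmod_ge_0 a). pose proof (Cmod_ge_0 z). nra.
Qed.

(** With w = c z, the squared modulus of the denominator exceeds that of the numerator by (1 -
    |a|^2)(1 - |w|^2). *)
Lemma moebius_disc a c z : Cmod a < 1 -> Cmod c = 1 -> Cmod z < 1 -> Cmod (moebius a c z) < 1.
Proof.
  intros Ha Hc Hz. unfold moebius. set (w := (c * z)%C).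
  assert (Hw : Cmod w < 1) by (unfold w; rewrite Cmod_mult, Hc; lra).
  pose proof (moebius_denom a w Ha Hw) as D.
  rewrite Cmod_mult, Cmod_inv by auto.
  apply Cmod_gt_0 in D. apply (Rmult_lt_reg_r (Cmod (1 + Cconj a * w))); auto.
  rewrite Rmult_assoc, Rinv_l by lra. rewrite Rmult_1_r, Rmult_1_l.
  apply Cmod_lt_sqr. rewrite !Cmod_sqr.
  pose proof (Cmod_sqr a). pose proof (Cmod_sqr w). pose proof (Cmod_ge_0 a). pose proof (Cmod_ge_0 w).
  assert (0 < (1 - Cmod a * Cmod a) * (1 - Cmod w * Cmod w)) by (apply Rmult_lt_0_compat; nra).
  rewrite H, H0 in H3. clearbody w. cparts. nra.
Qed.

Lemma cdiff_moebius a c z : Cmod a < 1 -> Cmod c = 1 -> Cmod z < 1 ->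
  exists l, cdiff (moebius a c) z l.
Proof.
  intros Ha Hc Hz. eexists. unfold moebius.
  assert (Hw : Cmod (c * z)%C < 1) by (rewrite Cmod_mult, Hc; lra).
  apply cdiff_mult.
  - apply cdiff_plus; [apply cdiff_mult|]; eauto using cdiff_const, cdiff_id.
  - apply (cdiff_comp (fun w => / w)%C (fun z => 1 + Cconj a * (c * z))%C).
    + apply cdiff_inv, moebius_denom; auto.
    + apply cdiff_plus; [|apply cdiff_mult; [|apply cdiff_mult]]; eauto using cdiff_const, cdiff_id.
Qed.

Lemma cdiff_moebius_real (T : R) : -1 < T < 1 -> cdiff (moebius T 1) 0 (1 - T * T)%R.
Proof.
  intros HT. assert (HTm : Cmod T < 1) by (rewrite Cmod_R; apply Rabs_lt_between; lra).
  eapply cdiff_unique_eq.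
  - unfold moebius. apply cdiff_mult.
    + apply cdiff_plus; [apply cdiff_mult|]; eauto using cdiff_const, cdiff_id.
    + apply (cdiff_comp (fun w => / w)%C (fun z => 1 + Cconj T * (1 * z))%C).
      * apply cdiff_inv, moebius_denom; auto. rewrite Cmult_0_r, Cmod_0; lra.
      * apply cdiff_plus; [|apply cdiff_mult; [|apply cdiff_mult]]; eauto using cdiff_const, cdiff_id.
  - replace (Cconj T) with (RtoC T) by (apply injective_projections; simpl; lra).
    rewrite RtoC_minus, RtoC_mult. field.
Qed.

Lemma cosh_pos x : 0 < cosh x.
Proof. unfold cosh. pose proof (exp_pos x). pose proof (exp_pos (- x)). lra. Qed.

Lemma tanh_bound x : -1 < tanh x < 1.
Proof.
  unfold tanh. pose proof (cosh_pos x). pose proof (exp_pos x). pose proof (exp_pos (- x)).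
  assert (- cosh x < sinh x < cosh x) by (unfold cosh, sinh; lra).
  split; [apply Rlt_div_r|apply Rlt_div_l]; lra.
Qed.

Lemma cosh2_sinh2 x : cosh x * cosh x - sinh x * sinh x = 1.
Proof.
  unfold cosh, sinh. replace 1 with (exp x * exp (- x)) by (rewrite <- exp_plus, Rplus_opp_r; apply exp_0). field.
Qed.

Lemma is_derive_tanh x : is_derive tanh x (1 - tanh x * tanh x).
Proof.
  pose proof (cosh_pos x). pose proof (cosh2_sinh2 x).
  unfold tanh. replace (1 - _) with ((cosh x * cosh x - sinh x * sinh x) / (cosh x) ^ 2) by (field; lra).
  apply is_derive_div; [| |lra]; apply is_derive_Reals;
    [apply derivable_pt_lim_sinh | apply derivable_pt_lim_cosh].
Qed.

Lemma tanh_0 : tanh 0 = 0.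
Proof. unfold tanh; rewrite sinh_0; unfold Rdiv; ring. Qed.

Lemma tanh_mvt a b : a <= b -> exists c, a <= c <= b /\ tanh b - tanh a = (1 - tanh c * tanh c) * (b - a).
Proof.
  intros Hab. destruct (MVT_gen tanh a b (fun s => 1 - tanh s * tanh s)) as (c & Hc & E).
  - intros s _. apply is_derive_tanh.
  - intros s _. apply continuity_pt_filterlim, (ex_derive_continuous (V := R_NormedModule) tanh).
    eexists; apply is_derive_tanh.
  - rewrite Rmin_left, Rmax_right in Hc by auto. exists c; auto.
Qed.

Lemma tanh_increasing a b : a < b -> tanh a < tanh b.
Proof.
  intros Hab. destruct (tanh_mvt a b ltac:(lra)) as (c & _ & E). pose proof (tanh_bound c).
  assert (0 < (1 - tanh c * tanh c) * (b - a)) by (apply Rmult_lt_0_compat; nra). lra.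
Qed.

Lemma tanh_pos p : 0 < p -> 0 < tanh p.
Proof. intros Hp. rewrite <- tanh_0. apply tanh_increasing; auto. Qed.

Lemma tanh_le p : 0 <= p -> 0 <= tanh p <= p.
Proof.
  intros Hp. destruct (tanh_mvt 0 p Hp) as (c & _ & E). rewrite tanh_0 in E. pose proof (tanh_bound c).
  assert (0 <= tanh c * tanh c < 1) by nra. nra.
Qed.

Lemma is_derive_Re_real (f : C -> C) (x : R) l : cdiff f x l -> is_derive (fun t : R => Re (f t)) x (Re l).
Proof.
  intros H. destruct (cdiff_differentiable f x 0 l H) as [D _].
  apply is_derive_Reals. 
  replace (Re l) with (Re l * 1 + - Im l * 0) by ring.
  apply (derivable_pt_lim_comp_2d (fun u v => Re (f (u, v))) (fun t => t) (fun _ => 0)); auto.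
  - apply derivable_pt_lim_id. - apply derivable_pt_lim_const.
Qed.

(** The path s -> tanh s has unit hyperbolic speed. Moved to the point [tanh s] by a Moebius map,
    [half_plane_derivative] says that [Re f * exp (- 2 s)] is nondecreasing along it. *)
Lemma half_plane_harnack (f : C -> C) p : 0 <= p ->
  (forall z, Cmod z < 1 -> exists l, cdiff f z l) -> (forall z, Cmod z < 1 -> Re (f z) < 0) ->
  - Re (f (tanh p)) <= - Re (f 0) * exp (2 * p).
Proof.
  intros Hp Hf Hneg.
  assert (Ht : forall s, Cmod (tanh s) < 1).
  { intros s. rewrite Cmod_R. apply Rabs_lt_between. pose proof (tanh_bound s); lra. }
  assert (D : forall s, exists df, is_derive (fun s => Re (f (tanh s)) * exp (- (2 * s))) s df /\ 0 <= df).
  { intros s. destruct (Hf (tanh s) (Ht s)) as [l Hl].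
    pose proof (tanh_bound s). set (T := tanh s) in *.
    assert (2 * Re (f T) <= (1 - T * T) * Re l).
    { assert (E0 : moebius T 1 0 = T).
      { unfold moebius. field. }
      pose proof (half_plane_derivative (fun z => f (moebius T 1 z)) ((1 - T * T)%R * l)%C) as S. cbv beta in S.
      rewrite E0 in S. 
      replace (Re ((1 - T * T)%R * l)%C) with ((1 - T * T) * Re l) in S by (cparts; ring).
      apply S.
      - intros z Hz. destruct (cdiff_moebius T 1 z (Ht s) Cmod_1 Hz) as [m Hm].
        destruct (Hf _ (moebius_disc T 1 z (Ht s) Cmod_1 Hz)) as [m' Hm'].
        eexists. apply (cdiff_comp f (moebius T 1)); eauto.
      - intros z Hz. left. apply Hneg, (moebius_disc T 1 z (Ht s) Cmod_1 Hz).
      - apply (cdiff_comp f (moebius T 1)). + rewrite E0; auto. + apply cdiff_moebius_real; auto. }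
    eexists. split.
    - apply (is_derive_mult (fun s => Re (f (tanh s))) (fun s => exp (- (2 * s)))).
      + apply (is_derive_comp (fun t : R => Re (f t)) tanh).
        * apply is_derive_Re_real. apply Hl. * apply is_derive_tanh.
      + apply (is_derive_comp exp (fun s => - (2 * s))).
        * apply is_derive_exp.
        * apply (is_derive_ext (fun s => (-2) * s)). { intros; simpl; ring. }
          apply is_derive_scal. apply is_derive_id.
      + apply Rmult_comm.
    - unfold plus, mult, scal; simpl. unfold mult, one; simpl. fold T.
      pose proof (exp_pos (- (2 * s))). nra. }
  destruct (MVT_gen (fun s => Re (f (tanh s)) * exp (- (2 * s))) 0 p
    (Derive (fun s => Re (f (tanh s)) * exp (- (2 * s))))) as (c & Hc & E).
  - intros x _. apply Derive_correct. destruct (D x) as (df & Hdf & _). exists df; auto.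
  - intros x _. apply continuity_pt_filterlim. destruct (D x) as (df & Hdf & _).
    apply (ex_derive_continuous (V := R_NormedModule) (fun s : R => Re (f (tanh s)) * exp (- (2 * s)))).
    exists df; auto.
  - destruct (D c) as (df & Hdf & Hge). 
    assert (Ed : Derive (fun s : R => Re (f (tanh s)) * exp (- (2 * s))) c = df)
      by (apply is_derive_unique; exact Hdf).
    rewrite Ed in E.
    rewrite tanh_0, Rmult_0_r, Ropp_0, exp_0, Rmult_1_r, Rminus_0_r in E.
    rewrite exp_Ropp in E. pose proof (exp_pos (2 * p)).
    assert (0 <= df * p) by nra.
    assert (Re (f 0) * exp (2 * p) <= Re (f (tanh p))); [|lra].
    replace (Re (f (tanh p))) with (Re (f (tanh p)) * / exp (2 * p) * exp (2 * p)) by (field; lra). nra.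
Qed.

(** * Euclidean geometry of C^d *)

Lemma countable_choice (A : Type) (P : nat -> A -> Prop) : (forall n, exists a, P n a) -> exists u, forall n, P n (u n).
Proof.
  intros H. exists (fun n => proj1_sig (constructive_indefinite_description _ (H n))).
  intros n. destruct constructive_indefinite_description; auto.
Qed.

Lemma exp_le_mono a b : a <= b -> exp a <= exp b.
Proof. intros [L|L]; [left; apply exp_increasing; auto|rewrite L; lra]. Qed.

Ltac minimum e a b := set (e := Rmin a b);
  let H := fresh "Hmin" in pose proof (Rmin_l a b : e <= a) as H;
  let H' := fresh "Hmin" in pose proof (Rmin_r a b : e <= b) as H'.

Lemma fsum_ext d (f g : Fin.t d -> R) : (forall i, f i = g i) -> fsum f = fsum g.
Proof. intros H. replace g with f; auto. apply functional_extensionality; auto. Qed.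

Lemma fsum_plus d (f g : Fin.t d -> R) : fsum (fun i => f i + g i) = fsum f + fsum g.
Proof. induction d; simpl; [lra|]. rewrite IHd. lra. Qed.

Lemma fsum_scal d c (f : Fin.t d -> R) : fsum (fun i => c * f i) = c * fsum f.
Proof. induction d; simpl; [lra|]. rewrite IHd. lra. Qed.

Lemma fsum_nonneg d (f : Fin.t d -> R) : (forall i, 0 <= f i) -> 0 <= fsum f.
Proof.
  induction d; simpl; intros H; [lra|]. pose proof (H Fin.F1).
  pose proof (IHd (fun i => f (Fin.FS i)) (fun i => H _)). lra.
Qed.

Lemma fsum_term_le d (f : Fin.t d -> R) i : (forall i, 0 <= f i) -> f i <= fsum f.
Proof.
  intros H. induction i; simpl.
  - pose proof (fsum_nonneg n (fun i => f (Fin.FS i)) (fun i => H _)). lra.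
  - pose proof (IHi (fun i => f (Fin.FS i)) (fun i => H _)). pose proof (H Fin.F1). simpl in *. lra.
Qed.

Lemma rinner_sym d (u v : Cd d) : rinner u v = rinner v u.
Proof. apply fsum_ext; intros; ring. Qed.

Lemma rinner_add_l d (u v w : Cd d) : rinner (vadd u v) w = rinner u w + rinner v w.
Proof. unfold rinner. rewrite <- fsum_plus. apply fsum_ext; intros; unfold vadd; cparts; ring. Qed.

Lemma rinner_vrscal_l d t (u w : Cd d) : rinner (vrscal t u) w = t * rinner u w.
Proof. unfold rinner. rewrite <- fsum_scal. apply fsum_ext; intros; unfold vrscal; cparts; ring. Qed.

Lemma vsub_vadd d (u v : Cd d) : vsub u v = vadd u (vrscal (-1) v).
Proof.
  apply functional_extensionality; intros i; unfold vsub, vadd, vrscal.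
  apply injective_projections; cparts; ring.
Qed.

Lemma rinner_sub_l d (u v w : Cd d) : rinner (vsub u v) w = rinner u w - rinner v w.
Proof. rewrite vsub_vadd, rinner_add_l, rinner_vrscal_l. ring. Qed.

Lemma rinner_add_r d (u v w : Cd d) : rinner w (vadd u v) = rinner w u + rinner w v.
Proof. rewrite !(rinner_sym d w). apply rinner_add_l. Qed.
Lemma rinner_vrscal_r d t (u w : Cd d) : rinner w (vrscal t u) = t * rinner w u.
Proof. rewrite !(rinner_sym d w). apply rinner_vrscal_l. Qed.
Lemma rinner_sub_r d (u v w : Cd d) : rinner w (vsub u v) = rinner w u - rinner w v.
Proof. rewrite !(rinner_sym d w). apply rinner_sub_l. Qed.

Lemma vnorm_sqr d (v : Cd d) : vnorm v * vnorm v = rinner v v.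
Proof.
  unfold vnorm. rewrite sqrt_sqrt.
  - apply fsum_ext; intros i. rewrite Cmod2_alt. ring.
  - apply fsum_nonneg. intros i. apply pow2_ge_0.
Qed.

Lemma vnorm_nonneg d (v : Cd d) : 0 <= vnorm v.
Proof. apply sqrt_pos. Qed.

Lemma rinner_nonneg d (v : Cd d) : 0 <= rinner v v.
Proof. rewrite <- vnorm_sqr. pose proof (vnorm_nonneg d v). nra. Qed.

Lemma sqr_le_le a b : 0 <= b -> a * a <= b * b -> a <= b.
Proof. intros. destruct (Rle_lt_dec a b); auto. nra. Qed.

Lemma vnorm_coord d (v : Cd d) i : Cmod (v i) <= vnorm v.
Proof.
  apply sqr_le_le; [apply vnorm_nonneg|]. rewrite vnorm_sqr, Cmod_sqr.
  apply (fsum_term_le d (fun i => Re (v i) * Re (v i) + Im (v i) * Im (v i))).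
  intros j; nra.
Qed.

Lemma vnorm_eq_0 d (v : Cd d) : vnorm v = 0 -> v = vzero.
Proof.
  intros H. apply functional_extensionality; intros i. unfold vzero.
  apply Cmod_eq_0. pose proof (vnorm_coord d v i). pose proof (Cmod_ge_0 (v i)). lra.
Qed.

Lemma rinner_vzero_l d (w : Cd d) : rinner vzero w = 0.
Proof.
  replace (@vzero d) with (vrscal 0 (@vzero d)).
  - rewrite rinner_vrscal_l. ring.
  - apply functional_extensionality; intros i; unfold vrscal, vzero. ring.
Qed.

Lemma cauchy_schwarz d (u v : Cd d) : rinner u v <= vnorm u * vnorm v.
Proof.
  pose proof (vnorm_nonneg d u) as Hu. pose proof (vnorm_nonneg d v) as Hv.
  pose proof (vnorm_sqr d u) as Eu. pose proof (vnorm_sqr d v) as Ev.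
  pose proof (rinner_nonneg d (vsub (vrscal (vnorm v) u) (vrscal (vnorm u) v))) as K.
  rewrite rinner_sub_l, !rinner_sub_r, !rinner_vrscal_l, !rinner_vrscal_r, (rinner_sym d v u), <- Eu, <- Ev in K.
  destruct (Rle_lt_or_eq_dec _ _ Hu) as [Hu'|Hu'].
  destruct (Rle_lt_or_eq_dec _ _ Hv) as [Hv'|Hv'].
  - assert (0 < vnorm u * vnorm v) by (apply Rmult_lt_0_compat; auto).
    assert (0 <= 2 * (vnorm u * vnorm v) * (vnorm u * vnorm v - rinner u v)) by lra. nra.
  - symmetry in Hv'. rewrite Hv'. apply vnorm_eq_0 in Hv'. rewrite Hv', rinner_sym, rinner_vzero_l. lra.
  - symmetry in Hu'. rewrite Hu'. apply vnorm_eq_0 in Hu'. rewrite Hu', rinner_vzero_l. lra.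
Qed.

Lemma vnorm_triangle d (u v : Cd d) : vnorm (vadd u v) <= vnorm u + vnorm v.
Proof.
  pose proof (vnorm_nonneg d u). pose proof (vnorm_nonneg d v).
  apply sqr_le_le; [lra|]. rewrite vnorm_sqr, rinner_add_l, !rinner_add_r, (rinner_sym d v u), <- !vnorm_sqr.
  pose proof (cauchy_schwarz d u v). nra.
Qed.

Lemma vnorm_vscal d c (v : Cd d) : vnorm (vscal c v) = Cmod c * vnorm v.
Proof.
  pose proof (Cmod_ge_0 c). pose proof (vnorm_nonneg d v). pose proof (vnorm_nonneg d (vscal c v)).
  assert (E : vnorm (vscal c v) * vnorm (vscal c v) = (Cmod c * vnorm v) * (Cmod c * vnorm v)).
  { rewrite vnorm_sqr. replace (Cmod c * vnorm v * (Cmod c * vnorm v)) with (Cmod c * Cmod c * (vnorm v * vnorm v)) by ring.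
    rewrite vnorm_sqr, Cmod_sqr. unfold rinner. rewrite <- fsum_scal.
    apply fsum_ext; intros i. unfold vscal. cparts. ring. }
  apply Rle_antisym; apply sqr_le_le; nra.
Qed.

Lemma vrscal_vscal d t (v : Cd d) : vrscal t v = vscal t v.
Proof. reflexivity. Qed.

Lemma vnorm_vrscal d t (v : Cd d) : vnorm (vrscal t v) = Rabs t * vnorm v.
Proof. rewrite vrscal_vscal, vnorm_vscal, Cmod_R. reflexivity. Qed.

Lemma vnorm_vzero d : vnorm (@vzero d) = 0.
Proof.
  replace (@vzero d) with (vrscal 0 (@vzero d)).
  - rewrite vnorm_vrscal, Rabs_R0. ring.
  - apply functional_extensionality; intros i; unfold vrscal, vzero. ring.
Qed.

Ltac vext := apply functional_extensionality; intros ?i; unfold vadd, vsub, vscal, vrscal, vzero;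
  try (apply injective_projections; cparts; ring).

Lemma vdist_nonneg d (u v : Cd d) : 0 <= vdist u v.
Proof. apply vnorm_nonneg. Qed.
Lemma vdist_self d (u : Cd d) : vdist u u = 0.
Proof. unfold vdist. replace (vsub u u) with (@vzero d) by vext. apply vnorm_vzero. Qed.
Lemma vdist_sym d (u v : Cd d) : vdist u v = vdist v u.
Proof.
  unfold vdist. replace (vsub u v) with (vrscal (-1) (vsub v u)) by vext.
  rewrite vnorm_vrscal, Rabs_left by lra. ring.
Qed.
Lemma vdist_triangle d (u v w : Cd d) : vdist u w <= vdist u v + vdist v w.
Proof.
  unfold vdist. replace (vsub u w) with (vadd (vsub u v) (vsub v w)) by vext. apply vnorm_triangle.
Qed.
Lemma vdist_eq_0 d (u v : Cd d) : vdist u v = 0 -> u = v.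
Proof.
  intros H. apply vnorm_eq_0 in H. apply functional_extensionality; intros i.
  apply (f_equal (fun w => w i)) in H. unfold vsub, vzero in H.
  replace (u i) with (u i - v i + v i)%C by ring. rewrite H. ring.
Qed.
Lemma vdist_pos d (u v : Cd d) : u <> v -> 0 < vdist u v.
Proof.
  intros H. destruct (Rle_lt_or_eq_dec _ _ (vdist_nonneg d u v)) as [|E]; auto.
  symmetry in E. apply vdist_eq_0 in E. contradiction.
Qed.
Lemma vnorm_vdist d (u v : Cd d) : vnorm u <= vdist u v + vnorm v.
Proof. unfold vdist. replace u with (vadd (vsub u v) v) at 1 by vext. apply vnorm_triangle. Qed.

(** * Sequences, compactness and nearest points in C^d *)

Definition vlim {d} (u : nat -> Cd d) (l : Cd d) : Prop :=
  forall eps, 0 < eps -> exists N, forall n, (N <= n)%nat -> vdist (u n) l < eps.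

Definition extraction (phi : nat -> nat) : Prop := forall n, (phi n < phi (S n))%nat.

Lemma extraction_ge phi : extraction phi -> forall n, (n <= phi n)%nat.
Proof. intros H. induction n; [lia|]. specialize (H n). lia. Qed.

Lemma extraction_lt phi : extraction phi -> forall n m, (n < m)%nat -> (phi n < phi m)%nat.
Proof. intros H n m Hnm. induction Hnm; [apply H|]. specialize (H m). lia. Qed.

Lemma extraction_comp phi psi : extraction phi -> extraction psi -> extraction (fun n => phi (psi n)).
Proof. intros H K n. apply extraction_lt; auto. Qed.

Lemma vlim_extraction d (u : nat -> Cd d) l phi : extraction phi -> vlim u l -> vlim (fun n => u (phi n)) l.
Proof.
  intros Hp H eps He. destruct (H eps He) as [N HN]. exists N. intros n Hn. apply HN.
  pose proof (extraction_ge phi Hp n). lia.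
Qed.

Lemma R_bolzano_weierstrass (u : nat -> R) M : (forall n, Rabs (u n) <= M) ->
  exists phi l, extraction phi /\ forall eps, 0 < eps -> exists N, forall n, (N <= n)%nat -> Rabs (u (phi n) - l) < eps.
Proof.
  intros H.
  destruct (Bolzano_Weierstrass u (fun x => - M <= x <= M)) as [l Hl].
  { apply compact_P3. } { intros n. apply Rabs_le_between; auto. }
  assert (K : forall k N : nat, exists p, (N <= p)%nat /\ Rabs (u p - l) < / INR (S k)).
  { intros k N. pose proof (lt_0_INR (S k) ltac:(lia)) as Hk. apply Rinv_0_lt_compat in Hk.
    destruct (Hl (disc l (mkposreal _ Hk)) N) as (p & Hp1 & Hp2).
    - exists (mkposreal _ Hk). intros x Hx; exact Hx. - exists p. split; auto. }
  pose (pick := fun k N => proj1_sig (constructive_indefinite_description _ (K k N))).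
  assert (Hpick : forall k N, (N <= pick k N)%nat /\ Rabs (u (pick k N) - l) < / INR (S k)).
  { intros. unfold pick. destruct constructive_indefinite_description; auto. }
  pose (phi := fix phi n := match n with O => pick O O | S n => pick (S n) (S (phi n)) end).
  exists phi, l. split.
  - intros n. destruct (Hpick (S n) (S (phi n))). simpl. lia.
  - intros eps He. destruct (archimed_cor1 eps He) as (N & HN1 & HN2). exists N. intros n Hn.
    apply Rlt_trans with (2 := HN1). apply Rlt_le_trans with (/ INR (S n)).
    + destruct n; apply Hpick.
    + apply Rinv_le_contravar; [apply lt_0_INR; lia|]. apply le_INR; lia.
Qed.

Lemma vnorm_succ_le d (v : Cd (S d)) : vnorm v <= Cmod (v Fin.F1) + vnorm (fun i => v (Fin.FS i)).
Proof.
  pose proof (Cmod_ge_0 (v Fin.F1)) as H1. pose proof (vnorm_nonneg d (fun i => v (Fin.FS i))) as H2.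
  apply sqr_le_le; [lra|]. rewrite vnorm_sqr. pose proof (Cmod_sqr (v Fin.F1)) as E1.
  pose proof (vnorm_sqr d (fun i => v (Fin.FS i))) as E2.
  unfold rinner in *. simpl. rewrite <- E2, <- E1. nra.
Qed.

Lemma Cmod_le_ReIm (z : C) : Cmod z <= Rabs (Re z) + Rabs (Im z).
Proof.
  pose proof (Rabs_pos (Re z)). pose proof (Rabs_pos (Im z)).
  apply sqr_le_le; [lra|]. rewrite Cmod_sqr.
  pose proof (Rsqr_abs (Re z)) as E1. pose proof (Rsqr_abs (Im z)) as E2. unfold Rsqr in *. nra.
Qed.

Lemma bolzano_weierstrass d (u : nat -> Cd d) M : (forall n, vnorm (u n) <= M) ->
  exists phi l, extraction phi /\ vlim (fun n => u (phi n)) l.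
Proof.
  revert u. induction d as [|d IH]; intros u H.
  - exists (fun n => n), (u 0%nat). split; [intros n; lia|]. intros eps He. exists 0%nat. intros n _.
    unfold vdist, vnorm. simpl. rewrite sqrt_0. auto.
  - assert (Hc : forall n i, Cmod (u n i) <= M) by (intros; eapply Rle_trans; [apply vnorm_coord|auto]).
    destruct (R_bolzano_weierstrass (fun n => Re (u n Fin.F1)) M) as (p1 & l1 & E1 & L1).
    { intros n. eapply Rle_trans; [apply re_le_Cmod|auto]. }
    destruct (R_bolzano_weierstrass (fun n => Im (u (p1 n) Fin.F1)) M) as (p2 & l2 & E2 & L2).
    { intros n. eapply Rle_trans; [apply im_le_Cmod|auto]. }
    destruct (IH (fun n i => u (p1 (p2 n)) (Fin.FS i))) as (p3 & l3 & E3 & L3).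
    { intros n. apply Rle_trans with (vnorm (u (p1 (p2 n)))); [|auto].
      apply sqrt_le_1_alt. simpl. pose proof (pow2_ge_0 (Cmod (u (p1 (p2 n)) Fin.F1))). simpl in *. lra. }
    exists (fun n => p1 (p2 (p3 n))).
    exists (fun i => Fin.caseS' i (fun _ => C) (l1, l2) l3).
    split; [apply (extraction_comp p1 (fun n => p2 (p3 n))); auto; apply (extraction_comp p2 p3); auto|].
    intros eps He.
    destruct (L1 (eps / 3) ltac:(lra)) as [N1 K1]. destruct (L2 (eps / 3) ltac:(lra)) as [N2 K2].
    destruct (L3 (eps / 3) ltac:(lra)) as [N3 K3].
    exists (Nat.max N1 (Nat.max N2 N3)). intros n Hn.
    pose proof (extraction_ge p3 E3 n). pose proof (extraction_ge p2 E2 (p3 n)).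
    specialize (K1 (p2 (p3 n)) ltac:(lia)). specialize (K2 (p3 n) ltac:(lia)). specialize (K3 n ltac:(lia)).
    eapply Rle_lt_trans; [apply vnorm_succ_le|].
    change (Cmod (u (p1 (p2 (p3 n))) Fin.F1 - (l1, l2))%C +
      vdist (fun i => u (p1 (p2 (p3 n))) (Fin.FS i)) l3 < eps).
    eapply Rle_lt_trans; [apply Rplus_le_compat_r, Cmod_le_ReIm|].
    unfold Re, Im in *. simpl. unfold Rminus in *. lra.
Qed.

Lemma nearest_point d (A : Cd d -> Prop) eta : (exists z, A z) ->
  exists p, closure A p /\ forall z, A z -> vdist eta p <= vdist eta z.
Proof.
  intros [z0 Hz0].
  (* [completeness] yields suprema, so [m] is minus the distance from [eta] to [A]. *)
  destruct (completeness (fun r => exists z, A z /\ r = - vdist eta z)) as [m [Hm1 Hm2]].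
  { exists 0. intros r (z & _ & ->). pose proof (vdist_nonneg d eta z). lra. }
  { exists (- vdist eta z0), z0. auto. }
  assert (K : forall n : nat, exists z, A z /\ vdist eta z <= - m + / INR (S n)).
  { intros n. apply NNPP. intros Hn. pose proof (lt_0_INR (S n) ltac:(lia)) as Hk. apply Rinv_0_lt_compat in Hk.
    assert (m <= m - / INR (S n)); [|lra]. apply Hm2. intros r (z & Hz & ->).
    apply Rnot_lt_le. intros Hlt. apply Hn. exists z. split; auto. lra. }
  destruct (countable_choice _ _ K) as [u Hu].
  assert (H1 : forall n, / INR (S n) <= 1).
  { intros n. rewrite <- Rinv_1. apply Rinv_le_contravar; [lra|]. apply (le_INR 1); lia. }
  destruct (bolzano_weierstrass d u (- m + 1 + vnorm eta)) as (phi & p & Hphi & Hp).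
  { intros n. destruct (Hu n) as [_ L]. pose proof (vnorm_vdist d (u n) eta). rewrite vdist_sym in H.
    specialize (H1 n). lra. }
  exists p. split.
  - intros eps He. destruct (Hp eps He) as [N HN]. exists (u (phi N)). split; [apply Hu|]. apply HN; auto.
  - intros z Hz. assert (- vdist eta z <= m) by (apply Hm1; exists z; auto).
    apply Rnot_lt_le. intros Hlt. set (gap := (vdist eta p - vdist eta z) / 2).
    assert (Hg : 0 < gap) by (unfold gap; lra).
    destruct (Hp gap Hg) as [N HN]. destruct (archimed_cor1 gap Hg) as (N2 & HN2 & HN2').
    set (k := Nat.max N N2). specialize (HN k ltac:(lia)).
    destruct (Hu (phi k)) as [_ L]. pose proof (extraction_ge phi Hphi k).
    assert (/ INR (S (phi k)) <= / INR N2).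
    { apply Rinv_le_contravar; [apply lt_0_INR; lia|]. apply le_INR. lia. }
    pose proof (vdist_triangle d eta (u (phi k)) p). unfold gap in *. lra.
Qed.

(** * Holomorphic discs and hyperbolic steps *)

Lemma holo_disc_precomp d (D : Cd d -> Prop) (f : C -> Cd d) (g : C -> C) :
  holo_disc D f -> (forall z, Cmod z < 1 -> Cmod (g z) < 1) ->
  (forall z, Cmod z < 1 -> exists l, cdiff g z l) -> holo_disc D (fun z => f (g z)).
Proof.
  intros [Hf1 Hf2] Hg1 Hg2. split; [intros a Ha; apply Hf1, Hg1, Ha|].
  intros a Ha. destruct (Hg2 a Ha) as [l Hl]. destruct (Hf2 (g a) (Hg1 a Ha)) as [v Hv].
  exists (vscal l v). intros eps He.
  pose proof (Cmod_ge_0 l) as Hl0. pose proof (vnorm_nonneg d v) as Hv0.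
  set (S := Cmod l + vnorm v + 1). minimum e 1 (eps / S).
  assert (He1 : 0 < e) by (apply Rmin_pos; [lra|apply Rdiv_lt_0_compat; unfold S; lra]).
  apply Rle_div_r in Hmin0; [|unfold S; lra].
  destruct (Hl e He1) as (d1 & Hd1 & K1). destruct (Hv e He1) as (d2 & Hd2 & K2).
  minimum del d1 (d2 / S).
  exists del. split; [apply Rmin_pos; auto; apply Rdiv_lt_0_compat; unfold S; lra|]. intros h Hh.
  pose proof (Cmod_ge_0 h) as Hh0.
  assert (HS : S * Cmod h < d2).
  { rewrite Rmult_comm. apply Rlt_div_r; [unfold S; lra|]. lra. }
  specialize (K1 h ltac:(lra)). set (k := (g (a + h) - g a)%C) in *.
  assert (Hk : Cmod k <= (Cmod l + e) * Cmod h).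
  { pose proof (Cmod_triangle (k - l * h) (l * h)) as T. replace (k - l * h + l * h)%C with k in T by ring.
    rewrite Cmod_mult in T. lra. }
  specialize (K2 k ltac:(unfold S in *; nra)). replace (g a + k)%C with (g (a + h)%C) in K2 by (unfold k; ring).
  replace (vsub (vsub (f (g (a + h)%C)) (f (g a))) (vscal h (vscal l v)))
    with (vadd (vsub (vsub (f (g (a + h)%C)) (f (g a))) (vscal k v)) (vscal (k - l * h)%C v)) by vext.
  eapply Rle_trans; [apply vnorm_triangle|]. rewrite vnorm_vscal.
  apply Rle_trans with (e * S * Cmod h); [|apply Rmult_le_compat_r; auto].
  assert (e * Cmod k <= e * ((Cmod l + e) * Cmod h)) by (apply Rmult_le_compat_l; lra).
  assert (Cmod (k - l * h) * vnorm v <= e * Cmod h * vnorm v) by (apply Rmult_le_compat_r; auto).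
  assert (0 <= e * Cmod h * (1 - e)) by (repeat apply Rmult_le_pos; lra). unfold S. lra.
Qed.

(** The derivative in [holomorphic_on] is a bare linear map. The bound needed for continuity and the
    chain rule comes from finite dimension, by splitting off one coordinate at a time. *)
Lemma linear_bounded d m (L : Cd d -> Cd m) :
  (forall u v, L (vadd u v) = vadd (L u) (L v)) -> (forall c u, L (vscal c u) = vscal c (L u)) ->
  exists K, 0 <= K /\ forall u, vnorm (L u) <= K * vnorm u.
Proof.
  induction d as [|d IH]; intros Ha Hs.
  - exists 0. split; [lra|]. intros u.
    replace u with (vscal 0 u). + rewrite Hs, !vnorm_vscal, Cmod_0. lra.
    + apply functional_extensionality. intros i. inversion i.
  - pose (emb := fun (c : C) (w : Cd d) => (fun i => Fin.caseS' i (fun _ => C) c w) : Cd (S d)).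
    destruct (IH (fun w => L (emb 0 w))) as (K & HK & HL).
    { intros u v. rewrite <- Ha. f_equal. apply functional_extensionality. intros i.
      apply (Fin.caseS' i); simpl; unfold vadd; simpl; auto. ring. }
    { intros c u. rewrite <- Hs. f_equal. apply functional_extensionality. intros i.
      apply (Fin.caseS' i); simpl; unfold vscal; simpl; auto. ring. }
    set (e := emb 1 vzero). exists (vnorm (L e) + K). pose proof (vnorm_nonneg _ (L e)).
    split; [lra|]. intros u.
    assert (E : u = vadd (vscal (u Fin.F1) e) (emb 0 (fun i => u (Fin.FS i)))).
    { apply functional_extensionality. intros i.
      apply (Fin.caseS' i); simpl; unfold vscal, vadd; simpl; intros; unfold vzero; ring. }
    rewrite E at 1. rewrite Ha, Hs. eapply Rle_trans; [apply vnorm_triangle|].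
    rewrite vnorm_vscal. pose proof (HL (fun i => u (Fin.FS i))) as T.
    pose proof (vnorm_coord _ u Fin.F1). pose proof (Cmod_ge_0 (u Fin.F1)).
    assert (vnorm (fun i : Fin.t d => u (Fin.FS i)) <= vnorm u).
    { apply sqrt_le_1_alt. simpl. pose proof (pow2_ge_0 (Cmod (u Fin.F1))). simpl in *. lra. }
    pose proof (vnorm_nonneg _ (fun i : Fin.t d => u (Fin.FS i))). nra.
Qed.

Lemma holo_disc_postcomp d (A B U : Cd d -> Prop) (F : Cd d -> Cd d) f :
  holomorphic_on U F -> holo_disc A f -> (forall z, A z -> U z) -> (forall z, A z -> B (F z)) ->
  holo_disc B (fun z => F (f z)).
Proof.
  intros HF [Hf1 Hf2] HU HB. split; [intros a Ha; apply HB, Hf1, Ha|].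
  intros a Ha. destruct (Hf2 a Ha) as [v Hv].
  destruct (HF (f a) (HU _ (Hf1 a Ha))) as (L & La & Ls & HL).
  destruct (linear_bounded _ _ L La Ls) as (K & HK & HLK).
  exists (L v). intros eps He. pose proof (vnorm_nonneg d v) as Hv0.
  set (S := K + vnorm v + 1). minimum e 1 (eps / S).
  assert (He1 : 0 < e) by (apply Rmin_pos; [lra|apply Rdiv_lt_0_compat; unfold S; lra]).
  apply Rle_div_r in Hmin0; [|unfold S; lra].
  destruct (Hv e He1) as (d1 & Hd1 & K1). destruct (HL e He1) as (d2 & Hd2 & K2).
  minimum del d1 (d2 / S).
  exists del. split; [apply Rmin_pos; auto; apply Rdiv_lt_0_compat; unfold S; lra|]. intros h Hh.
  pose proof (Cmod_ge_0 h) as Hh0.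
  assert (HS : S * Cmod h < d2).
  { rewrite Rmult_comm. apply Rlt_div_r; [unfold S; lra|]. lra. }
  specialize (K1 h ltac:(lra)). set (k := vsub (f (a + h)%C) (f a)) in *.
  set (r := vsub k (vscal h v)) in *.
  assert (Ek : k = vadd (vscal h v) r) by (unfold r; vext).
  assert (Hk : vnorm k <= (vnorm v + e) * Cmod h).
  { rewrite Ek. eapply Rle_trans; [apply vnorm_triangle|]. rewrite vnorm_vscal. lra. }
  specialize (K2 k ltac:(unfold S in *; nra)).
  replace (vadd (f a) k) with (f (a + h)%C) in K2 by (unfold k; vext).
  replace (vsub (vsub (F (f (a + h)%C)) (F (f a))) (vscal h (L v)))
    with (vadd (vsub (vsub (F (f (a + h)%C)) (F (f a))) (L k)) (L r)).
  2: { rewrite Ek at 1. rewrite La, Ls. vext. }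
  eapply Rle_trans; [apply vnorm_triangle|].
  apply Rle_trans with (e * S * Cmod h); [|apply Rmult_le_compat_r; auto].
  assert (e * vnorm k <= e * ((vnorm v + e) * Cmod h)) by (apply Rmult_le_compat_l; lra).
  pose proof (HLK r). assert (K * vnorm r <= K * (e * Cmod h)) by (apply Rmult_le_compat_l; auto).
  assert (0 <= e * Cmod h * (1 - e)) by (repeat apply Rmult_le_pos; lra). unfold S. lra.
Qed.

(* complex-linear in [u], with real part the Euclidean inner product *)
Definition cinner {d} (u v : Cd d) : C := (rinner u v, rinner u (vscal Ci v)).

Lemma rinner_vscal_l d c (u w : Cd d) :
  rinner (vscal c u) w = Re c * rinner u w - Im c * rinner u (vscal Ci w).
Proof.
  replace (Re c * rinner u w - Im c * rinner u (vscal Ci w))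
   with (Re c * rinner u w + (- Im c) * rinner u (vscal Ci w)) by ring.
  unfold rinner. rewrite <- !fsum_scal, <- fsum_plus.
  apply fsum_ext; intros; unfold vscal, Ci; cparts; ring.
Qed.

Lemma cinner_vscal d c (u w : Cd d) : cinner (vscal c u) w = (c * cinner u w)%C.
Proof.
  unfold cinner. rewrite !rinner_vscal_l.
  replace (vscal Ci (vscal Ci w)) with (vrscal (-1) w) by (unfold Ci; vext).
  rewrite rinner_vrscal_r. apply injective_projections; cparts; ring.
Qed.

Lemma cinner_sub d (u v w : Cd d) : cinner (vsub u v) w = (cinner u w - cinner v w)%C.
Proof. unfold cinner. rewrite !rinner_sub_l. apply injective_projections; cparts; ring. Qed.

Lemma Rabs_rinner_le d (u v : Cd d) : Rabs (rinner u v) <= vnorm u * vnorm v.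
Proof.
  apply Rabs_le_between. split; [|apply cauchy_schwarz].
  pose proof (cauchy_schwarz d (vrscal (-1) u) v) as H. rewrite rinner_vrscal_l, vnorm_vrscal in H.
  rewrite Rabs_left in H by lra. lra.
Qed.

Lemma Cmod_cinner_le d (u v : Cd d) : Cmod (cinner u v) <= 2 * vnorm v * vnorm u.
Proof.
  eapply Rle_trans; [apply Cmod_le_ReIm|]. unfold cinner, Re, Im; simpl.
  pose proof (Rabs_rinner_le d u v). pose proof (Rabs_rinner_le d u (vscal Ci v)).
  rewrite vnorm_vscal, Cmod_Ci in H0. lra.
Qed.

Lemma cdiff_cinner_disc d (D : Cd d -> Prop) f (eta w : Cd d) z : holo_disc D f -> Cmod z < 1 ->
  exists l, cdiff (fun z => cinner (vsub (f z) eta) w) z l.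
Proof.
  intros [_ H] Hz. destruct (H z Hz) as [v Hv]. exists (cinner v w). intros eps He.
  pose proof (vnorm_nonneg d w).
  destruct (Hv (eps / (2 * vnorm w + 1))) as (del & Hd & K); [apply Rdiv_lt_0_compat; lra|].
  exists del. split; auto. intros h Hh. specialize (K h Hh).
  replace (cinner (vsub (f (z + h)) eta) w - cinner (vsub (f z) eta) w - cinner v w * h)%C
    with (cinner (vsub (vsub (f (z + h)%C) (f z)) (vscal h v)) w).
  2: { rewrite !cinner_sub, cinner_vscal. ring. }
  eapply Rle_trans; [apply Cmod_cinner_le|].
  apply Rle_trans with (2 * vnorm w * (eps / (2 * vnorm w + 1) * Cmod h)).
  - apply Rmult_le_compat_l; lra.
  - pose proof (Cmod_ge_0 h).
    replace (eps * Cmod h) with ((2 * vnorm w + 1) * (eps / (2 * vnorm w + 1) * Cmod h)) by (field; lra).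
    apply Rmult_le_compat_r; [|lra]. apply Rmult_le_pos; auto. left; apply Rdiv_lt_0_compat; lra.
Qed.

(** A normalized link of a chain: [tanh p] is the positive point at Poincare distance [p] from 0, so
    the length itself is the parameter and a step can be cut at any length. *)
Definition hstep {d} (D : Cd d -> Prop) (p : R) (z w : Cd d) : Prop :=
  0 <= p /\ exists f, holo_disc D f /\ f (RtoC 0) = z /\ f (RtoC (tanh p)) = w.

Lemma Cmod_tanh p : Cmod (tanh p) < 1.
Proof. rewrite Cmod_R. apply Rabs_lt_between. pose proof (tanh_bound p); lra. Qed.

Lemma tanh_frac p : (1 + tanh p) / (1 - tanh p) = exp (2 * p).
Proof.
  pose proof (tanh_bound p). unfold tanh. pose proof (cosh_pos p).
  replace (2 * p) with (p - - p) by ring. unfold Rminus at 2. rewrite exp_plus, Ropp_involutive.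
  assert (cosh p + sinh p = exp p) by (unfold cosh, sinh; field).
  assert (E : cosh p - sinh p = exp (- p)) by (unfold cosh, sinh; field).
  pose proof (exp_pos (- p)).
  assert (exp p * exp (- p) = 1) by (rewrite <- exp_plus, Rplus_opp_r; apply exp_0).
  replace ((1 + sinh p / cosh p) / (1 - sinh p / cosh p)) with ((cosh p + sinh p) / (cosh p - sinh p)) by (field; lra).
  rewrite H1, E. apply (Rmult_eq_reg_r (exp (- p))); [|lra]. unfold Rdiv. rewrite Rmult_assoc, Rinv_l by lra. nra.
Qed.

Definition artanh (t : R) : R := / 2 * ln ((1 + t) / (1 - t)).

Lemma artanh_tanh p : artanh (tanh p) = p.
Proof. unfold artanh. rewrite tanh_frac, ln_exp. field. Qed.

Lemma tanh_artanh t : -1 < t < 1 -> tanh (artanh t) = t.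
Proof.
  intros H. set (p := artanh t). assert (E : exp (2 * p) = (1 + t) / (1 - t)).
  { unfold p, artanh. replace (2 * (/ 2 * ln ((1 + t) / (1 - t)))) with (ln ((1 + t) / (1 - t))) by field.
    apply exp_ln. apply Rdiv_lt_0_compat; lra. }
  rewrite <- tanh_frac in E. pose proof (tanh_bound p).
  assert (E2 : (1 + tanh p) * (1 - t) = (1 + t) * (1 - tanh p)).
  { apply (Rmult_eq_reg_r (/ (1 - tanh p) * / (1 - t))).
    - transitivity ((1 + tanh p) / (1 - tanh p)); [field; lra|]. rewrite E. field; lra.
    - apply Rmult_integral_contrapositive_currified; apply Rinv_neq_0_compat; lra. }
  lra.
Qed.

Lemma artanh_nonneg t : 0 <= t < 1 -> 0 <= artanh t.
Proof.
  intros H. unfold artanh. rewrite <- (Rmult_0_r (/ 2)), <- ln_1. apply Rmult_le_compat_l; [lra|].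
  apply ln_le; [lra|]. apply Rle_div_r; lra.
Qed.

Definition pseudo (a b : C) : R := Cmod (Cminus a b) / Cmod (Cminus (RtoC 1) (Cmult (Cconj a) b)).

Lemma pseudo_denom a b : Cmod a < 1 -> Cmod b < 1 -> (1 - Cconj a * b)%C <> 0.
Proof.
  intros Ha Hb. replace (1 - Cconj a * b)%C with (1 + Cconj a * (- b))%C by ring.
  apply moebius_denom; auto. rewrite Cmod_opp; auto.
Qed.

Lemma pseudo_range a b : Cmod a < 1 -> Cmod b < 1 -> 0 <= pseudo a b < 1.
Proof.
  intros Ha Hb. pose proof (pseudo_denom a b Ha Hb) as D. pose proof (proj1 (Cmod_gt_0 _) D).
  split. { apply Rmult_le_pos; [apply Cmod_ge_0|]. left; apply Rinv_0_lt_compat; auto. }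
  assert (Hb' : Cmod (- b) < 1) by (rewrite Cmod_opp; auto).
  pose proof (moebius_disc a 1 (- b) Ha Cmod_1 Hb') as M. unfold moebius in M.
  replace (1 + Cconj a * (1 * - b))%C with (1 - Cconj a * b)%C in M by ring.
  replace (1 * - b + a)%C with (a - b)%C in M by ring. rewrite Cmod_mult, Cmod_inv in M; auto.
Qed.

Lemma poincare_artanh a b : poincare a b = artanh (pseudo a b).
Proof. reflexivity. Qed.

Lemma poincare_sym a b : poincare a b = poincare b a.
Proof.
  rewrite !poincare_artanh. unfold pseudo.
  replace (Cmod (b - a)) with (Cmod (a - b)) by (rewrite <- Cmod_opp; f_equal; ring).
  replace (Cmod (1 - Cconj b * a)) with (Cmod (1 - Cconj a * b)); auto.
  rewrite <- Cmod_conj. f_equal. apply injective_projections; cparts; ring.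
Qed.

Lemma poincare_real a b : -1 < a -> a <= b -> b < 1 ->
  poincare a b = / 2 * ln ((1 + b) * (1 - a) / ((1 - b) * (1 + a))).
Proof.
  intros Ha Hab Hb. unfold poincare.
  replace (Cminus (RtoC a) (RtoC b)) with (RtoC (a - b)) by (apply injective_projections; cparts; ring).
  replace (1 - Cconj a * b)%C with (RtoC (1 - a * b)) by (apply injective_projections; cparts; ring).
  assert (0 < 1 - a * b) by nra.
  rewrite !Cmod_R, Rabs_minus_sym, !Rabs_right by lra. cbv zeta. do 2 f_equal. field.
  assert (0 < (1 - b) * (1 + a)) by (apply Rmult_lt_0_compat; lra).
  repeat split; nra.
Qed.

Lemma poincare_tanh x y : x <= y -> poincare (tanh x) (tanh y) = y - x.
Proof.
  intros Hxy. pose proof (tanh_bound x). pose proof (tanh_bound y).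
  assert (Ht : tanh x <= tanh y) by (destruct Hxy as [L| ->]; [left; apply tanh_increasing; auto|lra]).
  rewrite poincare_real by lra.
  replace ((1 + tanh y) * (1 - tanh x) / ((1 - tanh y) * (1 + tanh x)))
    with ((1 + tanh y) / (1 - tanh y) * / ((1 + tanh x) / (1 - tanh x))) by (field; lra).
  rewrite !tanh_frac, <- exp_Ropp, <- exp_plus, ln_exp. field.
Qed.

Lemma poincare_nonneg a b : unit_disc a -> unit_disc b -> 0 <= poincare a b.
Proof. intros. rewrite poincare_artanh. apply artanh_nonneg, pseudo_range; auto. Qed.

(** Some [moebius a c] carries 0 and the pseudo-hyperbolic distance [t] to [a] and [b]; precomposing
    with it normalizes the disc without changing its image. *)
Lemma hstep_disc d (D : Cd d -> Prop) f a b : holo_disc D f -> unit_disc a -> unit_disc b ->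
  hstep D (poincare a b) (f a) (f b).
Proof.
  intros Hf Ha Hb. split; [apply poincare_nonneg; auto|].
  pose proof (pseudo_range a b Ha Hb) as Ht. rewrite poincare_artanh, tanh_artanh by lra.
  set (t := pseudo a b) in *. pose proof (pseudo_denom a b Ha Hb) as D1.
  assert (D2 : (1 - Cconj a * a)%C <> 0) by (apply pseudo_denom; auto).
  (* The rotation [c] is the direction from [a] to [b] seen from 0. It is undetermined when a = b,
     and 1 is taken then. *)
  assert (Hc : exists c, Cmod c = 1 /\ (c * t = (b - a) / (1 - Cconj a * b))%C).
  { assert (Et : t = Cmod ((b - a) / (1 - Cconj a * b))%C).
    { unfold t, pseudo. rewrite Cmod_div by auto. f_equal. rewrite <- Cmod_opp. f_equal. ring. }
    destruct (Req_dec t 0) as [E0|E0].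
    - exists 1. split; [apply Cmod_1|]. symmetry in Et. rewrite E0 in *. apply Cmod_eq_0 in Et. rewrite Et. ring.
    - assert (RtoC t <> 0) by (intros E; apply RtoC_inj in E; auto).
      exists ((b - a) / (1 - Cconj a * b) / t)%C. split; [|field; auto].
      rewrite Cmod_div, <- Et, Cmod_R, Rabs_right by (auto; lra). field; auto. }
  destruct Hc as (c & Hc1 & Hc2).
  exists (fun z => f (moebius a c z)). split; [|split].
  - apply holo_disc_precomp; auto; intros z Hz; [apply moebius_disc|apply cdiff_moebius]; auto.
  - f_equal. unfold moebius. replace (1 + Cconj a * (c * 0))%C with (1 : C) by ring. field.
  - f_equal. unfold moebius. rewrite Hc2.
    replace (1 + Cconj a * ((b - a) / (1 - Cconj a * b)))%C
      with ((1 - Cconj a * a) / (1 - Cconj a * b))%C by (field; auto).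
    field. auto.
Qed.

Lemma hstep_sym d (D : Cd d -> Prop) p z w : hstep D p z w -> hstep D p w z.
Proof.
  intros (Hp & f & Hf & <- & <-).
  pose proof (hstep_disc d D f (tanh p) 0 Hf (Cmod_tanh p)) as K.
  assert (unit_disc 0) by (unfold unit_disc; rewrite Cmod_0; lra). specialize (K H).
  rewrite poincare_sym in K. rewrite <- tanh_0 in K at 1. rewrite poincare_tanh in K by auto.
  replace p with (p - 0) at 1 by ring. exact K.
Qed.

(** 0, [tanh p] and [tanh (p + q)] lie in this order on a geodesic of the disc, so the cut loses no
    length. *)
Lemma hstep_split d (D : Cd d -> Prop) p q z w : 0 <= p -> 0 <= q -> hstep D (p + q) z w ->
  exists m, hstep D p z m /\ hstep D q m w.
Proof.
  intros Hp Hq (_ & f & Hf & <- & <-). exists (f (tanh p)). split.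
  - split; auto. exists f; auto.
  - pose proof (hstep_disc d D f (tanh p) (tanh (p + q)) Hf (Cmod_tanh _) (Cmod_tanh _)) as K.
    rewrite poincare_tanh in K by lra. replace q with (p + q - p) at 1 by ring. exact K.
Qed.

Lemma hstep_in d (D : Cd d -> Prop) p z w : hstep D p z w -> D z /\ D w.
Proof.
  intros (Hp & f & [Hf _] & <- & <-). split; apply Hf; unfold unit_disc; [rewrite Cmod_0; lra|apply Cmod_tanh].
Qed.

Lemma hstep_image d (A B U : Cd d -> Prop) F p z w : holomorphic_on U F -> (forall z, A z -> U z) ->
  (forall z, A z -> B (F z)) -> hstep A p z w -> hstep B p (F z) (F w).
Proof.
  intros HF HU HB (Hp & f & Hf & <- & <-). split; auto. exists (fun z => F (f z)).
  split; auto. eapply holo_disc_postcomp; eauto.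
Qed.

(** Harnack's inequality for the complex affine functional with real part [rinner (vsub y eta) l],
    restricted to the disc. Both the Euclidean and the logarithmic lower bounds for [kob] come from
    here. *)
Lemma hstep_half_space d (D : Cd d -> Prop) eta l p z w :
  (forall y, D y -> rinner (vsub y eta) l < 0) -> hstep D p z w ->
  ln (- rinner (vsub w eta) l) - ln (- rinner (vsub z eta) l) <= 2 * p.
Proof.
  intros HD (Hp & f & Hf & <- & <-).
  pose proof (half_plane_harnack (fun z => cinner (vsub (f z) eta) l) p Hp) as K.
  assert (H0 : D (f (RtoC 0))) by (apply Hf; unfold unit_disc; rewrite Cmod_0; lra).
  assert (H1 : D (f (RtoC (tanh p)))) by (apply Hf; apply Cmod_tanh).
  pose proof (HD _ H0) as N0. pose proof (HD _ H1) as N1.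
  assert (- rinner (vsub (f (RtoC (tanh p))) eta) l <= - rinner (vsub (f (RtoC 0)) eta) l * exp (2 * p)).
  { apply K.
    - intros x Hx. eapply cdiff_cinner_disc; eauto.
    - intros x Hx. apply HD, Hf, Hx. }
  apply ln_le in H; [|lra]. rewrite ln_mult, ln_exp in H; [lra|lra|apply exp_pos].
Qed.

Lemma ln_le_sub1 x : 0 < x -> ln x <= x - 1.
Proof.
  intros Hx. pose proof (exp_ineq1_le (ln x)). rewrite exp_ln in H; lra.
Qed.

(** A hyperplane orthogonal to w - z and at distance 2 M from [c] sees [D] at heights between M and
    3 M. The logarithm of the height then varies at rate at least 1 / (3 M) between the two
    points. *)
Lemma hstep_vdist_le d (D : Cd d -> Prop) c M p z w : 0 < M -> (forall y, D y -> vdist y c <= M) ->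
  hstep D p z w -> vdist z w <= 6 * M * p.
Proof.
  intros HM HD Hst. destruct (hstep_in _ _ _ _ _ Hst) as [Hz Hw].
  destruct (classic (z = w)) as [->|Hne].
  { rewrite vdist_self. destruct Hst as [Hp _]. apply Rmult_le_pos; lra. }
  apply vdist_pos in Hne. set (r := vdist z w) in *.
  set (e := vrscal (/ r) (vsub w z)).
  assert (Hr : vnorm (vsub w z) = r) by (apply vdist_sym).
  assert (He : vnorm e = 1).
  { unfold e. rewrite vnorm_vrscal, Hr, Rabs_inv, Rabs_right by lra. field; lra. }
  assert (Hee : rinner e e = 1) by (rewrite <- vnorm_sqr, He; ring).
  set (eta := vadd c (vrscal (2 * M) e)).
  assert (U : forall y, - rinner (vsub y eta) e = 2 * M - rinner (vsub y c) e).
  { intros y. unfold eta. rewrite !rinner_sub_l, rinner_add_l, rinner_vrscal_l, Hee. ring. }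
  assert (B : forall y, D y -> M <= - rinner (vsub y eta) e <= 3 * M).
  { intros y Hy. rewrite U. specialize (HD y Hy). pose proof (Rabs_rinner_le d (vsub y c) e).
    rewrite He, Rmult_1_r in H. fold (vdist y c) in H. apply Rabs_le_between in H. lra. }
  (* The height decreases from [z] to [w], so the step is read backwards to bound the growth of its
     logarithm. *)
  apply hstep_sym in Hst.
  pose proof (hstep_half_space d D eta e p w z) as K.
  specialize (K ltac:(intros y Hy; specialize (B y Hy); lra) Hst).
  pose proof (B z Hz) as Bz. pose proof (B w Hw) as Bw.
  assert (E : - rinner (vsub z eta) e - - rinner (vsub w eta) e = r).
  { rewrite !rinner_sub_l. replace (_ - _) with (rinner w e - rinner z e) by ring.
    rewrite <- rinner_sub_l. unfold e. rewrite rinner_vrscal_r, <- vnorm_sqr, Hr. field; lra. }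
  set (uz := - rinner (vsub z eta) e) in *. set (uw := - rinner (vsub w eta) e) in *.
  pose proof (ln_le_sub1 (uw / uz)) as L. rewrite ln_div in L by lra.
  assert (0 < uw / uz) by (apply Rdiv_lt_0_compat; lra). specialize (L H).
  assert (uw / uz - 1 = - (r / uz)) by (rewrite <- E; field; lra).
  assert (r / (3 * M) <= r / uz).
  { unfold Rdiv. apply Rmult_le_compat_l; [lra|]. apply Rinv_le_contravar; lra. }
  assert (r / (3 * M) <= 2 * p) by lra.
  apply (Rmult_le_compat_l (3 * M)) in H2; [|lra].
  replace (3 * M * (r / (3 * M))) with r in H2 by (field; lra). lra.
Qed.

(** * Chains and the Kobayashi distance *)

(** The chains of [kob_chain] with every link normalized and the total length as an index.
    [hpath_of_chain] and [chain_of_hpath] show that the attained lengths are the same. *)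
Inductive hpath {d} (D : Cd d -> Prop) : Cd d -> Cd d -> R -> Prop :=
| hpath_nil z : hpath D z z 0
| hpath_cons z y w p L : hstep D p z y -> hpath D y w L -> hpath D z w (p + L).

Lemma hpath_step d (D : Cd d -> Prop) p z w : hstep D p z w -> hpath D z w p.
Proof. intros. replace p with (p + 0) by ring. econstructor; eauto. constructor. Qed.

Lemma hpath_trans d (D : Cd d -> Prop) z y w L M : hpath D z y L -> hpath D y w M -> hpath D z w (L + M).
Proof.
  intros H1 H2. induction H1; [rewrite Rplus_0_l; auto|]. rewrite Rplus_assoc. econstructor; eauto.
Qed.

Lemma hpath_sym d (D : Cd d -> Prop) z w L : hpath D z w L -> hpath D w z L.
Proof.
  induction 1; [constructor|]. rewrite Rplus_comm. eapply hpath_trans; eauto.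
  apply hpath_step, hstep_sym; auto.
Qed.

Lemma hpath_nonneg d (D : Cd d -> Prop) z w L : hpath D z w L -> 0 <= L.
Proof. induction 1; [lra|]. destruct H. lra. Qed.

Lemma hpath_of_chain d (D : Cd d -> Prop) l z w : kob_chain D z w l -> hpath D z w (chain_length l).
Proof.
  revert z. induction l as [|[[f a] b] l IH]; simpl; intros z H.
  - subst; constructor.
  - destruct H as (Hf & Ha & Hb & <- & Hl). econstructor; eauto. apply hstep_disc; auto.
Qed.

Lemma chain_of_hpath d (D : Cd d -> Prop) z w L : hpath D z w L ->
  exists l, kob_chain D z w l /\ L = chain_length l.
Proof.
  induction 1 as [z|z y w p L (Hp & f & Hf & E1 & E2) H2 (l & Hl & ->)].
  - exists nil. simpl; auto.
  - exists ((f, RtoC 0, RtoC (tanh p)) :: l)%list. simpl. rewrite E2. split.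
    + repeat split; auto; unfold unit_disc; try apply Hf. * rewrite Cmod_0; lra. * apply Cmod_tanh.
    + rewrite <- tanh_0, poincare_tanh by auto. ring.
Qed.

(** [kob] takes [real] of an infimum that is [p_infty] when there is no chain, and then has the
    default value 0. [linked] rules this out. *)
Definition linked {d} (D : Cd d -> Prop) (z w : Cd d) : Prop := exists L, hpath D z w L.

Lemma linked_trans d (D : Cd d -> Prop) x y z : linked D x y -> linked D y z -> linked D x z.
Proof. intros [L H] [M K]. exists (L + M). eapply hpath_trans; eauto. Qed.
Lemma linked_sym d (D : Cd d -> Prop) x y : linked D x y -> linked D y x.
Proof. intros [L H]. exists L. apply hpath_sym; auto. Qed.

Lemma kob_is_glb d (D : Cd d -> Prop) z w : linked D z w ->
  is_glb_Rbar (fun s => hpath D z w s) (kob D z w).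
Proof.
  intros [L HL]. unfold kob.
  set (E := fun s => exists l, kob_chain D z w l /\ s = chain_length l).
  assert (EE : forall s, E s <-> hpath D z w s).
  { intros s. split. - intros (l & Hl & ->). apply hpath_of_chain; auto.
    - apply chain_of_hpath. }
  pose proof (Glb_Rbar_correct E) as [G1 G2].
  assert (Rbar_le (Glb_Rbar E) L) by (apply G1, EE; auto).
  assert (Rbar_le 0 (Glb_Rbar E)).
  { apply G2. intros s Hs. apply EE in Hs. simpl. eapply hpath_nonneg; eauto. }
  destruct (Glb_Rbar E) as [g| |]; simpl in H, H0; try contradiction. simpl.
  split. - intros s Hs. apply G1, EE; auto. - intros b Hb. apply G2. intros s Hs. apply Hb, EE; auto.
Qed.

Lemma kob_le d (D : Cd d -> Prop) z w L : hpath D z w L -> kob D z w <= L.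
Proof. intros H. destruct (kob_is_glb d D z w (ex_intro _ L H)) as [G _]. apply (G L H). Qed.

Lemma kob_ge d (D : Cd d -> Prop) z w B : linked D z w -> (forall L, hpath D z w L -> B <= L) -> B <= kob D z w.
Proof. intros H K. destruct (kob_is_glb d D z w H) as [_ G]. apply (G B). intros s Hs. apply K; auto. Qed.

Lemma kob_approx d (D : Cd d -> Prop) z w eps : linked D z w -> 0 < eps ->
  exists L, hpath D z w L /\ L < kob D z w + eps.
Proof.
  intros H He. apply NNPP. intros Hn.
  assert (kob D z w + eps <= kob D z w); [|lra].
  apply kob_ge; auto. intros L HL. apply Rnot_lt_le. intros Hlt. apply Hn. exists L; auto.
Qed.

Lemma kob_nonneg d (D : Cd d -> Prop) z w : linked D z w -> 0 <= kob D z w.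
Proof. intros H. apply kob_ge; auto. intros L HL. eapply hpath_nonneg; eauto. Qed.

Lemma kob_sym d (D : Cd d -> Prop) z w : linked D z w -> kob D z w = kob D w z.
Proof.
  intros H. apply Rle_antisym; apply kob_ge; auto using linked_sym; intros L HL; apply kob_le, hpath_sym; auto.
Qed.

Lemma kob_triangle d (D : Cd d -> Prop) x y z : linked D x y -> linked D y z ->
  kob D x z <= kob D x y + kob D y z.
Proof.
  intros H1 H2. apply le_epsilon. intros eps He.
  destruct (kob_approx d D x y (eps / 2) H1 ltac:(lra)) as (L & HL & HL').
  destruct (kob_approx d D y z (eps / 2) H2 ltac:(lra)) as (M & HM & HM').
  pose proof (kob_le d D x z _ (hpath_trans d D _ _ _ _ _ HL HM)). lra.
Qed.

Lemma kob_self d (D : Cd d -> Prop) z : kob D z z = 0.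
Proof.
  apply Rle_antisym. - apply kob_le; constructor. - apply kob_nonneg. exists 0; constructor.
Qed.

Lemma hpath_lower d (D : Cd d -> Prop) (phi : Cd d -> R) c z w L : 0 <= c ->
  (forall p z w, hstep D p z w -> phi w - phi z <= c * p) -> hpath D z w L -> phi w - phi z <= c * L.
Proof. intros Hc H. induction 1; [lra|]. apply H in H0. lra. Qed.

Lemma kob_lower d (D : Cd d -> Prop) (phi : Cd d -> R) z w : linked D z w ->
  (forall p z w, hstep D p z w -> phi w - phi z <= p) -> phi w - phi z <= kob D z w.
Proof.
  intros Hl H. apply kob_ge; auto. intros L HL. rewrite <- (Rmult_1_l L).
  apply (hpath_lower d D phi 1); auto; [lra|]. intros. rewrite Rmult_1_l. auto.
Qed.

Lemma vdist_kob_le d (D : Cd d -> Prop) c M z w : 0 < M -> (forall y, D y -> vdist y c <= M) ->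
  linked D z w -> vdist z w <= 6 * M * kob D z w.
Proof.
  intros HM HD Hl.
  assert (vdist z w / (6 * M) <= kob D z w).
  { pose proof (kob_lower d D (fun y => vdist z y / (6 * M)) z w Hl) as K. cbv beta in K.
    rewrite vdist_self in K. replace (vdist z w / (6 * M)) with (vdist z w / (6 * M) - 0 / (6 * M)) by (field; lra).
    apply K. intros p a b Hs. pose proof (hstep_vdist_le d D c M p a b HM HD Hs).
    pose proof (vdist_triangle d z a b). apply (Rmult_le_reg_r (6 * M)); [lra|].
    replace ((vdist z b / (6 * M) - vdist z a / (6 * M)) * (6 * M)) with (vdist z b - vdist z a) by (field; lra). lra. }
  apply (Rmult_le_compat_l (6 * M)) in H; [|lra].
  replace (6 * M * (vdist z w / (6 * M))) with (vdist z w) in H by (field; lra). lra.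
Qed.

Lemma holo_disc_affine d (D : Cd d -> Prop) (c v : Cd d) :
  (forall a, Cmod a < 1 -> D (vadd c (vscal a v))) -> holo_disc D (fun a => vadd c (vscal a v)).
Proof.
  intros H. split; [apply H|]. intros a Ha. exists v. intros eps He. exists 1. split; [lra|].
  intros h _. replace (vsub _ _) with (@vzero d) by vext. rewrite vnorm_vzero.
  apply Rmult_le_pos; [lra|apply Cmod_ge_0].
Qed.

Lemma artanh_le_div t : 0 <= t < 1 -> artanh t <= t / (1 - t).
Proof.
  intros H. unfold artanh. pose proof (ln_le_sub1 ((1 + t) / (1 - t))).
  assert (0 < (1 + t) / (1 - t)) by (apply Rdiv_lt_0_compat; lra). specialize (H0 H1).
  replace ((1 + t) / (1 - t) - 1) with (2 * (t / (1 - t))) in H0 by (field; lra). lra.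
Qed.

Lemma hstep_ball d (D : Cd d -> Prop) z w r : 0 < r -> (forall y, vdist y z < r -> D y) -> vdist w z < r ->
  hstep D (artanh (vdist w z / r)) z w.
Proof.
  intros Hr HD Hw. set (t := vdist w z / r). pose proof (vdist_nonneg d w z).
  assert (Ht : 0 <= t < 1).
  { split; [apply Rmult_le_pos; auto; left; apply Rinv_0_lt_compat; auto|].
    unfold t; apply Rlt_div_l; lra. }
  split; [apply artanh_nonneg; auto|]. rewrite tanh_artanh by lra.
  destruct (Req_dec t 0) as [E|E].
  - assert (w = z).
    { apply vdist_eq_0. replace (vdist w z) with (t * r) by (unfold t; field; lra). rewrite E; ring. }
    subst w. exists (fun a => vadd z (vscal a vzero)). rewrite E. split; [|split; vext].
    apply holo_disc_affine. intros a Ha. apply HD.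
    replace (vadd z (vscal a vzero)) with z by vext. rewrite vdist_self; auto.
  - assert (RtoC t <> 0) by (intros F; apply RtoC_inj in F; auto).
    exists (fun a => vadd z (vscal a (vrscal (/ t) (vsub w z)))). split; [|split].
    + apply holo_disc_affine. intros a Ha. apply HD. unfold vdist.
      replace (vsub (vadd z _) z) with (vscal a (vrscal (/ t) (vsub w z))) by vext.
      rewrite vnorm_vscal, vnorm_vrscal, Rabs_inv, Rabs_right by lra. fold (vdist w z).
      replace (/ t * vdist w z) with r.
      * rewrite <- (Rmult_1_l r) at 2. apply Rmult_lt_compat_r; auto.
      * replace (vdist w z) with (t * r) by (unfold t; field; lra). field; lra.
    + vext.
    + apply functional_extensionality; intros i; unfold vadd, vscal, vrscal, vsub. rewrite RtoC_inv by auto. field; auto.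
Qed.

Lemma kob_le_ball d (D : Cd d -> Prop) z w r : 0 < r -> (forall y, vdist y z < r -> D y) -> vdist w z <= r / 2 ->
  kob D z w <= 2 * vdist w z / r.
Proof.
  intros Hr HD Hw. pose proof (vdist_nonneg d w z).
  pose proof (hstep_ball d D z w r Hr HD ltac:(lra)) as Hs.
  eapply Rle_trans; [apply kob_le, hpath_step, Hs|].
  set (t := vdist w z / r).
  assert (Ht : 0 <= t <= / 2).
  { split; [apply Rmult_le_pos; auto; left; apply Rinv_0_lt_compat; auto|].
    unfold t; apply Rle_div_l; lra. }
  eapply Rle_trans; [apply artanh_le_div; lra|].
  replace (2 * vdist w z / r) with (2 * t) by (unfold t; field; lra).
  apply Rle_div_l; nra.
Qed.

Lemma linked_refl d (D : Cd d -> Prop) z : linked D z z.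
Proof. exists 0; constructor. Qed.

(** Balls in [D] are linked to their centres, so the points linked to [z] and those not linked to it
    form two open sets. *)
Lemma domain_linked d (D : Cd d -> Prop) z w : is_open D -> Defs.is_connected D -> D z -> D w -> linked D z w.
Proof.
  intros Ho Hc Hz Hw.
  destruct (Hc (fun y => D y /\ linked D z y) (fun y => D y /\ ~ linked D z y)) as [H|H].
  - intros y [Hy Hl]. destruct (Ho y Hy) as (r & Hr & HD). exists r. split; auto. intros x Hx.
    split; auto. eapply linked_trans; eauto. eexists. apply hpath_step, hstep_ball; eauto.
  - intros y [Hy Hl]. destruct (Ho y Hy) as (r & Hr & HD). exists r. split; auto. intros x Hx.
    split; auto. intros Hlx. apply Hl. eapply linked_trans; eauto. apply linked_sym.
    eexists. apply hpath_step, hstep_ball; eauto.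
  - intros y Hy. destruct (classic (linked D z y)); auto.
  - intros y _ [_ H1] [_ H2]. auto.
  - apply H; auto.
  - exfalso. apply (proj2 (H z Hz)). apply linked_refl.
Qed.

Lemma convex_ball d (D : Cd d -> Prop) z w r t : is_convex D -> 0 <= t <= 1 ->
  (forall y, vdist y z < r -> D y) -> (forall y, vdist y w < r -> D y) ->
  forall y, vdist y (vadd (vrscal (1 - t) z) (vrscal t w)) < r -> D y.
Proof.
  intros Hc Ht Hz Hw y Hy. set (c := vadd (vrscal (1 - t) z) (vrscal t w)) in *.
  replace y with (vadd (vrscal (1 - t) (vadd z (vsub y c))) (vrscal t (vadd w (vsub y c)))).
  - apply Hc; auto; [apply Hz|apply Hw]; unfold vdist; 
      match goal with |- vnorm ?x < _ => replace x with (vsub y c) by vext end; auto.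
  - unfold c. vext.
Qed.

(** By [convex_ball] one radius serves along the whole segment, so finitely many equal steps, each
    shorter than that radius, join its ends. *)
Lemma convex_linked d (D : Cd d -> Prop) z w : is_open D -> is_convex D -> D z -> D w -> linked D z w.
Proof.
  intros Ho Hc Hz Hw.
  destruct (Ho z Hz) as (r1 & Hr1 & H1). destruct (Ho w Hw) as (r2 & Hr2 & H2).
  minimum r r1 r2.
  assert (Hr : 0 < r) by (apply Rmin_pos; auto).
  pose proof (vdist_nonneg d w z) as Hd.
  destruct (archimed_cor1 (r / (vdist w z + 1))) as (N & HN & HN0); [apply Rdiv_lt_0_compat; lra|].
  assert (HNp : 0 < INR N) by (apply lt_0_INR; auto).
  assert (HN' : vdist w z / INR N < r).
  { apply Rle_lt_trans with ((vdist w z + 1) * / INR N).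
    - apply Rmult_le_compat_r; [left; apply Rinv_0_lt_compat; auto|lra].
    - apply (Rmult_lt_compat_l (vdist w z + 1)) in HN; [|lra].
      replace ((vdist w z + 1) * (r / (vdist w z + 1))) with r in HN by (field; lra). lra. }
  assert (K : forall n, (n <= N)%nat -> linked D z (vadd (vrscal (1 - INR n / INR N) z) (vrscal (INR n / INR N) w))).
  { induction n as [|n IH]; intros Hn.
    - replace (vadd _ _) with z; [apply linked_refl|]. simpl. unfold Rdiv. rewrite Rmult_0_l. vext.
    - eapply linked_trans; [apply IH; lia|]. eexists. apply hpath_step.
      assert (Hn' : INR n <= INR N) by (apply le_INR; lia). pose proof (pos_INR n).
      assert (Hn2 : 0 <= INR n / INR N <= 1).
      { split; [apply Rmult_le_pos; auto; left; apply Rinv_0_lt_compat; auto|].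
        apply Rle_div_l; lra. }
      apply (hstep_ball d D _ _ r Hr).
      + apply convex_ball; auto; intros y Hy; [apply H1|apply H2]; lra.
      + unfold vdist. match goal with |- vnorm ?x < _ => replace x with (vrscal (/ INR N) (vsub w z)) end.
        * rewrite vnorm_vrscal, Rabs_right by (left; apply Rinv_0_lt_compat; auto).
          rewrite Rmult_comm. apply HN'.
        * rewrite S_INR. replace ((INR n + 1) / INR N) with (INR n / INR N + / INR N) by (field; lra). vext. }
  specialize (K N (Nat.le_refl _)). replace (vadd _ _) with w in K; auto.
  replace (INR N / INR N) with 1 by (field; lra). vext.
Qed.

Lemma hpath_split d (D : Cd d -> Prop) z w L s : hpath D z w L -> 0 <= s <= L ->
  exists m, hpath D z m s /\ hpath D m w (L - s).
Proof.
  intros H. revert s. induction H as [z|z y w p L H1 H2 IH]; intros s Hs.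
  - exists z. replace s with 0 by lra. rewrite Rminus_0_r. split; constructor.
  - destruct (Rle_lt_dec s p) as [Hsp|Hsp].
    + replace p with (s + (p - s)) in H1 by ring. apply hstep_split in H1; [|lra|lra].
      destruct H1 as (m & K1 & K2). exists m. split; [apply hpath_step; auto|].
      replace (p + L - s) with (p - s + L) by ring. econstructor; eauto.
    + destruct (IH (s - p) ltac:(lra)) as (m & K1 & K2). exists m. split.
      * replace s with (p + (s - p)) by ring. econstructor; eauto.
      * replace (p + L - s) with (L - (s - p)) by ring. auto.
Qed.

(** [u] lists the vertices and [t] is the length accumulated from the start; only differences of [t]
    matter. The bound [eta] makes each step nearly infinitesimal. *)
Definition fine_chain {d} (D : Cd d -> Prop) (eta : R) (N : nat) (u : nat -> Cd d) (t : nat -> R) : Prop :=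
  forall i, (i < N)%nat -> hstep D (t (S i) - t i) (u i) (u (S i)) /\ t (S i) - t i <= eta.

Inductive hfine {d} (D : Cd d -> Prop) (eta : R) : Cd d -> Cd d -> R -> Prop :=
| hfine_nil z : hfine D eta z z 0
| hfine_cons z y w p L : hstep D p z y -> p <= eta -> hfine D eta y w L -> hfine D eta z w (p + L).

Lemma hfine_trans d (D : Cd d -> Prop) eta z y w L M :
  hfine D eta z y L -> hfine D eta y w M -> hfine D eta z w (L + M).
Proof.
  intros H1 H2. induction H1; [rewrite Rplus_0_l; auto|]. rewrite Rplus_assoc. econstructor; eauto.
Qed.

Lemma hfine_of_step d (D : Cd d -> Prop) eta : 0 < eta -> forall n p z w,
  hstep D p z w -> p <= INR n * eta -> hfine D eta z w p.
Proof.
  intros He. induction n as [|n IH]; intros p z w Hs Hp.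
  - simpl in Hp. replace p with (p + 0) by ring. apply hfine_cons with w; auto; [lra|constructor].
  - destruct (Rle_lt_dec p eta) as [Hpe|Hpe].
    + replace p with (p + 0) by ring. apply hfine_cons with w; auto. constructor.
    + replace p with (eta + (p - eta)) in Hs |- * by ring. apply hstep_split in Hs; [|lra|lra].
      destruct Hs as (m & K1 & K2). apply hfine_cons with m; auto; [lra|].
      apply IH; auto. rewrite S_INR in Hp. lra.
Qed.

Lemma hfine_of_path d (D : Cd d -> Prop) eta z w L : 0 < eta -> hpath D z w L -> hfine D eta z w L.
Proof.
  intros He. induction 1; [constructor|]. eapply hfine_trans; eauto.
  destruct (INR_unbounded (p / eta)) as [n Hn]. apply hfine_of_step with n; auto.
  apply (Rmult_lt_compat_r eta) in Hn; auto. unfold Rdiv in Hn. rewrite Rmult_assoc, Rinv_l in Hn; lra.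
Qed.

Lemma fine_chain_of_path d (D : Cd d -> Prop) eta z w L : 0 < eta -> hpath D z w L ->
  exists N u t, fine_chain D eta N u t /\ u 0%nat = z /\ u N = w /\ t 0%nat = 0 /\ t N = L.
Proof.
  intros He H. apply (hfine_of_path d D eta) in H; auto.
  induction H as [z|z y w p L Hs Hp H (N & u & t & Hf & Hu0 & HuN & Ht0 & HtN)].
  - exists 0%nat, (fun _ => z), (fun _ => 0). repeat split; auto; lia.
  - exists (S N), (fun i => match i with O => z | S j => u j end),
        (fun i => match i with O => 0 | S j => p + t j end).
    repeat split; auto; [..|rewrite HtN; ring];
    (destruct i as [|i]; 
     [rewrite Ht0, ?Hu0; replace (p + 0 - 0) with p by ring; auto; apply Hs
     |replace (p + t (S i) - (p + t i)) with (t (S i) - t i) by ring; apply Hf; lia]).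
Qed.

Lemma fine_chain_path d (D : Cd d -> Prop) eta N u t : fine_chain D eta N u t ->
  forall i j, (i <= j)%nat -> (j <= N)%nat -> hpath D (u i) (u j) (t j - t i).
Proof.
  intros H i j Hij. induction Hij as [|j Hij IH]; intros Hj.
  - rewrite Rminus_diag. constructor.
  - replace (t (S j) - t i) with (t j - t i + (t (S j) - t j)) by ring.
    eapply hpath_trans; [apply IH; lia|]. apply hpath_step, H. lia.
Qed.

(** * Bounded convex domains: lower bounds, geodesics, visibility *)

(* The point [eta], possibly on the boundary of [D], is first pushed away from [q]: the new
   point is at positive distance from [D] and has a nearest point there. *)
Lemma convex_separation d (D : Cd d -> Prop) eta q eps : is_open D -> is_convex D -> ~ D eta -> D q -> 0 < eps ->
  exists l, vnorm l = 1 /\ forall y, D y -> rinner (vsub y (vadd eta (vrscal eps (vsub eta q)))) l < 0.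
Proof.
  intros Ho Hc Heta Hq He. set (eta' := vadd eta (vrscal eps (vsub eta q))).
  assert (Hcl : ~ closure D eta').
  { intros Hcl. destruct (Ho q Hq) as (r & Hr & HD).
    destruct (Hcl (eps * r)) as (y & Hy & Hd); [apply Rmult_lt_0_compat; auto|].
    (* [eta] is a convex combination of [y] and [q']. If [y] in [D] is close enough to [eta'], then
       [q'] lies in the ball about [q], which forces [eta] into [D]. *)
    apply Heta. set (q' := vadd q (vrscal (/ eps) (vsub eta' y))).
    assert (Hq' : D q').
    { apply HD. unfold vdist, q'. replace (vsub (vadd q _) q) with (vrscal (/ eps) (vsub eta' y)) by vext.
      rewrite vnorm_vrscal, Rabs_right by (left; apply Rinv_0_lt_compat; auto).
      fold (vdist eta' y). rewrite vdist_sym. apply (Rmult_lt_reg_l eps); auto.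
      replace (eps * (/ eps * vdist y eta')) with (vdist y eta') by (field; lra). auto. }
    assert (H1 : 0 < / (1 + eps)) by (apply Rinv_0_lt_compat; lra).
    assert (H2 : 1 - eps * / (1 + eps) = / (1 + eps)) by (field; lra).
    replace eta with (vadd (vrscal (1 - eps / (1 + eps)) y) (vrscal (eps / (1 + eps)) q')).
    - apply Hc; auto. unfold Rdiv. split; [apply Rmult_le_pos; lra|lra].
    - unfold Rdiv. rewrite H2. unfold q', eta'. apply functional_extensionality; intros i.
      unfold vadd, vrscal, vsub. apply injective_projections; cparts; field; lra. }
  destruct (nearest_point d D eta') as (p & Hp & Hmin); [exists q; auto|].
  assert (Hne : eta' <> p) by (intros E; rewrite E in Hcl; auto).
  apply vdist_pos in Hne. set (r := vdist eta' p) in *. set (w := vsub eta' p).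
  assert (Hw : vnorm w = r) by reflexivity.
  assert (Hinner : forall y, D y -> rinner (vsub y p) w <= 0).
  { intros y Hy. apply Rnot_lt_le. intros Hpos. set (a := rinner (vsub y p) w) in *.
    set (b := rinner (vsub y p) (vsub y p)).
    assert (Hb : 0 <= b) by apply rinner_nonneg.
    minimum t 1 (a / (b + 1)).
    assert (Ht : 0 < t) by (apply Rmin_pos; [lra|apply Rdiv_lt_0_compat; lra]).
    set (x := vadd (vrscal (1 - t) p) (vrscal t y)).
    assert (Hx : r <= vdist eta' x).
    { apply le_epsilon. intros e Hee. destruct (Hp e Hee) as (p' & Hp' & Hd).
      set (x' := vadd (vrscal (1 - t) p') (vrscal t y)).
      assert (Hx' : D x') by (apply Hc; auto; lra).
      assert (vdist x' x <= e).
      { unfold vdist. replace (vsub x' x) with (vrscal (1 - t) (vsub p' p)) by (unfold x, x'; vext).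
        rewrite vnorm_vrscal, Rabs_right by lra. fold (vdist p' p). pose proof (vdist_nonneg d p' p). nra. }
      specialize (Hmin x' Hx'). pose proof (vdist_triangle d eta' x x').
      rewrite (vdist_sym d x x') in H0. lra. }
    assert (Hsq : r * r <= vdist eta' x * vdist eta' x) by (apply Rmult_le_compat; lra).
    unfold vdist in Hsq. rewrite vnorm_sqr in Hsq.
    replace (vsub eta' x) with (vsub w (vrscal t (vsub y p))) in Hsq by (unfold w, x; vext).
    rewrite rinner_sub_l, !rinner_sub_r, !rinner_vrscal_l, !rinner_vrscal_r, <- (vnorm_sqr _ w), Hw in Hsq.
    rewrite (rinner_sym d w) in Hsq. fold a b in Hsq.
    assert (t * (b + 1) <= a).
    { apply (Rmult_le_compat_r (b + 1)) in Hmin1; [|lra].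
      replace (a / (b + 1) * (b + 1)) with a in Hmin1 by (field; lra). auto. }
    assert (0 < t * a) by (apply Rmult_lt_0_compat; auto).
    assert (t * (t * (b + 1)) <= t * a) by (apply Rmult_le_compat_l; lra).
    assert (0 < t * t) by (apply Rmult_lt_0_compat; auto). lra. }
  exists (vrscal (/ r) w). split.
  - rewrite vnorm_vrscal, Hw, Rabs_right; [field; lra|left; apply Rinv_0_lt_compat; auto].
  - intros y Hy. specialize (Hinner y Hy).
    replace (vsub y eta') with (vsub (vsub y p) w) by (unfold w; vext).
    rewrite rinner_vrscal_r, rinner_sub_l, <- (vnorm_sqr _ w), Hw.
    assert (0 < / r) by (apply Rinv_0_lt_compat; auto). assert (0 < r * r) by (apply Rmult_lt_0_compat; auto).
    assert (0 < / r * (r * r - rinner (vsub y p) w)) by (apply Rmult_lt_0_compat; lra). lra.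
Qed.

(** The displacement in [convex_separation] is scaled to be at most [s]. Below the separating
    hyperplane [w] then has depth at most 2 s, while the ball about [q] gives depth at least r / 2
    to [q]; the logarithm of the ratio of depths is the bound. *)
Lemma convex_kob_lower d (D : Cd d -> Prop) eta q w r s : is_open D -> is_convex D -> ~ D eta ->
  0 < r -> (forall y, vdist y q < r -> D y) -> D w -> 0 < s -> vdist w eta <= s ->
  / 2 * ln (r / (4 * s)) <= kob D w q.
Proof.
  intros Ho Hc Heta Hr HD Hw Hs Hws.
  assert (Hq : D q) by (apply HD; rewrite vdist_self; auto).
  pose proof (vdist_nonneg d eta q).
  destruct (convex_separation d D eta q (s / (vdist eta q + 1)) Ho Hc Heta Hq) as (l & Hl & Hsep).
  { apply Rdiv_lt_0_compat; lra. }
  set (eta' := vadd _ _) in Hsep.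
  assert (Hw2 : - rinner (vsub w eta') l <= 2 * s).
  { pose proof (Rabs_rinner_le d (vsub w eta') l) as T. rewrite Hl in T.
    apply Rabs_le_between in T. fold (vdist w eta') in T.
    pose proof (vdist_triangle d w eta eta').
    assert (vdist eta eta' <= s); [|lra].
    unfold vdist, eta'. replace (vsub eta (vadd _ _)) with (vrscal (- (s / (vdist eta q + 1))) (vsub eta q)) by vext.
    rewrite vnorm_vrscal, Rabs_Ropp, Rabs_right by (apply Rle_ge; left; apply Rdiv_lt_0_compat; lra).
    fold (vdist eta q). apply Rle_trans with (s / (vdist eta q + 1) * (vdist eta q + 1)); [|right; field; lra].
    apply Rmult_le_compat_l; [left; apply Rdiv_lt_0_compat; lra|lra]. }
  assert (Hq2 : r / 2 <= - rinner (vsub q eta') l).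
  { assert (D (vadd q (vrscal (r / 2) l))).
    { apply HD. unfold vdist. replace (vsub (vadd q _) q) with (vrscal (r / 2) l) by vext.
      rewrite vnorm_vrscal, Hl, Rabs_right; lra. }
    specialize (Hsep _ H0). rewrite rinner_sub_l, rinner_add_l, rinner_vrscal_l, <- (vnorm_sqr _ l), Hl in Hsep.
    rewrite rinner_sub_l. lra. }
  pose proof (Hsep w Hw) as Hw3.
  pose proof (kob_lower d D (fun y => / 2 * ln (- rinner (vsub y eta') l)) w q (convex_linked d D w q Ho Hc Hw Hq)) as K.
  cbv beta in K. eapply Rle_trans; [|apply K].
  - rewrite <- Rmult_minus_distr_l. apply Rmult_le_compat_l; [lra|].
    replace (r / (4 * s)) with ((r / 2) / (2 * s)) by (field; lra). rewrite ln_div by lra.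
    apply ln_le in Hw2; [|lra]. apply ln_le in Hq2; lra.
  - intros p a b Hab. pose proof (hstep_half_space d D eta' l p a b Hsep Hab). lra.
Qed.

(** Sequential compactness of closed Kobayashi balls, stated with Euclidean convergence to a point
    of [D]. *)
Definition kob_proper {d} (D : Cd d -> Prop) : Prop :=
  forall (u : nat -> Cd d) q C, D q -> (forall n, D (u n)) -> (forall n, kob D (u n) q <= C) ->
  exists phi l, extraction phi /\ vlim (fun n => u (phi n)) l /\ D l.

Lemma convex_kob_proper d (D : Cd d -> Prop) : is_open D -> is_convex D -> is_bounded D -> kob_proper D.
Proof.
  intros Ho Hc [M HM] u q C Hq Hu HC.
  destruct (bolzano_weierstrass d u M) as (phi & l & Hphi & Hl); [intros; apply HM, Hu|].
  exists phi, l. split; [auto|split; [auto|]]. apply NNPP. intros Hn.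
  destruct (Ho q Hq) as (r & Hr & HD).
  (* For this [s] the bound of [convex_kob_lower] is exactly C + 1, too large for a sequence whose
     limit is outside [D]. *)
  set (s := r / (4 * exp (2 * (C + 1)))). pose proof (exp_pos (2 * (C + 1))).
  assert (Hs : 0 < s) by (apply Rdiv_lt_0_compat; lra).
  destruct (Hl s Hs) as [N HN]. specialize (HN N (Nat.le_refl _)).
  pose proof (convex_kob_lower d D l q (u (phi N)) r s Ho Hc Hn Hr HD (Hu _) Hs (Rlt_le _ _ HN)) as K.
  replace (r / (4 * s)) with (exp (2 * (C + 1))) in K by (unfold s; field; lra).
  rewrite ln_exp in K. specialize (HC (phi N)). lra.
Qed.

Lemma kob_vlim d (D : Cd d -> Prop) u l : is_open D -> D l -> vlim u l ->
  forall eps, 0 < eps -> exists N, forall n, (N <= n)%nat -> D (u n) /\ linked D l (u n) /\ kob D l (u n) < eps.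
Proof.
  intros Ho Hl Hu eps He. destruct (Ho l Hl) as (r & Hr & HD).
  destruct (Hu (Rmin (r / 2) (eps * r / 4))) as [N HN]; [apply Rmin_pos; nra|].
  exists N. intros n Hn. specialize (HN n Hn).
  pose proof (Rmin_l (r / 2) (eps * r / 4)). pose proof (Rmin_r (r / 2) (eps * r / 4)).
  split; [apply HD; lra|split].
  - eexists. apply hpath_step, (hstep_ball d D l (u n) r); auto; lra.
  - eapply Rle_lt_trans; [apply (kob_le_ball d D l (u n) r); auto; lra|].
    apply Rlt_div_l; nra.
Qed.

Lemma hpath_in d (D : Cd d -> Prop) z w L : D z -> hpath D z w L -> D w.
Proof. intros Hz H. induction H; auto. apply IHhpath. apply hstep_in in H. apply H. Qed.

(** * Geodesics of a proper Kobayashi distance, by dyadic bisection *)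

Section Geodesics.
Variables (d : nat) (D : Cd d -> Prop).
Hypothesis Hopen : is_open D.
Hypothesis Hlinked : forall z w, D z -> D w -> linked D z w.
Hypothesis Hproper : kob_proper D.
Hypothesis Hsep : forall z w, D z -> D w -> kob D z w = 0 -> z = w.

Let k := kob D.

Lemma ktri x y z : D x -> D y -> D z -> k x z <= k x y + k y z.
Proof. intros. apply kob_triangle; auto. Qed.

Lemma ksym x y : D x -> D y -> k x y = k y x.
Proof. intros. apply kob_sym; auto. Qed.

(** Chains within 1 / (n + 1) of the infimum are cut at length [s]. Properness gives a limit of the
    cut points, and the triangle inequality turns both upper bounds into equalities. *)
Lemma kob_intermediate z w s : D z -> D w -> 0 <= s <= k z w ->
  exists m, D m /\ k z m = s /\ k m w = k z w - s.
Proof.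
  intros Hz Hw Hs.
  assert (A : forall n, exists m, D m /\ k z m <= s /\ k m w <= k z w - s + / INR (S n)).
  { intros n. pose proof (lt_0_INR (S n) ltac:(lia)) as Hn. apply Rinv_0_lt_compat in Hn.
    destruct (kob_approx d D z w _ (Hlinked z w Hz Hw) Hn) as (L & HL & HL').
    pose proof (kob_le d D z w L HL) as HL2. fold k in HL', HL2.
    destruct (hpath_split d D z w L s HL ltac:(lra)) as (m & H1 & H2).
    exists m. split; [apply (hpath_in d D z m s); auto|].
    apply kob_le in H1. apply kob_le in H2. fold k in H1, H2. lra. }
  destruct (countable_choice _ _ A) as [u Hu].
  destruct (Hproper u z s Hz) as (phi & m & Hphi & Hm & HDm).
  { apply Hu. } { intros n. fold k. rewrite ksym; auto; apply Hu. }
  exists m. split; auto.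
  assert (U1 : k z m <= s).
  { apply le_epsilon. intros e He. destruct (kob_vlim d D _ m Hopen HDm Hm e He) as [N HN].
    destruct (HN N (Nat.le_refl _)) as (B1 & _ & B2). fold k in B2. rewrite ksym in B2 by auto.
    pose proof (ktri z (u (phi N)) m Hz B1 HDm). destruct (Hu (phi N)) as (_ & ? & _). lra. }
  assert (U2 : k m w <= k z w - s).
  { apply le_epsilon. intros e He. destruct (kob_vlim d D _ m Hopen HDm Hm (e / 2) ltac:(lra)) as [N HN].
    destruct (archimed_cor1 (e / 2) ltac:(lra)) as (N2 & HN2 & HN2').
    set (n := Nat.max N N2). destruct (HN n ltac:(lia)) as (B1 & _ & B2). fold k in B2.
    pose proof (ktri m (u (phi n)) w HDm B1 Hw). destruct (Hu (phi n)) as (_ & _ & Hx).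
    pose proof (extraction_ge phi Hphi n).
    assert (/ INR (S (phi n)) <= / INR N2).
    { apply Rinv_le_contravar; [apply lt_0_INR; lia|]. apply le_INR. lia. }
    lra. }
  pose proof (ktri z m w Hz HDm Hw). lra.
Qed.

(** Choosing midpoints by a function makes the cells of two parameters coincide until bisection
    separates them, which [geod_dist] exploits. *)
Definition mid (P Q : Cd d) : Cd d :=
  epsilon (inhabits P) (fun m => D m /\ k P m = k P Q / 2 /\ k m Q = k P Q / 2).

Lemma mid_spec P Q : D P -> D Q -> D (mid P Q) /\ k P (mid P Q) = k P Q / 2 /\ k (mid P Q) Q = k P Q / 2.
Proof.
  intros HP HQ. unfold mid. apply epsilon_spec.
  assert (0 <= k P Q) by (apply kob_nonneg; auto).
  destruct (kob_intermediate P Q (k P Q / 2) HP HQ ltac:(lra)) as (m & H1 & H2 & H3).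
  exists m. split; auto. split; auto. lra.
Qed.

Record cell := Cell { lo : R; hi : R; pl : Cd d; pr : Cd d }.

Definition good_cell (c : cell) : Prop := D (pl c) /\ D (pr c) /\ k (pl c) (pr c) = hi c - lo c.

Definition cmid (c : cell) : R := (lo c + hi c) / 2.
Definition left_half (c : cell) : cell := Cell (lo c) (cmid c) (pl c) (mid (pl c) (pr c)).
Definition right_half (c : cell) : cell := Cell (cmid c) (hi c) (mid (pl c) (pr c)) (pr c).
Definition halve (t : R) (c : cell) : cell := if Rle_dec t (cmid c) then left_half c else right_half c.

(* The triangle inequality turns both bounds into equalities when the cell is good. *)
Definition between (c : cell) (X : Cd d) (x : R) : Prop :=
  D X /\ k (pl c) X <= x - lo c /\ k X (pr c) <= hi c - x.

Lemma good_halves c : good_cell c -> good_cell (left_half c) /\ good_cell (right_half c).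
Proof.
  intros (H1 & H2 & H3). destruct (mid_spec _ _ H1 H2) as (M1 & M2 & M3).
  unfold good_cell, left_half, right_half, cmid; simpl. repeat split; auto; lra.
Qed.

Lemma between_left c X x : good_cell c -> between (left_half c) X x -> between c X x.
Proof.
  intros (H1 & H2 & H3) (K1 & K2 & K3). destruct (mid_spec _ _ H1 H2) as (M1 & M2 & M3).
  unfold left_half, cmid in *; simpl in *. split; auto. split; auto.
  pose proof (ktri X _ (pr c) K1 M1 H2). lra.
Qed.

Lemma between_right c X x : good_cell c -> between (right_half c) X x -> between c X x.
Proof.
  intros (H1 & H2 & H3) (K1 & K2 & K3). destruct (mid_spec _ _ H1 H2) as (M1 & M2 & M3).
  unfold right_half, cmid in *; simpl in *. split; auto. split; auto.
  pose proof (ktri (pl c) _ X H1 M1 K1). lra.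
Qed.

Section Path.
Variables z w : Cd d.
Hypothesis Hz : D z.
Hypothesis Hw : D w.

Let L := k z w.

Fixpoint cells (t : R) (n : nat) : cell :=
  match n with O => Cell 0 L z w | S n => halve t (cells t n) end.

Lemma cells_good t n : good_cell (cells t n).
Proof.
  induction n; simpl.
  - unfold good_cell; simpl. repeat split; auto. fold L. lra.
  - unfold halve. destruct Rle_dec; apply good_halves; auto.
Qed.

Lemma cells_range t n : 0 <= t <= L -> lo (cells t n) <= t <= hi (cells t n) /\
  hi (cells t n) - lo (cells t n) = L / 2 ^ n.
Proof.
  intros Ht. induction n as [|n [IH1 IH2]]; simpl; [split; lra|].
  assert (0 < 2 ^ n) by (apply pow_lt; lra).
  replace (L / (2 * 2 ^ n)) with (L / 2 ^ n / 2) by (field; lra). rewrite <- IH2.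
  unfold halve. destruct Rle_dec; unfold left_half, right_half, cmid in *; simpl; lra.
Qed.

Lemma between_up t n m X x : (n <= m)%nat -> between (cells t m) X x -> between (cells t n) X x.
Proof.
  intros Hnm. induction Hnm as [|m Hnm IH]; auto. intros H. apply IH. simpl in H. unfold halve in H.
  destruct Rle_dec; [apply between_left|apply between_right]; auto; apply cells_good.
Qed.

Lemma half_pow_small e : 0 < e -> exists N, forall n, (N <= n)%nat -> L / 2 ^ n < e.
Proof.
  intros He. assert (HL : 0 <= L) by (apply kob_nonneg; auto).
  destruct (pow_lt_1_zero (1/2) ltac:(rewrite Rabs_right; lra) (e / (L + 1))) as [N HN].
  { apply Rdiv_lt_0_compat; lra. }
  exists N. intros n Hn. specialize (HN n Hn). rewrite Rabs_right in HN by (apply Rle_ge, pow_le; lra).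
  replace ((1/2)^n) with (/ 2 ^ n) in HN by (rewrite <- pow_inv; f_equal; lra).
  apply (Rmult_lt_compat_l (L + 1)) in HN; [|lra].
  replace ((L + 1) * (e / (L + 1))) with e in HN by (field; lra).
  assert (0 < / 2 ^ n) by (apply Rinv_0_lt_compat, pow_lt; lra). unfold Rdiv. nra.
Qed.

(** The left ends of the later cells lie in every earlier cell and their parameters tend to [t]; a
    subsequential limit given by properness inherits the bounds. *)
Lemma cells_point t : 0 <= t <= L -> exists X, forall n, between (cells t n) X t.
Proof.
  intros Ht.
  assert (B : forall n m, (n <= m)%nat -> between (cells t n) (pl (cells t m)) (lo (cells t m))).
  { intros n m Hnm. apply (between_up t n m); auto. destruct (cells_good t m) as (G1 & G2 & G3).
    split; auto. rewrite Rminus_diag. split; [right; apply kob_self|lra]. }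
  destruct (Hproper (fun n => pl (cells t n)) z L Hz) as (phi & X & Hphi & HX & HDX).
  { intros n. apply cells_good. }
  { intros n. destruct (B 0%nat n ltac:(lia)) as (B1 & B2 & B3). simpl in B2, B3.
    fold k. rewrite ksym by auto.
    pose proof (cells_range t n Ht). lra. }
  exists X. intros n. split; auto. destruct (cells_good t n) as (G1 & G2 & G3).
  assert (A : forall e, 0 < e -> exists Y y, between (cells t n) Y y /\ t - e < y <= t /\ k X Y < e).
  { intros e He. destruct (kob_vlim d D _ X Hopen HDX HX e He) as [N HN].
    destruct (half_pow_small e He) as [N2 HN2].
    set (j := Nat.max n (Nat.max N N2)). pose proof (extraction_ge phi Hphi j).
    exists (pl (cells t (phi j))), (lo (cells t (phi j))).
    split; [apply B; lia|]. split; [|apply HN; lia].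
    destruct (cells_range t (phi j) Ht) as [R1 R2]. specialize (HN2 (phi j) ltac:(lia)). lra. }
  split; apply le_epsilon; intros e He; destruct (A (e / 2) ltac:(lra)) as (Y & y & (B1 & B2 & B3) & Hy & HXY).
  - pose proof (ktri _ Y X G1 B1 HDX). rewrite (ksym Y X) in H by auto. lra.
  - pose proof (ktri X Y _ HDX B1 G2). lra.
Qed.

(* The nested cells around [t] converge to the point at parameter [t]. *)
Definition geod (t : R) : Cd d := epsilon (inhabits z) (fun X => forall n, between (cells t n) X t).

Lemma geod_spec t : 0 <= t <= L -> forall n, between (cells t n) (geod t) t.
Proof. intros Ht. unfold geod. apply epsilon_spec. apply cells_point; auto. Qed.

(** If no midpoint separated [s] from [t], they would share cells of length L / 2^n for all n. *)
Lemma cells_split s t : 0 <= s -> s < t -> t <= L ->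
  exists n, cells s n = cells t n /\ s <= cmid (cells t n) < t.
Proof.
  intros Hs Hst Ht. apply NNPP. intros Hn.
  assert (E : forall n, cells s n = cells t n).
  { induction n as [|n IH]; auto. simpl. rewrite IH. unfold halve.
    destruct (Rle_dec s (cmid (cells t n))), (Rle_dec t (cmid (cells t n))); auto; exfalso; [|lra].
    apply Hn. exists n. split; auto. lra. }
  destruct (half_pow_small (t - s) ltac:(lra)) as [N HN]. specialize (HN N (Nat.le_refl _)).
  pose proof (cells_range s N ltac:(lra)) as [R1 R2]. pose proof (cells_range t N ltac:(lra)) as [R3 R4].
  rewrite E in R1. lra.
Qed.

(** In the last common cell the midpoint lies between the two points: passing through it gives the
    upper bound, and the known distance of the ends of the cell gives the lower one. *)
Lemma geod_dist s t : 0 <= s -> s < t -> t <= L -> k (geod s) (geod t) = t - s.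
Proof.
  intros Hs Hst Ht. destruct (cells_split s t Hs Hst Ht) as (n & E & Hm).
  pose proof (geod_spec s ltac:(lra) (S n)) as Bs. pose proof (geod_spec t ltac:(lra) (S n)) as Bt.
  simpl in Bs, Bt. rewrite E in Bs. unfold halve in Bs, Bt.
  destruct (Rle_dec s (cmid (cells t n))) as [_|]; [|lra].
  destruct (Rle_dec t (cmid (cells t n))) as [|_]; [lra|].
  destruct (cells_good t n) as (G1 & G2 & G3). destruct (mid_spec _ _ G1 G2) as (M1 & M2 & M3).
  destruct Bs as (S1 & S2 & S3). destruct Bt as (T1 & T2 & T3). simpl in *.
  pose proof (ktri (geod s) _ (geod t) S1 M1 T1).
  pose proof (ktri (pl (cells t n)) (geod s) (pr (cells t n)) G1 S1 G2).
  pose proof (ktri (geod s) (geod t) (pr (cells t n)) S1 T1 G2). lra.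
Qed.

Lemma geodesic_exists_aux : exists gamma, kob_geodesic D gamma 0 (kob D z w) /\
  gamma 0 = z /\ gamma (kob D z w) = w.
Proof.
  fold k. fold L. assert (HL : 0 <= L) by (apply kob_nonneg; auto).
  exists geod. repeat split; auto.
  - intros t Ht. apply (geod_spec t Ht 0).
  - intros s t Hs Ht. fold k. destruct (Rtotal_order s t) as [Hst|[Hst|Hst]].
    + rewrite geod_dist by lra. rewrite Rabs_left by lra. lra.
    + subst. rewrite Rminus_diag, Rabs_R0. apply kob_self.
    + rewrite ksym; [|apply (geod_spec s Hs 0)|apply (geod_spec t Ht 0)].
      rewrite geod_dist by lra. rewrite Rabs_right by lra. lra.
  - destruct (geod_spec 0 ltac:(lra) 0) as (B1 & B2 & _). simpl in B2. symmetry. apply Hsep; auto.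
    pose proof (kob_nonneg d D z (geod 0) (Hlinked _ _ Hz B1)) as K. fold k in K |- *. lra.
  - destruct (geod_spec L ltac:(lra) 0) as (B1 & _ & B2). simpl in B2. apply Hsep; auto.
    pose proof (kob_nonneg d D (geod L) w (Hlinked _ _ B1 Hw)) as K. fold k in K |- *. lra.
Qed.
End Path.
End Geodesics.

Lemma bounded_ball d (D : Cd d -> Prop) : is_bounded D -> exists M, 0 < M /\ forall y, D y -> vdist y vzero <= M.
Proof.
  intros [M HM]. exists (Rabs M + 1). pose proof (Rabs_pos M). split; [lra|]. intros y Hy.
  specialize (HM y Hy). unfold vdist. replace (vsub y vzero) with y by vext. pose proof (Rle_abs M). lra.
Qed.

Lemma kob_0_eq d (D : Cd d -> Prop) z w : is_bounded D -> linked D z w -> kob D z w = 0 -> z = w.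
Proof.
  intros Hb Hl H. destruct (bounded_ball d D Hb) as (M & HM & HD).
  pose proof (vdist_kob_le d D vzero M z w HM HD Hl). rewrite H, Rmult_0_r in H0.
  apply vdist_eq_0. pose proof (vdist_nonneg d z w). lra.
Qed.

Lemma convex_geodesic d (D : Cd d -> Prop) z w : is_open D -> is_convex D -> is_bounded D -> D z -> D w ->
  exists gamma, kob_geodesic D gamma 0 (kob D z w) /\ gamma 0 = z /\ gamma (kob D z w) = w.
Proof.
  intros Ho Hc Hb Hz Hw. apply geodesic_exists_aux; auto.
  - intros; apply convex_linked; auto.
  - apply convex_kob_proper; auto.
  - intros; apply (kob_0_eq d D); auto. apply convex_linked; auto.
Qed.

Lemma kob_bounded_compact d (D K : Cd d -> Prop) q : is_open D -> (forall z w, D z -> D w -> linked D z w) ->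
  D q -> is_compact K -> (forall z, K z -> D z) -> exists C, forall z, K z -> kob D q z <= C.
Proof.
  intros Ho Hl Hq [[M HM] HK] HKD. apply NNPP. intros Hn.
  assert (A : forall n, exists z, K z /\ INR n < kob D q z).
  { intros n. apply NNPP. intros H. apply Hn. exists (INR n). intros z Hz. apply Rnot_lt_le. intros Hlt.
    apply H. exists z; auto. }
  destruct (countable_choice _ _ A) as [u Hu].
  destruct (bolzano_weierstrass d u M) as (phi & l & Hphi & Hlim); [intros; apply HM, Hu|].
  assert (Kl : K l).
  { apply HK. intros e He. destruct (Hlim e He) as [N HN]. exists (u (phi N)). split; [apply Hu|auto]. }
  destruct (kob_vlim d D _ l Ho (HKD l Kl) Hlim 1 Rlt_0_1) as [N HN].
  destruct (INR_unbounded (kob D q l + 1)) as [N2 HN2].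
  set (n := Nat.max N N2). destruct (HN n ltac:(lia)) as (B1 & B2 & B3).
  destruct (Hu (phi n)) as [_ B4].
  pose proof (kob_triangle d D q l (u (phi n)) (Hl _ _ Hq (HKD _ Kl)) B2).
  pose proof (extraction_ge phi Hphi n).
  assert (INR N2 <= INR (phi n)) by (apply le_INR; lia). lra.
Qed.

(** A geodesic from [u n] to [v n] meets the compact set of visibility, hence passes within a fixed
    distance of [q]. The detour through [q] costs at most twice that distance. *)
Lemma visibility_gromov d (D : Cd d -> Prop) q (u v : nat -> Cd d) x y :
  is_open D -> is_convex D -> is_bounded D -> visibility D -> D q ->
  (forall n, D (u n)) -> (forall n, D (v n)) -> vlim u x -> vlim v y ->
  ~ D x -> ~ D y -> x <> y ->
  exists C N, forall n, (N <= n)%nat -> kob D (u n) q + kob D q (v n) - C <= kob D (u n) (v n).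
Proof.
  intros Ho Hc Hb Hvis Hq Hu Hv Hux Hvy Hx Hy Hxy.
  assert (Hl : forall z w, D z -> D w -> linked D z w) by (intros; apply convex_linked; auto).
  assert (Bx : bdry D x).
  { split; auto. intros e He. destruct (Hux e He) as [N HN]. exists (u N); split; auto. }
  assert (By : bdry D y).
  { split; auto. intros e He. destruct (Hvy e He) as [N HN]. exists (v N); split; auto. }
  destruct (Hvis x y Bx By Hxy) as (Ux & Uy & K & O1 & U1 & O2 & U2 & _ & HK & HKD & Hg).
  destruct (O1 x U1) as (r1 & Hr1 & B1). destruct (O2 y U2) as (r2 & Hr2 & B2).
  destruct (Hux r1 Hr1) as [N1 HN1]. destruct (Hvy r2 Hr2) as [N2 HN2].
  destruct (kob_bounded_compact d D K q Ho Hl Hq HK HKD) as [C HC].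
  exists (2 * C), (Nat.max N1 N2). intros n Hn.
  destruct (convex_geodesic d D (u n) (v n) Ho Hc Hb (Hu n) (Hv n)) as (gamma & G & G0 & G1).
  pose proof G as (GL & GD & GI).
  destruct (Hg gamma 0 _ G) as (t & Ht & Kt).
  { rewrite G0. apply B1, HN1. lia. } { rewrite G1. apply B2, HN2. lia. }
  pose proof (GI 0 t ltac:(lra) Ht) as E1. pose proof (GI t (kob D (u n) (v n)) Ht ltac:(lra)) as E2.
  rewrite G0, Rabs_left1 in E1 by lra. rewrite G1, Rabs_left1 in E2 by lra.
  specialize (HC _ Kt). specialize (HKD _ Kt).
  pose proof (kob_triangle d D (u n) (gamma t) q (Hl _ _ (Hu n) HKD) (Hl _ _ HKD Hq)).
  pose proof (kob_triangle d D q (gamma t) (v n) (Hl _ _ Hq HKD) (Hl _ _ HKD (Hv n))).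
  rewrite (kob_sym d D (gamma t) q) in H by auto. lra.
Qed.

(** * Localization of a single disc *)

Lemma holomorphic_continuous d (U : Cd d -> Prop) F z : holomorphic_on U F -> U z ->
  forall eps, 0 < eps -> exists del, 0 < del /\ forall w, vdist w z < del -> vdist (F w) (F z) < eps.
Proof.
  intros HF Hz eps He. destruct (HF z Hz) as (L & La & Ls & HL).
  destruct (linear_bounded _ _ L La Ls) as (K & HK & HLK).
  destruct (HL 1 Rlt_0_1) as (del & Hd & Hh).
  exists (Rmin del (eps / (K + 2))).
  split; [apply Rmin_pos; auto; apply Rdiv_lt_0_compat; lra|]. intros w Hw.
  pose proof (Rmin_l del (eps / (K + 2))). pose proof (Rmin_r del (eps / (K + 2))).
  set (h := vsub w z). assert (Eh : vnorm h = vdist w z) by reflexivity.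
  specialize (Hh h ltac:(lra)). replace (vadd z h) with w in Hh by (unfold h; vext).
  unfold vdist. replace (vsub (F w) (F z)) with (vadd (vsub (vsub (F w) (F z)) (L h)) (L h)) by vext.
  eapply Rle_lt_trans; [apply vnorm_triangle|]. specialize (HLK h). rewrite Eh in *.
  assert (vdist w z * (K + 2) < eps).
  { apply (Rmult_lt_reg_r (/ (K + 2))); [apply Rinv_0_lt_compat; lra|].
    rewrite Rmult_assoc, Rinv_r by lra. unfold Rdiv in *. lra. }
  pose proof (vdist_nonneg d w z). lra.
Qed.

Lemma holomorphic_vlim d (U : Cd d -> Prop) F u l : holomorphic_on U F -> U l -> vlim u l ->
  vlim (fun n => F (u n)) (F l).
Proof.
  intros HF Hl Hu eps He. destruct (holomorphic_continuous d U F l HF Hl eps He) as (del & Hd & K).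
  destruct (Hu del Hd) as [N HN]. exists N. intros n Hn. apply K, HN, Hn.
Qed.

Lemma vlim_dist_le d (u : nat -> Cd d) l c r : vlim u l -> (forall n, vdist (u n) c <= r) -> vdist l c <= r.
Proof.
  intros Hu H. apply le_epsilon. intros e He. destruct (Hu e He) as [N HN]. specialize (HN N (Nat.le_refl _)).
  pose proof (vdist_triangle d l (u N) c). rewrite (vdist_sym d l (u N)) in H0. specialize (H N). lra.
Qed.

Lemma vlim_dist_ge d (u : nat -> Cd d) l c r : vlim u l -> (forall n, r <= vdist (u n) c) -> r <= vdist l c.
Proof.
  intros Hu H. apply le_epsilon. intros e He. destruct (Hu e He) as [N HN]. specialize (HN N (Nat.le_refl _)).
  pose proof (vdist_triangle d (u N) l c). specialize (H N). lra.
Qed.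

Lemma vlim_closure d (A : Cd d -> Prop) u l : vlim u l -> (forall n, A (u n)) -> closure A l.
Proof. intros Hu H e He. destruct (Hu e He) as [N HN]. exists (u N). split; auto. Qed.

(* A Cauchy estimate, obtained from the affine disc through [z] and [z']. *)
Lemma holomorphic_lipschitz d (U : Cd d -> Prop) F x : is_open U -> holomorphic_on U F -> U x ->
  exists r K, 0 < r /\ 0 < K /\ (forall z, vdist z x < r -> U z) /\
    forall z z', vdist z x < r -> vdist z' x < r -> vdist (F z) (F z') <= K * vdist z z'.
Proof.
  intros Ho HF Hx. destruct (Ho x Hx) as (r0 & Hr0 & HU).
  destruct (holomorphic_continuous d U F x HF Hx 1 Rlt_0_1) as (r1 & Hr1 & HC).
  minimum r r0 r1. assert (Hr : 0 < r) by (apply Rmin_pos; auto).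
  exists (r / 8), (6 * 1 * (2 * (2 / r))).
  assert (0 < 2 / r) by (apply Rdiv_lt_0_compat; lra).
  split; [lra|]. split; [lra|]. split; [intros z Hz; apply HU; lra|]. intros z z' Hz Hz'.
  set (B := fun y => vdist y z < r / 2).
  assert (HB : forall y, B y -> vdist y x < r).
  { intros y Hy. unfold B in Hy. pose proof (vdist_triangle d y z x). lra. }
  assert (Hd : vdist z' z < r / 4).
  { pose proof (vdist_triangle d z' x z). rewrite (vdist_sym d x z) in H0. lra. }
  pose proof (hstep_ball d B z z' (r / 2) ltac:(lra) (fun y H => H) ltac:(lra)) as Hs.
  apply (hstep_image d B (fun y => vdist y (F x) <= 1) U F) in Hs; auto.
  2: { intros y Hy. apply HU. apply HB in Hy. lra. }
  2: { intros y Hy. left. apply HC. apply HB in Hy. lra. }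
  eapply Rle_trans; [apply (hstep_vdist_le d _ (F x) 1 _ _ _ Rlt_0_1 (fun y H => H) Hs)|].
  rewrite (vdist_sym d z z').
  replace (6 * 1 * (2 * (2 / r)) * vdist z' z) with (6 * 1 * (2 * (2 / r) * vdist z' z)) by ring.
  apply Rmult_le_compat_l; [lra|].
  set (t := vdist z' z / (r / 2)). pose proof (vdist_nonneg d z' z).
  replace (2 * (2 / r) * vdist z' z) with (2 * t) by (unfold t; field; lra).
  assert (Ht : 0 <= t <= / 2).
  { split; [apply Rmult_le_pos; auto; left; apply Rinv_0_lt_compat; lra|].
    unfold t; apply Rle_div_l; lra. }
  eapply Rle_trans; [apply artanh_le_div; lra|].
  apply Rle_div_l; nra.
Qed.

Lemma artanh_lt a b : -1 < a -> a < b -> b < 1 -> artanh a < artanh b.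
Proof.
  intros. unfold artanh. apply Rmult_lt_compat_l; [lra|]. apply ln_increasing.
  - apply Rdiv_lt_0_compat; lra.
  - apply (Rmult_lt_reg_r ((1 - a) * (1 - b))); [apply Rmult_lt_0_compat; lra|].
    replace ((1 + a) / (1 - a) * ((1 - a) * (1 - b))) with ((1 + a) * (1 - b)) by (field; lra).
    replace ((1 + b) / (1 - b) * ((1 - a) * (1 - b))) with ((1 + b) * (1 - a)) by (field; lra). nra.
Qed.

(* Royden's localization, for one disc: a disc based at [z] stays in [V] on the
   hyperbolic ball of radius [s]. *)
Lemma hstep_localize d (Om V : Cd d -> Prop) s h z w : 
  (forall a b, Om a -> Om b -> linked Om a b) ->
  0 < s -> h < s -> (forall z', Om z' -> ~ V z' -> s <= kob Om z z') ->
  hstep Om h z w -> hstep (fun y => V y /\ Om y) (artanh (tanh h / tanh s)) z w.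
Proof.
  intros Hl Hs Hhs HV (Hh & f & Hf & <- & <-).
  pose proof (tanh_pos s Hs) as Hts. pose proof (tanh_bound s) as Hts1. pose proof (tanh_le h Hh) as Hth.
  pose proof (tanh_increasing h s Hhs) as Hlt.
  assert (Hq : 0 <= tanh h / tanh s < 1).
  { split; [apply Rmult_le_pos; [lra|left; apply Rinv_0_lt_compat; auto]|].
    apply Rlt_div_l; lra. }
  split; [apply artanh_nonneg; auto|]. rewrite tanh_artanh by lra.
  assert (Hin : forall z, Cmod z < 1 -> Cmod (tanh s * z)%C < 1).
  { intros y Hy. rewrite Cmod_mult, Cmod_R, Rabs_right by lra. pose proof (Cmod_ge_0 y). nra. }
  exists (fun y => f (tanh s * y)%C). split; [|split].
  - assert (HH : holo_disc Om (fun y => f (tanh s * y)%C)).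
    { apply (holo_disc_precomp d Om f (fun y => tanh s * y)%C); auto. intros y Hy. eexists.
      apply cdiff_mult; [apply cdiff_const|apply cdiff_id]. }
    split; [|apply HH]. intros a Ha. pose proof (proj1 HH a Ha) as HO. split; auto. apply NNPP. intros HnV.
    specialize (HV _ HO HnV).
    assert (H0 : unit_disc 0) by (unfold unit_disc; rewrite Cmod_0; lra).
    pose proof (kob_le _ _ _ _ _ (hpath_step _ _ _ _ _ (hstep_disc d Om f 0 (tanh s * a) Hf H0 (Hin a Ha)))) as K.
    rewrite poincare_artanh in K.
    assert (E : pseudo 0 (tanh s * a) = tanh s * Cmod a).
    { unfold pseudo. replace (0 - tanh s * a)%C with (- (tanh s * a))%C by ring.
      replace (1 - Cconj 0 * (tanh s * a))%C with (1 : C) by (apply injective_projections; cparts; ring).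
      rewrite Cmod_opp, Cmod_1, Cmod_mult, Cmod_R, Rabs_right by lra. field. }
    rewrite E in K. pose proof (Cmod_ge_0 a). unfold unit_disc in Ha.
    pose proof (artanh_lt (tanh s * Cmod a) (tanh s)) as A. rewrite artanh_tanh in A.
    specialize (A ltac:(nra) ltac:(nra) ltac:(lra)). lra.
  - f_equal. ring.
  - f_equal. rewrite <- RtoC_mult. f_equal. field. lra.
Qed.

(** With e = exp (- 2 s) one has coth s = 1 + 2 e / (1 - e), and artanh y <= y (1 + eps) for small
    y. The order of quantifiers matters: [C0] depends on [s0] alone, and only the step size [eta]
    depends on [eps]. *)
Lemma localized_length_bound s0 : 0 < s0 -> exists C0, 0 < C0 /\ forall eps, 0 < eps <= 1 ->
  exists eta, 0 < eta /\ eta < s0 /\ eta <= 1 /\ forall s h, s0 <= s -> 0 <= h <= eta ->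
    artanh (tanh h / tanh s) <= h * (1 + eps) + C0 * (h * exp (- (2 * s))).
Proof.
  intros Hs0. set (rho := tanh s0). pose proof (tanh_pos s0 Hs0) as Hrho. fold rho in Hrho.
  pose proof (tanh_bound s0) as Hr1. fold rho in Hr1.
  assert (He0 : exp (- (2 * s0)) < 1) by (rewrite <- exp_0; apply exp_increasing; lra).
  set (c0 := 2 / (1 - exp (- (2 * s0)))).
  assert (Hc0 : 0 < c0) by (apply Rdiv_lt_0_compat; lra).
  exists (2 * c0). split; [lra|]. intros eps He.
  exists (Rmin (rho * eps / 4) (Rmin 1 (s0 / 2))).
  set (eta := Rmin _ _).
  assert (0 < rho * eps) by (apply Rmult_lt_0_compat; lra).
  pose proof (Rmin_l (rho * eps / 4) (Rmin 1 (s0 / 2))) as M1.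
  pose proof (Rmin_r (rho * eps / 4) (Rmin 1 (s0 / 2))) as M2. fold eta in M1, M2.
  pose proof (Rmin_l 1 (s0 / 2)). pose proof (Rmin_r 1 (s0 / 2)).
  split; [repeat apply Rmin_pos; lra|]. split; [lra|]. split; [lra|].
  intros s h Hs Hh.
  assert (Hts : rho <= tanh s).
  { unfold rho. destruct Hs as [L| <-]; [left; apply tanh_increasing; auto|lra]. }
  pose proof (tanh_bound s) as Hs1. pose proof (tanh_le h (proj1 Hh)) as Hth.
  assert (Ei : 0 < / tanh s <= / rho).
  { split; [apply Rinv_0_lt_compat; lra|apply Rinv_le_contravar; lra]. }
  assert (Ec : / tanh s <= 1 + c0 * exp (- (2 * s))).
  { pose proof (tanh_frac s) as E. pose proof (exp_pos (2 * s)).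
    assert (E2 : exp (- (2 * s)) * (1 + tanh s) = 1 - tanh s) by (rewrite exp_Ropp, <- E; field; lra).
    assert (Hle : exp (- (2 * s)) <= exp (- (2 * s0))).
    { apply exp_le_mono; lra. }
    pose proof (exp_pos (- (2 * s))). set (e := exp (- (2 * s))) in *.
    assert (Et : / tanh s = 1 + 2 * e / (1 - e)).
    { assert (T : tanh s * (1 + e) = 1 - e) by lra.
      apply (Rmult_eq_reg_r (tanh s * (1 - e))); [|apply Rmult_integral_contrapositive_currified; lra].
      replace (/ tanh s * (tanh s * (1 - e))) with (1 - e) by (field; lra).
      replace ((1 + 2 * e / (1 - e)) * (tanh s * (1 - e))) with (tanh s * (1 + e)) by (field; lra). lra. }
    rewrite Et. apply Rplus_le_compat_l. unfold c0, Rdiv. 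
    replace (2 * e * / (1 - e)) with (2 * e * / (1 - e)) by ring.
    replace (2 * / (1 - exp (- (2 * s0))) * e) with (2 * e * / (1 - exp (- (2 * s0)))) by ring.
    apply Rmult_le_compat_l; [lra|]. apply Rinv_le_contravar; lra. }
  set (y := tanh h / tanh s).
  assert (Hy : 0 <= y <= h * / tanh s).
  { unfold y, Rdiv. split; [apply Rmult_le_pos; lra|apply Rmult_le_compat_r; lra]. }
  assert (Hy2 : h * / tanh s <= eps / 4).
  { apply Rle_trans with (rho * eps / 4 * / rho); [|right; field; lra].
    apply Rmult_le_compat; lra. }
  assert (artanh y <= y * (1 + eps)).
  { eapply Rle_trans; [apply artanh_le_div; lra|]. apply (Rmult_le_reg_r (1 - y)); [lra|].
    unfold Rdiv. rewrite Rmult_assoc, Rinv_l by lra.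
    assert (0 <= y * (eps - y - eps * y)) by (apply Rmult_le_pos; nra). lra. }
  pose proof (exp_pos (- (2 * s))) as Hep.
  assert (y <= h * (1 + c0 * exp (- (2 * s)))).
  { apply Rle_trans with (1 := proj2 Hy). apply Rmult_le_compat_l; lra. }
  assert (0 <= h * (c0 * exp (- (2 * s)))) by (apply Rmult_le_pos; [lra|apply Rmult_le_pos; lra]).
  nra.
Qed.

(** A bounded function whose derivative, 1 / cosh^2 (x / 2), is at least exp (- |x|). Sums of step
    lengths weighted by such exponentials are thereby dominated by a telescoping sum, whatever the
    number of steps. *)
Definition potential (x : R) : R := 2 * tanh (x / 2).

Lemma potential_range x : - 2 < potential x < 2.
Proof. unfold potential. pose proof (tanh_bound (x / 2)). lra. Qed.

Lemma potential_increment x del : 0 <= del -> del * exp (- Rabs x - del) <= potential (x + del) - potential x.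
Proof.
  intros Hd. unfold potential. destruct (tanh_mvt (x / 2) ((x + del) / 2) ltac:(lra)) as (c & Hc & E).
  rewrite <- Rmult_minus_distr_l, E.
  replace (2 * ((1 - tanh c * tanh c) * ((x + del) / 2 - x / 2))) with (del * (1 - tanh c * tanh c)) by field.
  apply Rmult_le_compat_l; auto. pose proof (cosh_pos c) as Hcp.
  replace (1 - tanh c * tanh c) with (/ (cosh c * cosh c)).
  2: { pose proof (cosh2_sinh2 c) as E1. unfold tanh. apply (Rmult_eq_reg_r (cosh c * cosh c)); [|nra].
       rewrite Rinv_l by nra. rewrite <- E1 at 1. field. lra. }
  assert (Hm : 2 * Rabs c <= Rabs x + del).
  { pose proof (Rle_abs x). pose proof (Rle_abs (- x)). rewrite Rabs_Ropp in H0.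
    destruct (Rle_lt_dec 0 c); [rewrite (Rabs_right c) by lra|rewrite (Rabs_left c) by lra]; lra. }
  assert (Hcosh : cosh c <= exp (Rabs c)).
  { pose proof (Rle_abs c). pose proof (Rle_abs (- c)). rewrite Rabs_Ropp in H0.
    pose proof (exp_le_mono c (Rabs c) H). pose proof (exp_le_mono (- c) (Rabs c) H0). unfold cosh. lra. }
  replace (- Rabs x - del) with (- (Rabs x + del)) by ring. rewrite exp_Ropp.
  apply Rinv_le_contravar; [nra|].
  apply Rle_trans with (exp (2 * Rabs c)); [|apply exp_le_mono; lra].
  replace (2 * Rabs c) with (Rabs c + Rabs c) by ring. rewrite exp_plus. apply Rmult_le_compat; lra.
Qed.

(** * Localization along almost minimizing chains *)

Lemma argmin_nat (f : nat -> R) n : (0 < n)%nat -> exists i, (i < n)%nat /\ forall j, (j < n)%nat -> f i <= f j.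
Proof.
  induction n as [|n IH]; [lia|]. intros _. destruct n as [|n].
  - exists 0%nat. split; [lia|]. intros j Hj. assert (j = 0%nat) by lia. subst; lra.
  - destruct (IH ltac:(lia)) as (i & Hi & Hm). destruct (Rle_lt_dec (f i) (f (S n))) as [L|L].
    + exists i. split; [lia|]. intros j Hj. destruct (Nat.eq_dec j (S n)) as [->|]; auto. apply Hm; lia.
    + exists (S n). split; [lia|]. intros j Hj. destruct (Nat.eq_dec j (S n)) as [->|]; [lra|].
      specialize (Hm j ltac:(lia)). lra.
Qed.

Lemma first_exit (P : nat -> Prop) N : P 0%nat -> ~ P N ->
  exists n, (0 < n <= N)%nat /\ ~ P n /\ forall i, (i < n)%nat -> P i.
Proof.
  intros H0. induction N as [N IH] using (well_founded_induction lt_wf). intros HN.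
  destruct (classic (exists i, (i < N)%nat /\ ~ P i)) as [(i & Hi & Hp)|Hn].
  - destruct (IH i Hi Hp) as (n & Hn & Hn1 & Hn2). exists n. split; [lia|auto].
  - exists N. assert (N <> 0%nat) by (intros ->; auto). split; [lia|]. split; auto.
    intros i Hi. apply NNPP. intros Hp. apply Hn. exists i; auto.
Qed.

Section Chart.
Variables (d : nat) (Om U V : Cd d -> Prop) (x o : Cd d) (Phi : Cd d -> Cd d).
Hypothesis HOo : is_open Om.
Hypothesis HOc : Defs.is_connected Om.
Hypothesis HOb : is_bounded Om.
Hypothesis Ho : Om o.
Hypothesis Hchart : local_convex_chart Om x U V Phi.
Hypothesis Hvis : visibility (image_chart Om V Phi).

Let D := image_chart Om V Phi.

Lemma VsubU z : V z -> U z.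
Proof.
  destruct Hchart as (_ & _ & _ & _ & _ & HVU & _). intros Hz. apply HVU. intros e He. exists z.
  split; auto. rewrite vdist_self; auto.
Qed.

Lemma chart_in z : V z -> Om z -> D (Phi z).
Proof. intros. exists z. auto. Qed.

(** Injectivity on all of [U] is what sends the points of [U] outside [Om], in particular its
    boundary points, outside the convex image. *)
Lemma chart_notin z : U z -> ~ Om z -> ~ D (Phi z).
Proof.
  destruct Hchart as (_ & _ & _ & _ & _ & _ & _ & Hinj & _). intros Hz Hn (y & Hy & Hoy & E).
  apply Hn. replace z with y; auto. apply Hinj; auto. apply VsubU; auto.
Qed.

Lemma chart_open : is_open D.
Proof. destruct Hchart as (_ & _ & _ & _ & _ & _ & _ & _ & H & _). exact H. Qed.
Lemma chart_convex : is_convex D.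
Proof. destruct Hchart as (_ & _ & _ & _ & _ & _ & _ & _ & _ & H). exact H. Qed.

(** [V] is relatively compact in [U], so the limit is still a point where [Phi] is continuous. *)
Lemma V_subsequence u : (forall n : nat, V (u n)) ->
  exists phi l, extraction phi /\ vlim (fun n => u (phi n)) l /\ U l /\ vlim (fun n => Phi (u (phi n))) (Phi l).
Proof.
  destruct Hchart as (_ & _ & _ & _ & [M HM] & HVU & HF & _). intros Hu.
  destruct (bolzano_weierstrass d u M) as (phi & l & Hphi & Hl); [intros; apply HM, Hu|].
  assert (Ul : U l) by (apply HVU, (vlim_closure d V (fun n => u (phi n)) l Hl); auto).
  exists phi, l. repeat split; auto. apply (holomorphic_vlim d U Phi (fun n => u (phi n)) l HF Ul Hl).
Qed.

Lemma chart_bounded : is_bounded D.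
Proof.
  apply NNPP. intros Hn.
  assert (A : forall n, exists z, V z /\ INR n < vnorm (Phi z)).
  { intros n. apply NNPP. intros H. apply Hn. exists (INR n). intros y (z & Hz & _ & <-).
    apply Rnot_lt_le. intros Hlt. apply H. exists z; auto. }
  destruct (countable_choice _ _ A) as [u Hu].
  destruct (V_subsequence u) as (phi & l & Hphi & _ & _ & Hl); [apply Hu|].
  destruct (Hl 1 Rlt_0_1) as [N HN]. destruct (INR_unbounded (vnorm (Phi l) + 1)) as [N2 HN2].
  set (n := Nat.max N N2). specialize (HN n ltac:(lia)). destruct (Hu (phi n)) as [_ Hb].
  pose proof (vnorm_vdist d (Phi (u (phi n))) (Phi l)). pose proof (extraction_ge phi Hphi n).
  assert (INR N2 <= INR (phi n)) by (apply le_INR; lia). lra.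
Qed.

Lemma D_linked z w : D z -> D w -> linked D z w.
Proof. apply convex_linked; [apply chart_open|apply chart_convex]. Qed.

Lemma Om_linked z w : Om z -> Om w -> linked Om z w.
Proof. apply domain_linked; auto. Qed.

Lemma Otri a b c : Om a -> Om b -> Om c -> kob Om a c <= kob Om a b + kob Om b c.
Proof. intros. apply kob_triangle; apply Om_linked; auto. Qed.

Lemma Osym a b : Om a -> Om b -> kob Om a b = kob Om b a.
Proof. intros. apply kob_sym, Om_linked; auto. Qed.

Lemma Dtri a b c : D a -> D b -> D c -> kob D a c <= kob D a b + kob D b c.
Proof. intros. apply kob_triangle; apply D_linked; auto. Qed.

Lemma Dsym a b : D a -> D b -> kob D a b = kob D b a.
Proof. intros. apply kob_sym, D_linked; auto. Qed.

Lemma chain_image_length n u f : (forall i, (i <= n)%nat -> D (Phi (u i))) ->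
  (forall i, (i < n)%nat -> kob D (Phi (u i)) (Phi (u (S i))) <= f (S i) - f i) ->
  kob D (Phi (u 0%nat)) (Phi (u n)) <= f n - f 0%nat.
Proof.
  induction n as [|n IH]; intros HD Hs; [rewrite kob_self; lra|].
  pose proof (Dtri _ _ _ (HD 0%nat ltac:(lia)) (HD n ltac:(lia)) (HD (S n) ltac:(lia))).
  specialize (Hs n ltac:(lia)) as Hn.
  specialize (IH ltac:(intros; apply HD; lia) ltac:(intros; apply Hs; lia)). lra.
Qed.

Lemma exit_chain eta r w z L : 0 < eta -> Om w -> vdist w x < r -> r <= vdist z x -> hpath Om w z L ->
  exists N u t n, (0 < n <= N)%nat /\ fine_chain Om eta N u t /\ u 0%nat = w /\ u N = z /\ t 0%nat = 0 /\ t N = L /\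
    (forall i, (i <= N)%nat -> Om (u i)) /\ r <= vdist (u n) x /\ forall i, (i < n)%nat -> vdist (u i) x < r.
Proof.
  intros He Hw Hwx Hzx HL.
  destruct (fine_chain_of_path d Om eta w z L He HL) as (N & u & t & Hf & Hu0 & HuN & Ht0 & HtN).
  destruct (first_exit (fun i => vdist (u i) x < r) N) as (n & HnN & Hex & Hin).
  { rewrite Hu0. lra. } { rewrite HuN. lra. }
  exists N, u, t, n. repeat (split; auto); [|lra].
  intros i Hi. apply (hpath_in d Om w (u i) (t i - t 0%nat) Hw). rewrite <- Hu0.
  apply (fine_chain_path d Om eta N); auto; lia.
Qed.

(** Otherwise two sequences with unbounded Gromov products subconverge, to limits kept apart by
    their distances to [x] and hence with distinct images. If one image were in [D], the distances
    to [q] along that sequence, and so the products, would stay bounded ([Key]). Both images are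
    thus boundary points, and visibility applies. *)
Lemma chart_gromov q r1 r2 : D q -> r1 < r2 -> exists C, 0 <= C /\ forall z p,
  V z -> Om z -> V p -> Om p -> vdist z x <= r1 -> r2 <= vdist p x ->
  kob D (Phi z) q + kob D q (Phi p) - C <= kob D (Phi z) (Phi p).
Proof.
  intros Hq Hr. apply NNPP. intros Hn.
  assert (A : forall n, exists zp, (V (fst zp) /\ Om (fst zp) /\ V (snd zp) /\ Om (snd zp)) /\
     vdist (fst zp) x <= r1 /\ r2 <= vdist (snd zp) x /\
     kob D (Phi (fst zp)) (Phi (snd zp)) < kob D (Phi (fst zp)) q + kob D q (Phi (snd zp)) - INR n).
  { intros n. apply NNPP. intros H. apply Hn. exists (INR n). split; [apply pos_INR|]. intros z p Z1 Z2 P1 P2 Hz Hp.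
    apply Rnot_lt_le. intros Hlt. apply H. exists (z, p). simpl. auto. }
  destruct (countable_choice _ _ A) as [u Hu].
  destruct (V_subsequence (fun n => fst (u n))) as (f1 & z & E1 & L1 & Uz & K1); [apply Hu|].
  destruct (V_subsequence (fun n => snd (u (f1 n)))) as (f2 & p & E2 & L2 & Up & K2); [intros; apply Hu|].
  apply (vlim_extraction _ _ _ f2 E2) in L1. apply (vlim_extraction _ _ _ f2 E2) in K1.
  cbv beta in *. set (f := fun n => f1 (f2 n)) in *.
  assert (Ef : extraction f) by exact (extraction_comp f1 f2 E1 E2).
  assert (Dz : forall n, D (Phi (fst (u (f n))))) by (intros n; destruct (Hu (f n)) as ((?&?&?&?)&_); apply chart_in; auto).
  assert (Dp : forall n, D (Phi (snd (u (f n))))) by (intros n; destruct (Hu (f n)) as ((?&?&?&?)&_); apply chart_in; auto).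
  assert (Hz : vdist z x <= r1) by (exact (vlim_dist_le d _ z x r1 L1 (fun n => proj1 (proj2 (Hu (f n)))))).
  assert (Hp : r2 <= vdist p x) by (exact (vlim_dist_ge d _ p x r2 L2 (fun n => proj1 (proj2 (proj2 (Hu (f n))))))).
  assert (Hne : Phi z <> Phi p).
  { intros E. destruct Hchart as (_ & _ & _ & _ & _ & _ & _ & Hinj & _). apply Hinj in E; auto. subst. lra. }
  assert (HnR : forall n, INR n <= INR (f n)) by (intros n; apply le_INR, extraction_ge; auto).
  assert (Key : forall a b y, (forall n : nat, D (a n)) -> (forall n, D (b n)) -> vlim a y ->
    (forall n, kob D (a n) (b n) < kob D (a n) q + kob D q (b n) - INR n) -> ~ D y).
  { intros a b y Da Db Hay Hlt HD. destruct (kob_vlim d D _ _ chart_open HD Hay 1 Rlt_0_1) as [N HN].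
    destruct (INR_unbounded (2 * (kob D y q + 1))) as [N2 HN2].
    set (n := Nat.max N N2). destruct (HN n ltac:(lia)) as (_ & _ & B3). specialize (Hlt n).
    assert (INR N2 <= INR n) by (apply le_INR; lia).
    pose proof (Dtri _ _ q (Da n) HD Hq). rewrite (Dsym _ y (Da n) HD) in H0.
    pose proof (Dtri q _ _ Hq (Da n) (Db n)). rewrite (Dsym q _ Hq (Da n)) in H1. lra. }
  assert (HDz : ~ D (Phi z)).
  { apply (Key _ (fun n => Phi (snd (u (f n)))) _ Dz Dp K1). intros n.
    destruct (Hu (f n)) as (_ & _ & _ & Hlt). specialize (HnR n). fold (f n). lra. }
  assert (HDp : ~ D (Phi p)).
  { apply (Key _ (fun n => Phi (fst (u (f n)))) _ Dp Dz K2). intros n.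
    destruct (Hu (f n)) as (_ & _ & _ & Hlt). specialize (HnR n). fold (f n).
    rewrite (Dsym _ _ (Dp n) (Dz n)), (Dsym _ q (Dp n) Hq), (Dsym q _ Hq (Dz n)). lra. }
  destruct (visibility_gromov d D q _ _ (Phi z) (Phi p) chart_open chart_convex chart_bounded Hvis Hq Dz Dp K1 K2 HDz HDp Hne)
    as (C & N & HC).
  destruct (INR_unbounded C) as [N2 HN2]. set (n := Nat.max N N2). specialize (HC n ltac:(lia)).
  destruct (Hu (f n)) as (_ & _ & _ & Hlt).
  assert (INR N2 <= INR n) by (apply le_INR; lia). specialize (HnR n). lra.
Qed.

Variables (q : Cd d) (Rad CF : R).
Hypothesis Hq : D q.
Hypothesis HRad : 0 < Rad.
Hypothesis HRV : forall z, vdist z x < Rad -> V z.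
(* Upper bound coming from the Dini condition; it replaces the inequality
   [kob Om <= kob D], which would need [Phi] to have a holomorphic inverse. *)
Hypothesis HF1 : forall w, Om w -> vdist w x < Rad -> kob Om o w <= kob D (Phi w) q + CF.

Let VO := fun y => V y /\ Om y.

Lemma localized_step s h z w : Om z -> 0 < s -> h < s -> (forall z', Om z' -> ~ V z' -> s <= kob Om z z') ->
  hstep Om h z w -> V w /\ Om w /\ kob D (Phi z) (Phi w) <= artanh (tanh h / tanh s).
Proof.
  intros Hz Hs Hhs HV Hst. apply (hstep_localize d Om V s) in Hst; auto using Om_linked.
  destruct (hstep_in _ _ _ _ _ Hst) as [_ [H1 H2]]. split; [auto|split; auto].
  apply kob_le, hpath_step. destruct Hchart as (_ & _ & _ & _ & _ & _ & HF & _).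
  apply (hstep_image d VO D U Phi); auto.
  - intros y [Hy _]. apply VsubU; auto. - intros y [Hy Hy']. apply chart_in; auto.
Qed.

Lemma escape_dist : exists s0, 0 < s0 /\ forall z z', Om z -> vdist z x < Rad / 2 -> Om z' -> ~ V z' -> s0 <= kob Om z z'.
Proof.
  (* The Euclidean gap is at least Rad / 2, and [vdist_kob_le] divides it by 6 M. *)
  destruct (bounded_ball d Om HOb) as (M & HM & HB). exists (Rad / (12 * M)).
  split; [apply Rdiv_lt_0_compat; lra|]. intros z z' Hz Hzx Hz' Hn.
  pose proof (vdist_kob_le d Om vzero M z z' HM HB (Om_linked z z' Hz Hz')).
  assert (Rad <= vdist z' x) by (apply Rnot_lt_le; intros L; apply Hn, HRV, L).
  pose proof (vdist_triangle d z' z x). rewrite (vdist_sym d z' z) in H1.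
  apply Rle_div_l; lra.
Qed.

(** A chain leaving [V] first leaves the ball of radius Rad / 2. Up to that exit [escape_dist] and a
    relative error of 1 give the crude factor [C1] for lengths in the image, and by [chart_gromov]
    the image has to cover the distance from [Phi z] to [q] up to a constant. *)
Lemma escape_dist_log : exists c K, 0 < c /\ 0 <= K /\ forall z z', Om z -> vdist z x < Rad / 4 -> Om z' -> ~ V z' ->
  c * (kob D (Phi z) q - K) <= kob Om z z'.
Proof.
  destruct escape_dist as (s0 & Hs0 & HE).
  destruct (localized_length_bound s0 Hs0) as (C0 & HC0 & HL).
  destruct (HL 1 ltac:(lra)) as (eta & Heta & Heta2 & _ & Hlen).
  destruct (chart_gromov q (Rad / 4) (Rad / 2) Hq ltac:(lra)) as (K & HK & HG).
  set (C1 := 2 + C0). assert (HC1 : 0 < C1) by (unfold C1; lra).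
  exists (/ C1), K. split; [apply Rinv_0_lt_compat; auto|]. split; auto.
  intros z z' Hz Hzx Hz' Hn. apply kob_ge; [apply Om_linked; auto|]. intros L HLp.
  assert (Rad <= vdist z' x) by (apply Rnot_lt_le; intros L2; apply Hn, HRV, L2).
  destruct (exit_chain eta (Rad / 2) z z' L Heta Hz ltac:(lra) ltac:(lra) HLp)
    as (N & u & t & n & HnN & Hf & Hu0 & HuN & Ht0 & HtN & HO & Hex & Hin).
  assert (Hstep : forall i, (i < n)%nat -> V (u (S i)) /\ kob D (Phi (u i)) (Phi (u (S i))) <= C1 * t (S i) - C1 * t i).
  { intros i Hi. destruct (Hf i ltac:(lia)) as [S1 S2].
    destruct (localized_step s0 (t (S i) - t i) (u i) (u (S i))) as (A1 & A2 & A3); auto.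
    - apply HO; lia. - lra. - intros y Hy Hy'. apply HE; auto. apply HO; lia.
    - split; auto. eapply Rle_trans; [apply A3|].
      pose proof (proj1 S1) as Hp. eapply Rle_trans; [apply Hlen; lra|].
      assert (exp (- (2 * s0)) <= 1) by (rewrite <- exp_0; apply exp_le_mono; lra).
      assert ((t (S i) - t i) * exp (- (2 * s0)) <= t (S i) - t i) by nra. unfold C1. nra. }
  assert (HV : forall i, (i <= n)%nat -> V (u i)).
  { intros [|i] Hi; [rewrite Hu0; apply HRV; lra|]. apply Hstep; lia. }
  assert (HDi : forall i, (i <= n)%nat -> D (Phi (u i))) by (intros i Hi; apply chart_in; [apply HV|apply HO]; lia).
  pose proof (chain_image_length n u (fun i => C1 * t i) HDi (fun i Hi => proj2 (Hstep i Hi))) as Hsum.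
  cbv beta in Hsum. rewrite Hu0, Ht0 in Hsum.
  pose proof (HG z (u n) (HRV z ltac:(lra)) Hz (HV n (Nat.le_refl _)) (HO n ltac:(lia)) ltac:(lra) Hex) as G.
  pose proof (kob_nonneg d D q (Phi (u n)) (D_linked _ _ Hq (HDi n (Nat.le_refl _)))).
  pose proof (hpath_nonneg _ _ _ _ _ (fine_chain_path d Om eta N u t Hf n N ltac:(lia) ltac:(lia))).
  apply (Rmult_le_reg_l C1); auto. rewrite <- Rmult_assoc, Rinv_r, Rmult_1_l by lra.
  assert (C1 * t n <= C1 * L) by (apply Rmult_le_compat_l; lra). lra.
Qed.

(* Along an almost length-minimizing chain of [Om] near [x] the localization error is
   summable: writing [i0] for the vertex closest to [q] in [D], the distance from the
   vertex [i] to the complement of [V] grows linearly in [|t i - t i0|]. *)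
Lemma localized_lower_bound : exists K, forall w z, Om w -> vdist w x < Rad / 16 -> Om z -> Rad / 8 <= vdist z x ->
  kob D (Phi w) q + kob Om o z - K <= kob Om w z.
Proof.
  destruct escape_dist as (s0 & Hs0 & HE).
  destruct escape_dist_log as (c & K1 & Hc & HK1 & HEl).
  destruct (localized_length_bound s0 Hs0) as (C0 & HC0 & HL).
  destruct (chart_gromov q (Rad / 16) (Rad / 8) Hq ltac:(lra)) as (K2 & HK2 & HG).
  destruct (bounded_ball d Om HOb) as (M & HM & HB).
  (* [K3] collects the additive constants of [escape_dist_log] and of [Hgap] in the bound [E1] for
     exp (- 2 s). In [K4], 1 / c comes from rescaling [potential], and exp c from its increment
     lemma, as steps have length at most 1. *)
  set (K3 := exp (2 * c * K1 + c * (2 * CF + 1))). pose proof (exp_pos (2 * c * K1 + c * (2 * CF + 1))) as HK3. fold K3 in HK3.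
  set (K4 := C0 * K3 * (exp c / c)). pose proof (exp_pos c) as Hec.
  assert (HK4 : 0 < K4) by (repeat apply Rmult_lt_0_compat; auto; apply Rinv_0_lt_compat; auto).
  (* [K2] is the Gromov defect in the chart, [CF] exchanges distances at the exit vertex, 4 K4
     bounds the localization error, and the two units pay for the relative error and for the chain
     not being minimal. *)
  exists (K2 + CF + 4 * K4 + 2).
  intros w z Hw Hwx Hz Hzx.
  assert (Hlk : linked Om w z) by (apply Om_linked; auto).
  destruct (kob_approx d Om w z 1 Hlk Rlt_0_1) as (L & HLp & HLk).
  pose proof (hpath_nonneg _ _ _ _ _ HLp) as HL0.
  (* Over a chain of length [L] this relative error accumulates to at most 1. *)
  set (eps := / (L + 1)).
  assert (Heps : 0 < eps <= 1).
  { split; [apply Rinv_0_lt_compat; lra|]. rewrite <- Rinv_1. apply Rinv_le_contravar; lra. }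
  destruct (HL eps Heps) as (eta0 & Heta0 & Heta1 & Heta2 & Hlen).
  (* The second bound limits the Euclidean length of a step to Rad / 16, so the exit vertex is still
     within [Rad] of [x], where [HF1] holds. *)
  minimum eta eta0 (Rad / (96 * M)).
  assert (Heta : 0 < eta) by (apply Rmin_pos; auto; apply Rdiv_lt_0_compat; lra).
  destruct (exit_chain eta (Rad / 8) w z L Heta Hw ltac:(lra) Hzx HLp)
    as (N & u & t & n & HnN & Hf & Hu0 & HuN & Ht0 & HtN & HO & Hex & Hin).
  assert (Hpath : forall i j, (i <= j)%nat -> (j <= N)%nat -> hpath Om (u i) (u j) (t j - t i)).
  { apply (fine_chain_path d Om eta N u t Hf). }
  (* A chain within 1 of the infimum is within 1 of it between any two of its vertices. *)
  assert (Hnear : forall i j, (i <= j)%nat -> (j <= N)%nat -> t j - t i <= kob Om (u i) (u j) + 1).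
  { intros i j Hij Hj.
    pose proof (kob_le _ _ _ _ _ (Hpath 0%nat i ltac:(lia) ltac:(lia))) as T1.
    pose proof (kob_le _ _ _ _ _ (Hpath j N ltac:(lia) ltac:(lia))) as T2. rewrite Hu0 in T1. rewrite HuN in T2.
    assert (Oi : Om (u i)) by (apply HO; lia). assert (Oj : Om (u j)) by (apply HO; lia).
    pose proof (Otri w (u i) z Hw Oi Hz). pose proof (Otri (u i) (u j) z Oi Oj Hz). lra. }
  destruct (argmin_nat (fun i => kob D (Phi (u i)) q) n ltac:(lia)) as (i0 & Hi0 & Hargmin).
  set (kap := fun i => kob D (Phi (u i)) q) in *.
  (* Two vertices are compared through [o], whose distances to them [HF1] bounds by [kap];
     minimality at [i0] replaces [kap i0] by [kap i]. *)
  assert (Hgap : forall i, (i < n)%nat -> Rabs (t i - t i0) <= 2 * kap i + (2 * CF + 1)).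
  { assert (Hd : forall i j, (i < n)%nat -> (j < n)%nat -> (i <= j)%nat -> t j - t i <= kap i + kap j + (2 * CF + 1)).
    { intros i j Hi Hj Hij. pose proof (Hnear i j Hij ltac:(lia)) as T.
      assert (Oi : Om (u i)) by (apply HO; lia). assert (Oj : Om (u j)) by (apply HO; lia).
      pose proof (Otri (u i) o (u j) Oi Ho Oj) as T2. rewrite (Osym (u i) o Oi Ho) in T2.
      pose proof (Hin i Hi). pose proof (Hin j Hj).
      pose proof (HF1 (u i) Oi ltac:(lra)). pose proof (HF1 (u j) Oj ltac:(lra)). fold (kap i) in H1. fold (kap j) in H2. lra. }
    intros i Hi. assert (Hargmin' : kap i0 <= kap i) by exact (Hargmin i Hi).
    destruct (Nat.le_ge_cases i i0) as [Hle|Hle].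
    - pose proof (Hd i i0 Hi Hi0 Hle). 
      pose proof (hpath_nonneg _ _ _ _ _ (Hpath i i0 Hle ltac:(lia))).
      rewrite Rabs_left1 by lra. lra.
    - pose proof (Hd i0 i Hi0 Hi Hle). 
      pose proof (hpath_nonneg _ _ _ _ _ (Hpath i0 i Hle ltac:(lia))). rewrite Rabs_right by lra. lra. }
  set (G := fun s => potential (c * (s - t i0))).
  set (f := fun i => (1 + eps) * t i + K4 * G (t i)).
  assert (Hstep : forall i, (i < n)%nat -> V (u (S i)) /\
     kob D (Phi (u i)) (Phi (u (S i))) <= f (S i) - f i).
  { intros i Hi. destruct (Hf i ltac:(lia)) as [S1 S2]. pose proof (proj1 S1) as Hp.
    pose proof (Hin i Hi) as Hinx. assert (Oi : Om (u i)) by (apply HO; lia).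
    (* The linear bound may be negative near [q]; [s0] keeps the localization radius bounded away
       from 0. *)
    set (s := Rmax s0 (c * (kap i - K1))).
    pose proof (Rmax_l s0 (c * (kap i - K1))) as Ms1. pose proof (Rmax_r s0 (c * (kap i - K1))) as Ms2. fold s in Ms1, Ms2.
    destruct (localized_step s (t (S i) - t i) (u i) (u (S i))) as (A1 & A2 & A3); auto; try lra.
    { intros y Hy Hy'. apply Rmax_lub; [apply HE; auto; lra|apply HEl; auto; lra]. }
    split; auto.
    replace (f (S i) - f i) with ((1 + eps) * (t (S i) - t i) + K4 * (G (t (S i)) - G (t i))) by (unfold f; ring).
    eapply Rle_trans; [apply A3|]. set (h := t (S i) - t i) in *.
    eapply Rle_trans; [apply Hlen; lra|]. rewrite (Rmult_comm h). apply Rplus_le_compat_l.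
    specialize (Hgap i Hi).
    assert (E1 : exp (- (2 * s)) <= K3 * exp (- (c * Rabs (t i - t i0)))).
    { unfold K3. rewrite <- exp_plus.
      assert (c * Rabs (t i - t i0) <= c * (2 * kap i + (2 * CF + 1))) by (apply Rmult_le_compat_l; lra).
      assert (B : - (2 * s) <= 2 * c * K1 + c * (2 * CF + 1) + - (c * Rabs (t i - t i0))) by lra.
      apply exp_le_mono; lra. }
    pose proof (potential_increment (c * (t i - t i0)) (c * h) ltac:(nra)) as P.
    replace (c * (t i - t i0) + c * h) with (c * (t (S i) - t i0)) in P by (unfold h; ring).
    fold (G (t (S i))) (G (t i)) in P.
    rewrite Rabs_mult, (Rabs_right c) in P by lra. unfold Rminus at 1 in P. rewrite exp_plus in P.
    set (E := exp (- (c * Rabs (t i - t i0)))) in *. pose proof (exp_pos (- (c * Rabs (t i - t i0)))) as HE0. fold E in HE0.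
    assert (E2 : / exp c <= exp (- (c * h))).
    { rewrite <- exp_Ropp. assert (B : - c <= - (c * h)) by nra.
      apply exp_le_mono; lra. }
    assert (E3 : h * E <= exp c / c * (G (t (S i)) - G (t i))).
    { assert (c * h * (E * / exp c) <= G (t (S i)) - G (t i)).
      { eapply Rle_trans; [|apply P]. apply Rmult_le_compat_l; [nra|]. apply Rmult_le_compat_l; lra. }
      replace (h * E) with (exp c / c * (c * h * (E * / exp c))) by (field; lra).
      apply Rmult_le_compat_l; auto. left. apply Rdiv_lt_0_compat; auto. }
    assert (h * exp (- (2 * s)) <= h * (K3 * E)) by (apply Rmult_le_compat_l; lra).
    unfold K4. 
    apply Rle_trans with (C0 * (K3 * (h * E))).
    - apply Rmult_le_compat_l; lra.
    - replace (C0 * K3 * (exp c / c) * (G (t (S i)) - G (t i)))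
        with (C0 * (K3 * (exp c / c * (G (t (S i)) - G (t i))))) by ring.
      apply Rmult_le_compat_l; [lra|]. apply Rmult_le_compat_l; lra. }
  assert (HV : forall i, (i <= n)%nat -> V (u i)).
  { intros [|i] Hi; [rewrite Hu0; apply HRV; lra|]. apply Hstep; lia. }
  assert (HDi : forall i, (i <= n)%nat -> D (Phi (u i))) by (intros i Hi; apply chart_in; [apply HV|apply HO]; lia).
  pose proof (chain_image_length n u f HDi (fun i Hi => proj2 (Hstep i Hi))) as Hsum.
  unfold f in Hsum. rewrite Hu0, Ht0 in Hsum.
  assert (On : Om (u n)) by (apply HO; lia). assert (Dn : D (Phi (u n))) by (apply HDi; lia).
  assert (Htn : 0 <= t n <= L).
  { pose proof (hpath_nonneg _ _ _ _ _ (Hpath 0%nat n ltac:(lia) ltac:(lia))).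
    pose proof (hpath_nonneg _ _ _ _ _ (Hpath n N ltac:(lia) ltac:(lia))). lra. }
  assert (Heps2 : eps * t n <= 1).
  { apply Rle_trans with (eps * (L + 1)); [apply Rmult_le_compat_l; lra|]. unfold eps. right. field. lra. }
  assert (HG2 : K4 * (G (t n) - G 0) <= 4 * K4).
  { pose proof (potential_range (c * (t n - t i0))). pose proof (potential_range (c * (0 - t i0))).
    unfold G. rewrite Rmult_comm. apply Rmult_le_compat_r; lra. }
  pose proof (HG w (u n) (HRV w ltac:(lra)) Hw (HV n ltac:(lia)) On ltac:(lra) Hex) as HGr.
  assert (Hclose : vdist (u n) x < Rad).
  { destruct n as [|n]; [lia|]. destruct (Hf n ltac:(lia)) as [S1 S2]. pose proof (Hin n ltac:(lia)).
    pose proof (hstep_vdist_le d Om vzero M _ _ _ HM HB S1) as T.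
    pose proof (vdist_triangle d (u (S n)) (u n) x). rewrite (vdist_sym d (u (S n)) (u n)) in H0.
    assert (6 * M * (t (S n) - t n) <= 6 * M * (Rad / (96 * M))) by (apply Rmult_le_compat_l; lra).
    replace (6 * M * (Rad / (96 * M))) with (Rad / 16) in H1 by (field; lra). lra. }
  (* At the exit vertex the distance to [q] in the image is exchanged for the distance to [o] in
     [Om]; the rest of the chain then leads on to [z]. *)
  pose proof (HF1 (u n) On Hclose) as HFn.
  rewrite (Dsym (Phi (u n)) q Dn Hq) in HFn.
  pose proof (kob_le _ _ _ _ _ (Hpath n N ltac:(lia) ltac:(lia))) as Htail. rewrite HuN in Htail.
  pose proof (Otri o (u n) z Ho On Hz) as Htri.
  lra.
Qed.
End Chart.

(** * Dini-smooth boundary points: upper bounds along normals *)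

Lemma INR_le_pow2 n : INR n <= 2 ^ n.
Proof.
  induction n as [|n IH]; [simpl; lra|]. rewrite S_INR. simpl pow.
  assert (1 <= 2 ^ n) by (apply pow_R1_Rle; lra). lra.
Qed.

(** * Consequences of the Dini integral for the modulus of continuity *)

Section Modulus.
Variables (omega : R -> R) (eps M : R).
Hypothesis Hmono : forall s t, 0 <= s -> s <= t -> 0 <= omega s <= omega t.
Hypothesis Heps : 0 < eps.
Hypothesis Hint : forall del, 0 < del < eps ->
  ex_RInt (fun t => omega t / t) del eps /\ RInt (fun t => omega t / t) del eps <= M.

Let phi := fun t => omega t / t.

Lemma modulus_ex_RInt a b : 0 < a -> a <= b -> b < eps -> ex_RInt phi a b.
Proof.
  intros Ha Hab Hb. destruct (Hint a ltac:(lra)) as [E _].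
  apply (ex_RInt_Chasles_1 (V := R_CompleteNormedModule) phi a b eps); [lra|exact E].
Qed.

Lemma modulus_RInt_nonneg a b : 0 < a -> a <= b -> b < eps -> 0 <= RInt phi a b.
Proof.
  intros Ha Hab Hb. apply RInt_ge_0; auto. { apply modulus_ex_RInt; auto. }
  intros t Ht. unfold phi. apply Rmult_le_pos; [apply (Hmono t t); lra|left; apply Rinv_0_lt_compat; lra].
Qed.

Lemma modulus_RInt_le a b : 0 < a -> a <= b -> b < eps -> RInt phi a b <= M.
Proof.
  intros Ha Hab Hb. destruct (Hint a ltac:(lra)) as [E1 L1]. destruct (Hint b ltac:(lra)) as [E2 _].
  pose proof (RInt_Chasles (V := R_CompleteNormedModule) phi a b eps (modulus_ex_RInt a b Ha Hab Hb) E2) as E.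
  unfold plus in E; simpl in E. fold phi in L1. rewrite <- E in L1.
  assert (0 <= RInt phi b eps); [|lra]. apply RInt_ge_0; auto; [lra|].
  intros t Ht. unfold phi. apply Rmult_le_pos; [apply (Hmono t t); lra|left; apply Rinv_0_lt_compat; lra].
Qed.

Lemma modulus_RInt_chasles a b c : 0 < a -> a <= b -> b <= c -> c < eps ->
  RInt phi a c = RInt phi a b + RInt phi b c.
Proof.
  intros. symmetry. apply (RInt_Chasles (V := R_CompleteNormedModule) phi a b c); apply modulus_ex_RInt; lra.
Qed.

(** By monotonicity the integrand is at least omega a / (2 a) on [a, 2 a]. This turns sums of
    [omega] over dyadic scales into the Dini integral. *)
Lemma modulus_le_RInt a : 0 < a -> 2 * a < eps -> omega a <= 2 * RInt phi a (2 * a).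
Proof.
  intros Ha Hb.
  assert (RInt (fun _ => omega a / (2 * a)) a (2 * a) <= RInt phi a (2 * a)).
  { apply RInt_le; [lra|apply ex_RInt_const|apply modulus_ex_RInt; lra|].
    intros t Ht. unfold phi, Rdiv. pose proof (Hmono a t ltac:(lra) ltac:(lra)).
    apply Rmult_le_compat; try lra. - left; apply Rinv_0_lt_compat; lra. - apply Rinv_le_contravar; lra. }
  rewrite RInt_const in H. unfold scal in H; simpl in H. unfold mult in H; simpl in H.
  replace ((2 * a - a) * (omega a / (2 * a))) with (omega a / 2) in H by (field; lra). lra.
Qed.

(** Each of the n dyadic intervals above [a] contributes at least half of omega a to an integral
    bounded by [M], so omega a <= 2 M / n. *)
Lemma modulus_small kappa : 0 < kappa -> exists t0, 0 < t0 /\ forall t, 0 <= t <= t0 -> omega t <= kappa.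
Proof.
  intros Hk.
  assert (A : forall n a, 0 < a -> a * 2 ^ n < eps -> INR n * omega a <= 2 * RInt phi a (a * 2 ^ n)).
  { induction n as [|n IH]; intros a Ha Hlt.
    - simpl. rewrite Rmult_1_r, RInt_point. unfold zero; simpl. lra.
    - rewrite S_INR. assert (H2 : 1 <= 2 ^ n) by (apply pow_R1_Rle; lra). simpl in Hlt |- *.
      specialize (IH a Ha ltac:(nra)).
      rewrite (modulus_RInt_chasles a (a * 2 ^ n) (a * (2 * 2 ^ n))) by nra.
      pose proof (modulus_le_RInt (a * 2 ^ n) ltac:(nra) ltac:(nra)) as L.
      replace (2 * (a * 2 ^ n)) with (a * (2 * 2 ^ n)) in L by ring.
      pose proof (Hmono a (a * 2 ^ n) ltac:(lra) ltac:(nra)). lra. }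
  assert (HM : 0 <= M).
  { eapply Rle_trans; [|apply (modulus_RInt_le (eps / 2) (eps / 2)); lra].
    apply modulus_RInt_nonneg; lra. }
  destruct (INR_unbounded (2 * M / kappa)) as [n Hn].
  assert (H2 : 0 < 2 ^ n) by (apply pow_lt; lra).
  set (a := eps / 2 / 2 ^ n). assert (Ha : 0 < a) by (apply Rdiv_lt_0_compat; lra).
  assert (Ea : a * 2 ^ n = eps / 2) by (unfold a; field; lra).
  exists a. split; auto. intros t Ht. apply Rle_trans with (omega a); [apply Hmono; lra|].
  specialize (A n a Ha ltac:(lra)).
  pose proof (modulus_RInt_le a (a * 2 ^ n) Ha ltac:(pose proof (pow_R1_Rle 2 n ltac:(lra)); nra) ltac:(lra)) as B.
  apply Rnot_lt_le. intros Hlt.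
  assert (0 < INR n). { eapply Rle_lt_trans; [|apply Hn]. apply Rmult_le_pos; [lra|left; apply Rinv_0_lt_compat; auto]. }
  apply (Rmult_lt_compat_r kappa) in Hn; auto. unfold Rdiv in Hn. rewrite Rmult_assoc, Rinv_l in Hn by lra. nra.
Qed.
End Modulus.

(** The exit time is a supremum. Only an open initial piece of the segment is required to lie in
    [Om], so that [p] may itself be a boundary point, as in [inward_segment]. *)
Lemma line_exit d (Om : Cd d -> Prop) p u : is_open Om ->
  (exists del, 0 < del /\ forall s, 0 < s < del -> Om (vadd p (vrscal s u))) -> ~ Om (vadd p u) ->
  exists t, 0 < t <= 1 /\ bdry Om (vadd p (vrscal t u)) /\ forall s, 0 < s < t -> Om (vadd p (vrscal s u)).
Proof.
  intros Ho (del & Hdel & Hstart) Hy. set (pt := fun t => vadd p (vrscal t u)).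
  destruct (completeness (fun t => 0 <= t <= 1 /\ forall s, 0 < s < t -> Om (pt s))) as [t [H1 H2]].
  { exists 1. intros t [Ht _]. lra. } { exists 0. split; [lra|]. intros s Hs. lra. }
  pose proof (vnorm_nonneg d u) as Hu.
  assert (Ht : 0 < t <= 1).
  { split; [|apply H2; intros s [Hs _]; lra]. minimum m 1 del.
    assert (0 < m) by (apply Rmin_pos; lra). apply Rlt_le_trans with m; auto.
    apply H1. split; [lra|]. intros s Hs. apply Hstart. lra. }
  assert (Hbelow : forall s, 0 < s < t -> Om (pt s)).
  { intros s Hs. apply NNPP. intros Hn. assert (t <= s); [|lra].
    apply H2. intros t' [_ K]. apply Rnot_lt_le. intros Hlt. apply Hn, K. lra. }
  assert (Hd : forall s, vdist (pt s) (pt t) = Rabs (s - t) * vnorm u).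
  { intros s. unfold vdist. replace (vsub (pt s) (pt t)) with (vrscal (s - t) u) by (unfold pt; vext).
    apply vnorm_vrscal. }
  assert (Hclose : forall e, 0 < e -> exists h, 0 < h < t /\ forall s, Rabs (s - t) <= h -> vdist (pt s) (pt t) < e).
  { intros e He. minimum h (t / 2) (e / (2 * (vnorm u + 1))).
    assert (0 < h) by (apply Rmin_pos; [|apply Rdiv_lt_0_compat]; lra).
    exists h. split; [lra|]. intros s Hs. rewrite Hd. apply Rle_div_r in Hmin0; [|lra].
    pose proof (Rabs_pos (s - t)). nra. }
  exists t. split; auto. split; auto. split.
  - intros e He. destruct (Hclose e He) as (h & Hh & K). exists (pt (t - h)). split; [apply Hbelow; lra|].
    apply K. rewrite Rabs_left; lra.
  - intros HO. destruct (Ho _ HO) as (r & Hr & HB). destruct (Hclose r Hr) as (h & Hh & K).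
    destruct (Req_dec t 1) as [->|Hne].
    { apply Hy. replace u with (vrscal 1 u) by vext. exact HO. }
    minimum m h (1 - t). assert (0 < m) by (apply Rmin_pos; lra).
    assert (t + m <= t); [|lra]. apply H1. split; [lra|]. intros s Hs.
    destruct (Rlt_le_dec s t); [apply Hbelow; lra|]. apply HB, K. rewrite Rabs_right; lra.
Qed.

(** * Inner normals and discs in the complex normal lines *)

Section Normal.
Variables (d : nat) (Om W : Cd d -> Prop) (rho : Cd d -> R) (g : Cd d -> Cd d).
Hypothesis HOo : is_open Om.
Hypothesis HC1 : C1_on W rho g.
Hypothesis Hg : forall z, W z -> g z <> vzero.
Hypothesis Hdef : forall z, W z -> (Om z <-> rho z < 0).
Hypothesis HWo : is_open W.

Definition unit_normal (p : Cd d) : Cd d := vrscal (/ vnorm (g p)) (g p).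

Lemma gnorm_pos p : W p -> 0 < vnorm (g p).
Proof.
  intros Hp. destruct (Rle_lt_or_eq_dec _ _ (vnorm_nonneg d (g p))) as [|E]; auto.
  symmetry in E. apply vnorm_eq_0 in E. exfalso. apply (Hg p); auto.
Qed.

Lemma unit_normal_norm p : W p -> vnorm (unit_normal p) = 1.
Proof.
  intros Hp. pose proof (gnorm_pos p Hp). unfold unit_normal.
  rewrite vnorm_vrscal, Rabs_right; [field; lra|left; apply Rinv_0_lt_compat; auto].
Qed.

Lemma g_unit_normal p : W p -> g p = vrscal (vnorm (g p)) (unit_normal p).
Proof.
  intros Hp. pose proof (gnorm_pos p Hp). unfold unit_normal.
  apply functional_extensionality; intros i; unfold vrscal.
  rewrite Cmult_assoc, <- RtoC_mult, Rinv_r by lra. ring.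
Qed.

Lemma rho_line_derivative p u : W p -> forall e, 0 < e -> exists del, 0 < del /\ forall h, Rabs h < del ->
  Rabs (rho (vadd p (vrscal h u)) - rho p - h * rinner (g p) u) <= e * Rabs h.
Proof.
  intros Hp e He. destruct HC1 as [H _]. pose proof (vnorm_nonneg d u).
  destruct (H p Hp (e / (vnorm u + 1))) as (del & Hd & K); [apply Rdiv_lt_0_compat; lra|].
  exists (del / (vnorm u + 1)). split; [apply Rdiv_lt_0_compat; lra|]. intros h Hh. pose proof (Rabs_pos h).
  specialize (K (vrscal h u)). rewrite vnorm_vrscal, rinner_vrscal_r in K.
  eapply Rle_trans; [apply K|].
  - apply Rle_lt_trans with (Rabs h * (vnorm u + 1)); [apply Rmult_le_compat_l; lra|].
    apply (Rmult_lt_compat_r (vnorm u + 1)) in Hh; [|lra].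
    replace (del / (vnorm u + 1) * (vnorm u + 1)) with del in Hh by (field; lra). auto.
  - apply Rle_trans with (e / (vnorm u + 1) * (Rabs h * (vnorm u + 1))).
    + apply Rmult_le_compat_l; [left; apply Rdiv_lt_0_compat; lra|]. apply Rmult_le_compat_l; lra.
    + right. field. lra.
Qed.

Lemma rho_decreasing_line p u : W p -> rinner (g p) u < 0 -> exists del, 0 < del /\ forall h, 0 < h < del ->
  rho (vadd p (vrscal h u)) < rho p /\ rho p < rho (vadd p (vrscal (- h) u)).
Proof.
  intros Hp Hu. destruct (rho_line_derivative p u Hp (- rinner (g p) u / 2) ltac:(lra)) as (del & Hd & K).
  exists del. split; auto. intros h Hh. split.
  - specialize (K h). rewrite Rabs_right in K by lra. specialize (K ltac:(lra)). apply Rabs_le_between in K. nra.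
  - specialize (K (- h)). rewrite Rabs_Ropp, Rabs_right in K by lra. specialize (K ltac:(lra)). apply Rabs_le_between in K. nra.
Qed.

Lemma rho_bdry p : W p -> bdry Om p -> rho p = 0.
Proof.
  intros Hp [Hc Hn]. assert (0 <= rho p) by (apply Rnot_lt_le; intros L; apply Hn, Hdef; auto).
  destruct (Rle_lt_or_eq_dec _ _ H) as [L|]; auto. exfalso.
  destruct HC1 as [HD _]. destruct (HD p Hp 1 Rlt_0_1) as (del & Hd & K).
  destruct (HWo p Hp) as (r & Hr & HB). pose proof (vnorm_nonneg d (g p)) as Hgn.
  minimum m del r. minimum e m (rho p / (2 + vnorm (g p))).
  assert (He : 0 < e) by (repeat apply Rmin_pos; auto; apply Rdiv_lt_0_compat; lra).
  apply Rle_div_r in Hmin2; [|lra].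
  destruct (Hc e He) as (z & Hz & Hzp).
  assert (Wz : W z) by (apply HB; lra). apply Hdef in Hz; auto.
  set (h := vsub z p). assert (Eh : vnorm h = vdist z p) by reflexivity.
  specialize (K h ltac:(lra)). replace (vadd p h) with z in K by (unfold h; vext).
  pose proof (Rabs_rinner_le d (g p) h) as C. rewrite Eh in *.
  apply Rabs_le_between in K. apply Rabs_le_between in C. pose proof (vdist_nonneg d z p). nra.
Qed.

(** The ball about [w] of radius [s] lies in [Om] and touches its boundary at [xi]. This forces
    rinner nu n >= s for the radius n = xi - w of length s, the equality case of Cauchy-Schwarz,
    hence n = s nu. *)
Lemma nearest_bdry_normal w xi : Om w -> bdry Om xi -> W xi ->
  (forall xi', bdry Om xi' -> vdist w xi <= vdist w xi') ->
  w = vsub xi (vrscal (vdist w xi) (unit_normal xi)).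
Proof.
  intros Hw Hxi HWxi Hmin. set (s := vdist w xi) in *.
  assert (Hs : 0 < s).
  { apply vdist_pos. intros E. subst w. apply (proj2 Hxi); auto. }
  assert (HB : forall y, vdist y w < s -> Om y).
  { intros y Hy. apply NNPP. intros Hn. destruct (HOo w Hw) as (r & Hr & HBw).
    pose proof (vdist_nonneg d y w) as Hyw.
    destruct (line_exit d Om w (vsub y w) HOo) as (t & Ht & Hb & _).
    - exists (r / (vdist y w + 1)). split; [apply Rdiv_lt_0_compat; lra|]. intros t [Ht1 Ht2]. apply HBw.
      apply Rlt_div_r in Ht2; [|lra]. unfold vdist at 1.
      replace (vsub (vadd w _) w) with (vrscal t (vsub y w)) by vext.
      rewrite vnorm_vrscal, Rabs_right by lra. fold (vdist y w). lra.
    - replace (vadd w (vsub y w)) with y by vext. auto.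
    - specialize (Hmin _ Hb). unfold vdist in Hmin.
      replace (vsub w (vadd w (vrscal t (vsub y w)))) with (vrscal (- t) (vsub y w)) in Hmin by vext.
      rewrite vnorm_vrscal, Rabs_Ropp, Rabs_right in Hmin by lra. fold (vdist y w) in Hmin. nra. }
  set (n := vsub xi w). assert (Hn : vnorm n = s) by (unfold s; rewrite vdist_sym; reflexivity).
  assert (Hnn : rinner n n = s * s) by (rewrite <- vnorm_sqr, Hn; auto).
  pose proof (gnorm_pos xi HWxi) as Hgp. pose proof (unit_normal_norm xi HWxi) as Hnu.
  pose proof (g_unit_normal xi HWxi) as Hgn. set (nu := unit_normal xi) in *.
  assert (Hvv : rinner nu nu = 1) by (rewrite <- vnorm_sqr, Hnu; ring).
  set (c := rinner nu n). assert (Hcn : rinner n nu = c) by apply rinner_sym.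
  assert (Hc : s <= c).
  { apply Rnot_lt_le. intros Hlt. set (u := vsub (vrscal s nu) n).
    (* [u] points into the ball around [w], where [rho] is negative, and out of [Om] *)
    assert (Hu1 : rinner n u = - (s * (s - c))).
    { unfold u. rewrite rinner_sub_r, rinner_vrscal_r, Hnn, Hcn. ring. }
    assert (Hu2 : rinner (g xi) u = vnorm (g xi) * (s - c)).
    { unfold u. rewrite Hgn at 1. rewrite rinner_sub_r, rinner_vrscal_r, !rinner_vrscal_l, Hvv. fold c. ring. }
    assert (0 < s * (s - c)) by (apply Rmult_lt_0_compat; lra).
    assert (0 < vnorm (g xi) * (s - c)) by (apply Rmult_lt_0_compat; lra).
    destruct (rho_decreasing_line xi (vrscal (-1) u) HWxi) as (del & Hd & K).
    { rewrite rinner_vrscal_r. lra. }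
    destruct (HWo xi HWxi) as (r & Hr & HBW). pose proof (vnorm_nonneg d u) as Hu0.
    set (b := rinner u u). assert (Hb : 0 <= b) by apply rinner_nonneg.
    minimum h1 (r / (2 * (vnorm u + 1))) (s * (s - c) / (b + 1)). minimum h (del / 2) h1.
    assert (Hh : 0 < h) by (repeat apply Rmin_pos; try lra; apply Rdiv_lt_0_compat; lra).
    apply Rle_div_r in Hmin0; [|lra]. apply Rle_div_r in Hmin1; [|lra].
    destruct (K h ltac:(lra)) as [_ K2].
    replace (vadd xi (vrscal (- h) (vrscal (-1) u))) with (vadd xi (vrscal h u)) in K2 by vext.
    set (y := vadd xi (vrscal h u)) in *.
    assert (Oy : Om y).
    { apply HB. apply Rnot_le_lt. intros Hge.
      assert (Hsq : s * s <= vdist y w * vdist y w) by (apply Rmult_le_compat; lra).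
      unfold vdist in Hsq. rewrite vnorm_sqr in Hsq.
      replace (vsub y w) with (vadd n (vrscal h u)) in Hsq by (unfold y, n; vext).
      rewrite rinner_add_l, !rinner_add_r, !rinner_vrscal_l, !rinner_vrscal_r, Hnn, (rinner_sym d u n), Hu1 in Hsq.
      fold b in Hsq.
      assert (h * (b + 1) <= h1 * (b + 1)) by (apply Rmult_le_compat_r; lra).
      assert (h * (h * (b + 1)) <= h * (s * (s - c))) by (apply Rmult_le_compat_l; lra).
      assert (0 < h * h) by nra. assert (0 < h * (s * (s - c))) by (apply Rmult_lt_0_compat; auto). lra. }
    assert (Wy : W y).
    { apply HBW. unfold vdist, y. replace (vsub (vadd xi (vrscal h u)) xi) with (vrscal h u) by vext.
      rewrite vnorm_vrscal, Rabs_right by lra. nra. }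
    apply Hdef in Oy; auto. rewrite (rho_bdry xi HWxi Hxi) in K2. lra. }
  assert (E : vsub n (vrscal s nu) = vzero).
  { apply vnorm_eq_0. apply Rle_antisym; [|apply vnorm_nonneg]. apply sqr_le_le; [lra|].
    rewrite vnorm_sqr, rinner_sub_l, !rinner_sub_r, !rinner_vrscal_l, !rinner_vrscal_r, Hnn, Hvv, Hcn. fold c. nra. }
  replace (vrscal s nu) with (vsub n (vsub n (vrscal s nu))) by vext. rewrite E. unfold n. vext.
Qed.

Variable omega : R -> R.
Hypothesis Hmono : forall s t, 0 <= s -> s <= t -> 0 <= omega s <= omega t.
Hypothesis Hmod : forall p q, W p -> bdry Om p -> W q -> bdry Om q ->
  vdist (unit_normal p) (unit_normal q) <= omega (vdist p q).

(* At a first exit point [p] of the segment from [xi], [rho] would have to be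
   nondecreasing along [u], but the normal at [p] is [omega]-close to the one at [xi]. *)
Lemma inward_segment xi u r : bdry Om xi -> (forall z, vdist z xi < r -> W z) -> vnorm u < r ->
  omega (vnorm u) * vnorm u < - rinner (unit_normal xi) u -> Om (vadd xi u).
Proof.
  intros Hxi HWr Hur Hin. pose proof (vnorm_nonneg d u) as Hu0.
  set (pt := fun t => vadd xi (vrscal t u)).
  assert (Hdist : forall t, 0 <= t -> vdist (pt t) xi = t * vnorm u).
  { intros t Ht. unfold vdist, pt. replace (vsub (vadd xi (vrscal t u)) xi) with (vrscal t u) by vext.
    rewrite vnorm_vrscal, Rabs_right; lra. }
  assert (HWpt : forall t, 0 <= t <= 1 -> W (pt t)).
  { intros t Ht. apply HWr. rewrite Hdist by lra. nra. }
  assert (HWxi : W xi) by (apply HWr; rewrite vdist_self; lra).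
  assert (Hder : forall p, W p -> bdry Om p -> vdist p xi <= vnorm u -> rinner (g p) u < 0).
  { intros p Wp Bp Hp. rewrite (g_unit_normal p Wp), rinner_vrscal_l. pose proof (gnorm_pos p Wp).
    assert (rinner (unit_normal p) u < 0); [|nra].
    pose proof (Rabs_rinner_le d (vsub (unit_normal p) (unit_normal xi)) u) as T.
    rewrite rinner_sub_l in T. apply Rabs_le_between in T.
    pose proof (Hmod p xi Wp Bp HWxi Hxi) as Hm. unfold vdist in Hm at 1.
    pose proof (Hmono (vdist p xi) (vnorm u) (vdist_nonneg d p xi) Hp).
    assert (vnorm (vsub (unit_normal p) (unit_normal xi)) * vnorm u <= omega (vnorm u) * vnorm u)
      by (apply Rmult_le_compat_r; lra). lra. }
  apply NNPP. intros Hn. destruct (line_exit d Om xi u HOo) as (t & Ht & Bt & Hbelow); auto.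
  - destruct (rho_decreasing_line xi u HWxi) as (del & Hd & K).
    { apply Hder; auto. rewrite vdist_self; auto. }
    rewrite (rho_bdry xi HWxi Hxi) in K. exists (Rmin 1 del). split; [apply Rmin_pos; lra|].
    pose proof (Rmin_l 1 del). pose proof (Rmin_r 1 del).
    intros s Hs. apply Hdef; [apply HWpt; lra|]. apply K. lra.
  - assert (Wt : W (pt t)) by (apply HWpt; lra). change (bdry Om (pt t)) in Bt.
    destruct (rho_decreasing_line (pt t) u Wt) as (del & Hd & K).
    { apply Hder; auto. rewrite Hdist by lra. nra. }
    minimum m t del. assert (0 < m) by (apply Rmin_pos; lra). destruct (K (m / 2) ltac:(lra)) as [_ K2].
    replace (vadd (pt t) (vrscal (- (m / 2)) u)) with (pt (t - m / 2)) in K2 by (unfold pt; vext).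
    rewrite (rho_bdry (pt t) Wt Bt) in K2.
    assert (rho (pt (t - m / 2)) < 0); [|lra]. apply Hdef; [apply HWpt; lra|]. apply Hbelow; lra.
Qed.

Variables (eps M T : R) (xi : Cd d).
Hypothesis Hint : forall del, 0 < del < eps ->
  ex_RInt (fun t => omega t / t) del eps /\ RInt (fun t => omega t / t) del eps <= M.
Hypothesis HT : 0 < T < eps.
Hypothesis HTom : forall t, 0 <= t <= T -> omega t <= / 16.
Hypothesis Hxi : bdry Om xi.
Hypothesis HWT : forall z, vdist z xi < T -> W z.

Definition inward (s : R) : Cd d := vsub xi (vrscal s (unit_normal xi)).

(* The disc with centre [c = a / e] and radius [c - 2 a omega a] then stays in the region
   [Re tau > |tau| omega |tau|] of the complex normal line. *)
Definition admissible (a e : R) : Prop :=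
  0 < a /\ 0 < e <= / 2 /\ 2 * a <= e * T /\ forall r, a <= r <= T -> 2 * omega r * a <= e * r.

Lemma admissible_bounds a e : admissible a e ->
  2 * a <= a / e /\ 2 * (a / e) <= T /\ a <= T /\ 0 <= omega a <= / 16 /\ 0 <= 2 * a * omega a <= a / 4.
Proof.
  intros (Ha & He & HaT & _). assert (a <= T) by nra.
  assert (Hom : 0 <= omega a <= / 16) by (split; [apply (Hmono a a); lra|apply HTom; lra]).
  assert (Ec : a / e * e = a) by (field; lra).
  repeat split; try lra; try nra; apply (Rmult_le_reg_r e); nra.
Qed.

(** Points tau of the disc satisfy |tau|^2 + c h < 2 c Re tau. To conclude with [inward_segment],
    the term c h absorbs 2 c |tau| omega |tau| when |tau| <= a, and admissibility lets |tau|^2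
    absorb it when |tau| > a. *)
Lemma normal_disc a e : admissible a e ->
  holo_disc Om (fun z => vadd (inward (a / e)) (vscal z (vrscal (- (a / e - 2 * a * omega a)) (unit_normal xi)))).
Proof.
  intros Hae. destruct (admissible_bounds a e Hae) as (Hc & HcT & HaT & Hom & Hh).
  destruct Hae as (Ha & He & _ & Hadm). set (c := a / e) in *. set (h := 2 * a * omega a) in *.
  assert (HWxi : W xi) by (apply HWT; rewrite vdist_self; lra).
  pose proof (unit_normal_norm xi HWxi) as Hnu. set (nu := unit_normal xi) in *.
  assert (Hnn : rinner nu nu = 1) by (rewrite <- vnorm_sqr, Hnu; ring).
  apply holo_disc_affine. intros z Hz.
  set (tau := (RtoC c + RtoC (c - h) * z)%C).
  replace (vadd (inward c) (vscal z (vrscal (- (c - h)) nu))) with (vadd xi (vscal (- tau)%C nu)).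
  2: { unfold inward, tau. fold nu. apply functional_extensionality; intros i.
       unfold vadd, vsub, vscal, vrscal. rewrite RtoC_opp. ring. }
  pose proof (Cmod_ge_0 z) as Hz0. pose proof (Cmod_ge_0 tau) as Ht0.
  assert (Hz2 : Cmod z * Cmod z < 1) by nra.
  assert (Htau2 : Cmod tau * Cmod tau + c * h < 2 * c * Re tau).
  { rewrite Cmod_sqr in Hz2 |- *. unfold tau. cparts.
    assert (0 < (c - h) * (c - h) * (1 - (fst z * fst z + snd z * snd z))).
    { apply Rmult_lt_0_compat; nra. } nra. }
  assert (Htau : Cmod tau < T).
  { apply Rlt_le_trans with (2 * c); auto. unfold tau. eapply Rle_lt_trans; [apply Cmod_triangle|].
    rewrite Cmod_mult, !Cmod_R, !Rabs_right by lra. nra. }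
  apply (inward_segment xi _ T); auto.
  - rewrite vnorm_vscal, Cmod_opp, Hnu. lra.
  - rewrite vnorm_vscal, Cmod_opp, Hnu, Rmult_1_r. fold nu.
    rewrite (rinner_sym d nu), rinner_vscal_l, Hnn.
    assert (Hi : rinner nu (vscal Ci nu) = 0).
    { pose proof (rinner_vscal_l d Ci nu nu) as E. rewrite Hnn in E.
      rewrite (rinner_sym d (vscal Ci nu)) in E. unfold Ci in E at 2 3. simpl in E. lra. }
    rewrite Hi. replace (- (Re (- tau) * 1 - Im (- tau) * 0)) with (Re tau) by (unfold Re, Copp; simpl; ring).
    apply (Rmult_lt_reg_l (2 * c)); [lra|]. eapply Rle_lt_trans; [|apply Htau2].
    destruct (Rle_lt_dec (Cmod tau) a) as [Hle|Hgt].
    + pose proof (Hmono (Cmod tau) a Ht0 Hle).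
      assert (omega (Cmod tau) * Cmod tau <= omega a * a) by (apply Rmult_le_compat; lra).
      unfold h. nra.
    + pose proof (Hadm (Cmod tau) ltac:(lra)) as K.
      assert (2 * c * omega (Cmod tau) <= Cmod tau).
      { apply (Rmult_le_reg_r e); [lra|]. replace (2 * c * omega (Cmod tau) * e) with (2 * omega (Cmod tau) * a) by (unfold c; field; lra). lra. }
      assert (0 <= c * h) by nra. nra.
Qed.

(** Both points lie on the real diameter of [normal_disc], where the exponential of twice the
    distance is (a - h) / (b - h) times (2 c - h - b) / (2 c - h - a). The first factor is at most
    (a / b) (1 + 8 omega a), by b >= a / 2, and the second at most 1 + e / 2. *)
Lemma normal_step a e b : admissible a e -> a / 2 <= b <= a ->
  Om (inward b) /\ Om (inward a) /\ linked Om (inward b) (inward a) /\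
  kob Om (inward b) (inward a) <= / 2 * ln (a / b) + 4 * omega a + e.
Proof.
  intros Hae Hb. pose proof (normal_disc a e Hae) as Hf.
  destruct (admissible_bounds a e Hae) as (Hc & _ & HaT & Hom & Hh).
  destruct Hae as (Ha & He & _ & _). set (c := a / e) in *. set (h := 2 * a * omega a) in *.
  set (zeta := fun s => (c - s) / (c - h)).
  assert (Hz : forall s, h < s -> s <= a -> -1 < - zeta s < 1).
  { intros s Hs1 Hs2. unfold zeta. split; apply (Rmult_lt_reg_r (c - h)); try lra;
    replace (- ((c - s) / (c - h)) * (c - h)) with (s - c) by (field; lra); lra. }
  assert (Hval : forall s, inward s = vadd (inward c) (vscal (RtoC (- zeta s)) (vrscal (- (c - h)) (unit_normal xi)))).
  { intros s. unfold inward, zeta. apply functional_extensionality; intros i.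
    unfold vadd, vsub, vscal, vrscal. rewrite Cmult_assoc, <- RtoC_mult.
    replace (- ((c - s) / (c - h)) * - (c - h)) with (c - s) by (field; lra). rewrite RtoC_minus. ring. }
  pose proof (Hz b ltac:(lra) ltac:(lra)) as Zb. pose proof (Hz a ltac:(lra) ltac:(lra)) as Za.
  assert (Zab : - zeta b <= - zeta a).
  { unfold zeta. apply (Rmult_le_reg_r (c - h)); [lra|].
    replace (- ((c - b) / (c - h)) * (c - h)) with (b - c) by (field; lra).
    replace (- ((c - a) / (c - h)) * (c - h)) with (a - c) by (field; lra). lra. }
  assert (Ub : unit_disc (RtoC (- zeta b))) by (unfold unit_disc; rewrite Cmod_R; apply Rabs_lt_between; lra).
  assert (Ua : unit_disc (RtoC (- zeta a))) by (unfold unit_disc; rewrite Cmod_R; apply Rabs_lt_between; lra).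
  pose proof (hstep_disc d Om _ _ _ Hf Ub Ua) as Hs. cbv beta in Hs. rewrite <- !Hval in Hs.
  destruct (hstep_in _ _ _ _ _ Hs) as [Ob Oa]. split; auto. split; auto.
  split; [eexists; apply hpath_step; eauto|].
  eapply Rle_trans; [apply kob_le, hpath_step, Hs|]. rewrite poincare_real by lra.
  assert (Hq : (1 + - zeta a) * (1 - - zeta b) / ((1 - - zeta a) * (1 + - zeta b))
    <= a / b * ((1 + 8 * omega a) * (1 + e / 2))).
  { replace ((1 + - zeta a) * (1 - - zeta b) / ((1 - - zeta a) * (1 + - zeta b)))
      with ((a - h) / (b - h) * ((2 * c - h - b) / (2 * c - h - a))) by (unfold zeta; field; lra).
    assert (Q1 : (a - h) / (b - h) <= a / b * (1 + 8 * omega a)).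
    { apply (Rmult_le_reg_r (b * (b - h))); [apply Rmult_lt_0_compat; lra|].
      replace ((a - h) / (b - h) * (b * (b - h))) with ((a - h) * b) by (field; lra).
      replace (a / b * (1 + 8 * omega a) * (b * (b - h))) with (a * ((1 + 8 * omega a) * (b - h))) by (field; lra).
      apply Rle_trans with (a * b); [nra|]. apply Rmult_le_compat_l; [lra|].
      assert (h <= 4 * b * omega a) by (unfold h; nra).
      assert (b - h >= b * (1 - 4 * omega a)) by lra.
      apply Rle_trans with ((1 + 8 * omega a) * (b * (1 - 4 * omega a))); [|apply Rmult_le_compat_l; lra].
      assert (0 <= b * (omega a * (4 - 32 * omega a))) by (repeat apply Rmult_le_pos; lra). lra. }
    assert (Q2 : (2 * c - h - b) / (2 * c - h - a) <= 1 + e / 2).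
    { apply (Rmult_le_reg_r (2 * c - h - a)); [lra|].
      replace ((2 * c - h - b) / (2 * c - h - a) * (2 * c - h - a)) with (2 * c - h - b) by (field; lra).
      assert (e * c = a) by (unfold c; field; lra).
      assert (e * c <= e * (2 * c - h - a)) by (apply Rmult_le_compat_l; lra). lra. }
    rewrite <- Rmult_assoc. apply Rmult_le_compat; auto;
      apply Rmult_le_pos; try lra; left; apply Rinv_0_lt_compat; lra. }
  apply ln_le in Hq.
  2: { apply Rdiv_lt_0_compat; apply Rmult_lt_0_compat; lra. }
  assert (0 < a / b) by (apply Rdiv_lt_0_compat; lra).
  rewrite !ln_mult in Hq; try lra; [|apply Rmult_lt_0_compat; lra].
  pose proof (ln_le_sub1 (1 + 8 * omega a) ltac:(lra)). pose proof (ln_le_sub1 (1 + e / 2) ltac:(lra)). lra.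
Qed.

(** For r >= a the old condition serves with half the slack; for r between a / 2 and a, monotonicity
    of [omega] is paid for by 2 omega a. The halving keeps the sum of the slacks under control along
    a dyadic descent. *)
Lemma admissible_half a e : admissible a e -> admissible (a / 2) (e / 2 + 2 * omega a).
Proof.
  intros Hae. destruct (admissible_bounds a e Hae) as (_ & _ & Ha1 & Hom & _).
  destruct Hae as (Ha & He & HaT & Hadm).
  split; [lra|]. split; [lra|]. split; [nra|]. intros r Hr.
  pose proof (Hmono r r ltac:(lra) ltac:(lra)).
  destruct (Rle_lt_dec a r) as [L|L].
  - specialize (Hadm r ltac:(lra)). nra.
  - pose proof (Hmono r a ltac:(lra) ltac:(lra)). nra.
Qed.

(** Dyadic descent from depth [a] to depth [s]. The first step costs 4 omega a + e, and the new
    slack contributes twice e / 2 + 2 omega a; the total 2 e + 8 omega a is at most 2 e plus 16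
    times the integral over [a, 2 a]. *)
Lemma normal_chain n : forall a e s, admissible a e -> 2 * a < eps -> a / 2 ^ n <= s <= a ->
  Om (inward s) /\ Om (inward a) /\ linked Om (inward s) (inward a) /\
  kob Om (inward s) (inward a) <= / 2 * ln (a / s) + 2 * e + 16 * RInt (fun t => omega t / t) s (2 * a).
Proof.
  induction n as [|n IH]; intros a e s Hadm Ha Hs;
    pose proof Hadm as (Ha0 & He & HaT & _);
    pose proof (modulus_le_RInt omega eps M Hmono Hint a Ha0 Ha) as Hw;
    pose proof (Hmono a a ltac:(lra) ltac:(lra)) as Hoa.
  - simpl in Hs. replace (a / 1) with a in Hs by field. replace s with a by lra.
    destruct (normal_step a e a Hadm ltac:(lra)) as (O1 & _ & L & _).
    split; auto. split; auto. split; auto. rewrite kob_self.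
    replace (a / a) with 1 by (field; lra). rewrite ln_1.
    pose proof (Hmono a a ltac:(lra) ltac:(lra)). lra.
  - assert (H2n : 0 < 2 ^ n) by (apply pow_lt; lra).
    assert (Hs0 : 0 < s).
    { eapply Rlt_le_trans; [|apply Hs]. apply Rdiv_lt_0_compat; auto. apply pow_lt; lra. }
    pose proof (modulus_RInt_chasles omega eps M Hint s a (2 * a) Hs0 ltac:(lra) ltac:(lra) Ha) as HCh.
    pose proof (modulus_RInt_nonneg omega eps M Hmono Hint s a Hs0 ltac:(lra) ltac:(lra)) as Hnn.
    destruct (Rle_lt_dec (a / 2) s) as [L|L].
    + destruct (normal_step a e s Hadm ltac:(lra)) as (O1 & O2 & Lk & K).
      split; auto. split; auto. split; auto. eapply Rle_trans; [apply K|]. rewrite HCh. lra.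
    + destruct (normal_step a e (a / 2) Hadm ltac:(lra)) as (O1 & O2 & Lk & K).
      destruct (IH (a / 2) _ s (admissible_half a e Hadm) ltac:(lra)) as (O3 & _ & Lk2 & K2).
      { split; [|lra]. simpl in Hs. replace (a / 2 / 2 ^ n) with (a / (2 * 2 ^ n)) by (field; lra). lra. }
      split; auto. split; auto. split; [eapply linked_trans; eauto|].
      pose proof (kob_triangle d Om _ _ _ Lk2 Lk) as Tr.
      replace (2 * (a / 2)) with a in K2 by field. rewrite HCh.
      replace (a / s) with ((a / 2 / s) * (a / (a / 2))) by (field; lra).
      rewrite ln_mult by (apply Rdiv_lt_0_compat; lra). lra.
Qed.

Lemma normal_distance s t : 0 < s -> s <= t -> t <= T / 8 ->
  Om (inward s) /\ Om (inward t) /\ linked Om (inward s) (inward t) /\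
  kob Om (inward s) (inward t) <= / 2 * ln (t / s) + (1 + 16 * M).
Proof.
  intros Hs Hst Ht.
  assert (HoT : 0 <= omega T <= / 16) by (split; [apply (Hmono T T); lra|apply HTom; lra]).
  assert (HtT : 0 < t / T <= / 8).
  { split; [apply Rdiv_lt_0_compat; lra|]. apply Rle_div_l; lra. }
  (* The first term handles all radii up to [T] by monotonicity and the second fits the disc inside
     radius [T]. Since omega T <= 1 / 16 and t <= T / 8, also 2 e <= 1. *)
  set (e := 2 * omega T + 2 * (t / T)).
  assert (Hadm : admissible t e).
  { split; [lra|]. split; [unfold e; lra|]. split.
    - unfold e. replace ((2 * omega T + 2 * (t / T)) * T) with (2 * omega T * T + 2 * t) by (field; lra). nra.
    - intros r Hr. pose proof (Hmono r T ltac:(lra) ltac:(lra)).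
      apply Rle_trans with (2 * omega T * r); [|unfold e; apply Rmult_le_compat_r; lra].
      apply Rmult_le_compat; lra. }
  destruct (INR_unbounded (t / s)) as [n Hn].
  assert (Hn2 : INR n <= 2 ^ n) by apply INR_le_pow2.
  assert (H2n : 0 < 2 ^ n) by (apply pow_lt; lra).
  destruct (normal_chain n t e s Hadm ltac:(lra)) as (O1 & O2 & Lk & K).
  { split; [|lra]. apply (Rmult_le_reg_r (2 ^ n * / s)); [apply Rmult_lt_0_compat; auto; apply Rinv_0_lt_compat; auto|].
    replace (t / 2 ^ n * (2 ^ n * / s)) with (t / s) by (field; lra).
    replace (s * (2 ^ n * / s)) with (2 ^ n) by (field; lra). lra. }
  split; auto. split; auto. split; auto. eapply Rle_trans; [apply K|].
  pose proof (modulus_RInt_le omega eps M Hmono Hint s (2 * t) Hs ltac:(lra) ltac:(lra)). unfold e. lra.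
Qed.
End Normal.

(** * Boundary estimates and horospheres *)

Lemma bdry_closed d (Om : Cd d -> Prop) p : is_open Om -> closure (bdry Om) p -> bdry Om p.
Proof.
  intros Ho Hp. split.
  - intros e He. destruct (Hp (e / 2) ltac:(lra)) as (y & [Hy _] & Hd).
    destruct (Hy (e / 2) ltac:(lra)) as (z & Hz & Hd2). exists z. split; auto.
    pose proof (vdist_triangle d z y p). lra.
  - intros HO. destruct (Ho p HO) as (r & Hr & HB). destruct (Hp r Hr) as (y & [_ Hy] & Hd). apply Hy, HB, Hd.
Qed.

Lemma nearest_bdry_point d (Om : Cd d -> Prop) x w : is_open Om -> bdry Om x -> Om w ->
  exists xi, bdry Om xi /\ 0 < vdist w xi /\ vdist w xi <= vdist w x /\ vdist xi x <= 2 * vdist w x /\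
    forall xi', bdry Om xi' -> vdist w xi <= vdist w xi'.
Proof.
  intros Ho Hx Hw. destruct (nearest_point d (bdry Om) w) as (xi & Hxi & Hnearest); [exists x; auto|].
  apply bdry_closed in Hxi; auto. exists xi. specialize (Hnearest x Hx) as Hm.
  pose proof (vdist_triangle d xi w x). rewrite (vdist_sym d xi w) in H.
  repeat split; try apply Hxi; auto; try lra.
  apply vdist_pos. intros E. subst. apply (proj2 Hxi); auto.
Qed.

(** A point [w] lies on the inner normal at its nearest boundary point [xi]. It descends along that
    normal to depth [t] and then jumps to the normal at [x], at cost at most 1 when [w] is close to
    [x]. Only [del] depends on [t]; the uniformity of [C] lets small [t] enter small horospheres. *)
Lemma dini_approach d (Om : Cd d -> Prop) x : is_open Om -> bdry Om x -> dini_smooth_point Om x ->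
  exists (y : R -> Cd d) T C, 0 < T /\ forall t, 0 < t <= T -> Om (y t) /\ vdist (y t) x <= t /\
    exists del, 0 < del /\ forall w, Om w -> vdist w x < del -> exists xi,
      bdry Om xi /\ 0 < vdist w xi /\ vdist xi x <= 2 * vdist w x /\
      linked Om w (y t) /\ kob Om w (y t) <= / 2 * ln (t / vdist w xi) + C.
Proof.
  intros Ho Hx (W & rho & g & HWo & HWx & HC1 & Hg & Hdef & omega & Hmono & Hmod & eps & M & Heps & Hint).
  change (forall p q, W p -> bdry Om p -> W q -> bdry Om q ->
    vdist (unit_normal d g p) (unit_normal d g q) <= omega (vdist p q)) in Hmod.
  destruct (HWo x HWx) as (rW & HrW & HBW).
  destruct (modulus_small omega eps M Hmono Heps Hint (/ 16) ltac:(lra)) as (t0 & Ht0 & Hom).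
  minimum T t0 (Rmin (eps / 2) (rW / 2)).
  assert (HT : 0 < T) by (repeat apply Rmin_pos; lra).
  pose proof (Rmin_l (eps / 2) (rW / 2)) as M3. pose proof (Rmin_r (eps / 2) (rW / 2)) as M4.
  assert (HN : forall xi s t, bdry Om xi -> vdist xi x < rW / 2 -> 0 < s -> s <= t -> t <= T / 8 ->
    Om (inward d g xi s) /\ Om (inward d g xi t) /\ linked Om (inward d g xi s) (inward d g xi t) /\
    kob Om (inward d g xi s) (inward d g xi t) <= / 2 * ln (t / s) + (1 + 16 * M)).
  { intros xi s t Hxi Hd Hs Hst HtT.
    apply (normal_distance d Om W rho g Ho HC1 Hg Hdef HWo omega Hmono Hmod eps M T xi); auto; try lra.
    - intros r Hr. apply Hom. lra.
    - intros z Hz. apply HBW. pose proof (vdist_triangle d z xi x). lra. }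
  exists (inward d g x), (T / 8), (2 + 16 * M). split; [lra|]. intros t Ht.
  destruct (HN x t t Hx) as (Oy & _); try lra. { rewrite vdist_self; lra. }
  split; auto. split.
  { unfold vdist, inward. replace (vsub (vsub x _) x) with (vrscal (- t) (unit_normal d g x)) by vext.
    rewrite vnorm_vrscal, (unit_normal_norm d W g Hg x HWx), Rabs_Ropp, Rabs_right; lra. }
  destruct (Ho _ Oy) as (r2 & Hr2 & HB2).
  (* At depth [t] the tilt of the normal then displaces the point by at most r2 / 4. The feet
     contribute as much again, so the jump stays within half of the ball of radius [r2]. *)
  destruct (modulus_small omega eps M Hmono Heps Hint (r2 / (4 * t))) as (t1 & Ht1 & Hom1).
  { apply Rdiv_lt_0_compat; lra. }
  minimum del (Rmin t1 r2 / 8) (Rmin t (rW / 4)).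
  pose proof (Rmin_pos t1 r2 Ht1 Hr2) as Hp. pose proof (Rmin_pos t (rW / 4) ltac:(lra) ltac:(lra)) as Hp2.
  pose proof (Rmin_l t1 r2). pose proof (Rmin_r t1 r2). pose proof (Rmin_l t (rW / 4)). pose proof (Rmin_r t (rW / 4)).
  exists del. split; [apply Rmin_pos; lra|]. intros w Hw Hwx.
  destruct (nearest_bdry_point d Om x w Ho Hx Hw) as (xi & Hxi & Hs0 & Hsx & Hxix & Hnearest).
  exists xi. split; auto. split; auto. split; auto.
  assert (HWxi : W xi) by (apply HBW; lra).
  assert (Ew : w = inward d g xi (vdist w xi)).
  { apply (nearest_bdry_normal d Om W rho g Ho HC1 Hg Hdef HWo); auto. }
  set (s := vdist w xi) in *.
  destruct (HN xi s t Hxi) as (_ & Ot & Lk & K); try lra. rewrite <- Ew in Lk, K.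
  assert (Hc : vdist (inward d g xi t) (inward d g x t) <= r2 / 2).
  { unfold vdist, inward.
    replace (vsub _ _) with (vadd (vsub xi x) (vrscal (- t) (vsub (unit_normal d g xi) (unit_normal d g x)))) by vext.
    eapply Rle_trans; [apply vnorm_triangle|]. rewrite vnorm_vrscal, Rabs_Ropp, Rabs_right by lra.
    fold (vdist xi x). fold (vdist (unit_normal d g xi) (unit_normal d g x)).
    pose proof (Hmod xi x HWxi Hxi HWx Hx).
    pose proof (Hom1 (vdist xi x) ltac:(pose proof (vdist_nonneg d xi x); lra)).
    assert (t * vdist (unit_normal d g xi) (unit_normal d g x) <= t * (r2 / (4 * t))) by (apply Rmult_le_compat_l; lra).
    replace (t * (r2 / (4 * t))) with (r2 / 4) in H5 by (field; lra). lra. }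
  assert (Lk2 : linked Om (inward d g x t) (inward d g xi t)).
  { eexists. apply hpath_step, (hstep_ball d Om _ _ r2); auto. lra. }
  pose proof (kob_le_ball d Om _ (inward d g xi t) r2 Hr2 HB2 Hc) as K2.
  assert (2 * vdist (inward d g xi t) (inward d g x t) / r2 <= 1).
  { apply Rle_div_l; lra. }
  rewrite kob_sym in K2 by auto. apply linked_sym in Lk2.
  split; [eapply linked_trans; eauto|].
  pose proof (kob_triangle d Om _ _ _ Lk Lk2). lra.
Qed.

(** Both bounds come from [localized_lower_bound]. In the first, [HF1] replaces the distance in the
    image by one in [Om]; the second takes z = o and inserts the logarithmic bound in the image,
    where the Lipschitz constant of [Phi] near [x] controls the distance to [Phi xi]. *)
Lemma local_estimates d (Om : Cd d -> Prop) x o : is_domain Om -> is_bounded Om -> bdry Om x -> Om o ->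
  dini_smooth_point Om x ->
  (exists U V Phi, local_convex_chart Om x U V Phi /\ visibility (image_chart Om V Phi)) ->
  exists r0, 0 < r0 /\ forall Rad, 0 < Rad <= r0 -> exists K,
    (forall w z, Om w -> vdist w x < Rad / 16 -> Om z -> Rad / 8 <= vdist z x ->
       kob Om o w + kob Om o z - K <= kob Om w z) /\
    (forall w xi, Om w -> vdist w x < Rad / 16 -> bdry Om xi -> 0 < vdist w xi -> vdist xi x < Rad ->
       - / 2 * ln (vdist w xi) - K <= kob Om o w).
Proof.
  intros (_ & HOo & HOc) HOb Hx Ho Hdini (U & V & Phi & Hchart & Hvis).
  pose proof Hchart as (HUo & HVo & HUx & HVx & _ & _ & HF & _).
  set (D := image_chart Om V Phi) in *.
  destruct (HVo x HVx) as (rV & HrV & HBV).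
  destruct (proj1 Hx rV HrV) as (z0 & Hz0 & Hz0x).
  set (q := Phi z0). assert (Hq : D q) by (apply chart_in; auto).
  destruct (chart_open d Om U V x Phi Hchart q Hq) as (rq & Hrq & HBq).
  destruct (holomorphic_lipschitz d U Phi x HUo HF HUx) as (rL & KL & HrL & HKL & HUr & HLip).
  destruct (dini_approach d Om x HOo Hx Hdini) as (y & T & C & HT & HA).
  destruct (HA T ltac:(lra)) as (Oy & _ & del & Hdel & HT2).
  assert (Hlow : forall w xi, Om w -> V w -> vdist w x < rL -> bdry Om xi -> 0 < vdist w xi -> vdist xi x < rL ->
     / 2 * ln (rq / (4 * KL)) - / 2 * ln (vdist w xi) <= kob D (Phi w) q).
  { intros w xi Hw HVw Hwx Hxi Hs Hxix.
    assert (0 < KL * vdist w xi) by (apply Rmult_lt_0_compat; auto).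
    rewrite <- Rmult_minus_distr_l, <- ln_div by (try apply Rdiv_lt_0_compat; lra).
    replace (rq / (4 * KL) / vdist w xi) with (rq / (4 * (KL * vdist w xi))) by (field; lra).
    apply (convex_kob_lower d D (Phi xi)); auto.
    - apply (chart_open d Om U V x Phi Hchart). - apply (chart_convex d Om U V x Phi Hchart).
    - apply (chart_notin d Om U V x Phi Hchart); [apply HUr; auto|apply Hxi].
    - apply chart_in; auto. }
  assert (Hox : 0 < vdist o x) by (apply vdist_pos; intros E; subst; apply (proj2 Hx); auto).
  (* The bound by [vdist o x] keeps [o] away from [x], so that [o] can stand for the far point in
     the lower bound. *)
  minimum r0 (Rmin rV rL / 2) (Rmin del (vdist o x)).
  pose proof (Rmin_pos rV rL HrV HrL) as Hp. pose proof (Rmin_pos del (vdist o x) Hdel Hox) as Hp2.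
  pose proof (Rmin_l rV rL). pose proof (Rmin_r rV rL). pose proof (Rmin_l del (vdist o x)). pose proof (Rmin_r del (vdist o x)).
  exists r0. split; [apply Rmin_pos; lra|]. intros Rad HRad.
  (* The unknown [vdist w xi] enters the upper bound in [Om] and the lower bound in the image
     through the same logarithm and cancels; these constants remain. *)
  set (CF := / 2 * ln T + C + kob Om o (y T) - / 2 * ln (rq / (4 * KL))).
  assert (HlkO : forall a b, Om a -> Om b -> linked Om a b) by (intros; apply domain_linked; auto).
  assert (HF1 : forall w, Om w -> vdist w x < Rad -> kob Om o w <= kob D (Phi w) q + CF).
  { intros w Hw Hwx. destruct (HT2 w Hw ltac:(lra)) as (xi & Hxi & Hs & Hxix & Lk & K).
    pose proof (Hlow w xi Hw (HBV w ltac:(lra)) ltac:(lra) Hxi Hs ltac:(lra)) as L.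
    rewrite ln_div in K by lra.
    pose proof (kob_triangle d Om o (y T) w (HlkO _ _ Ho Oy) (linked_sym _ _ _ _ Lk)) as Tr.
    rewrite (kob_sym d Om (y T) w) in Tr by (apply linked_sym; auto). unfold CF. lra. }
  assert (HRV : forall z, vdist z x < Rad -> V z) by (intros z Hz; apply HBV; lra).
  destruct (localized_lower_bound d Om U V x o Phi HOo HOc HOb Ho Hchart Hvis q Rad CF Hq ltac:(lra) HRV HF1) as (K & HK).
  set (K0 := / 2 * ln (rq / (4 * KL))) in *.
  exists (Rmax (K + CF) (K - K0)). pose proof (Rmax_l (K + CF) (K - K0)). pose proof (Rmax_r (K + CF) (K - K0)).
  split.
  - intros w z Hw Hwx Hz Hzx. specialize (HK w z Hw Hwx Hz Hzx).
    pose proof (HF1 w Hw ltac:(lra)). fold D in HK. lra.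
  - intros w xi Hw Hwx Hxi Hs Hxix.
    specialize (HK w o Hw Hwx Ho ltac:(lra)). rewrite kob_self in HK. fold D in HK.
    specialize (Hlow w xi Hw (HRV w ltac:(lra)) ltac:(lra) Hxi Hs ltac:(lra)).
    rewrite (kob_sym d Om o w) by auto. lra.
Qed.

Lemma limsup_at_ge d (Om : Cd d -> Prop) x F B del : closure Om x -> 0 < del ->
  (forall w, Om w -> vdist w x < del -> B <= F w) -> Rbar_le B (limsup_at Om x F).
Proof.
  intros Hx Hd H. apply (proj2 (Glb_Rbar_correct _)). intros s (e & He & Es).
  pose proof (Rmin_pos del e Hd He) as Hp. pose proof (Rmin_l del e). pose proof (Rmin_r del e).
  destruct (Hx _ Hp) as (w & Hw & Hwx).
  pose proof (proj1 (Lub_Rbar_correct (fun y => exists w, Om w /\ vdist w x < e /\ y = F w)) (F w)) as L.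
  rewrite <- Es in L. simpl in *. specialize (H w Hw ltac:(lra)).
  specialize (L ltac:(exists w; repeat split; auto; lra)). lra.
Qed.

(** [limsup_at] collects finite suprema only, so the supremum near [x] must first be shown finite:
    it lies between one value of [F], provided by the closure, and [B]. *)
Lemma limsup_at_le d (Om : Cd d -> Prop) x F B del : closure Om x -> 0 < del ->
  (forall w, Om w -> vdist w x < del -> F w <= B) -> Rbar_le (limsup_at Om x F) B.
Proof.
  intros Hx Hd H. destruct (Hx del Hd) as (w & Hw & Hwx).
  pose proof (Lub_Rbar_correct (fun y => exists w, Om w /\ vdist w x < del /\ y = F w)) as [L1 L2].
  remember (Lub_Rbar (fun y => exists w, Om w /\ vdist w x < del /\ y = F w)) as l eqn:El.
  assert (H1 : Rbar_le (F w) l) by (apply L1; exists w; auto).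
  assert (H2 : Rbar_le l B) by (apply L2; intros y (v & Hv & Hvx & ->); simpl; auto).
  destruct l as [l| |]; simpl in H1, H2; try contradiction.
  apply Rbar_le_trans with l; [|simpl; auto]. apply (proj1 (Glb_Rbar_correct _)). exists del. split; auto.
Qed.

(** As for the upper limit, finiteness comes first: the infimum lies between [B] and one value of
    [F]. *)
Lemma liminf_at_ge d (Om : Cd d -> Prop) x F B del : closure Om x -> 0 < del ->
  (forall w, Om w -> vdist w x < del -> B <= F w) -> Rbar_le B (liminf_at Om x F).
Proof.
  intros Hx Hd H. destruct (Hx del Hd) as (w & Hw & Hwx).
  pose proof (Glb_Rbar_correct (fun y => exists w, Om w /\ vdist w x < del /\ y = F w)) as [L1 L2].
  remember (Glb_Rbar (fun y => exists w, Om w /\ vdist w x < del /\ y = F w)) as l eqn:El.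
  assert (H1 : Rbar_le l (F w)) by (apply L1; exists w; auto).
  assert (H2 : Rbar_le B l) by (apply L2; intros y (v & Hv & Hvx & ->); simpl; auto).
  destruct l as [l| |]; simpl in H1, H2; try contradiction.
  apply Rbar_le_trans with l; [simpl; auto|]. apply (proj1 (Lub_Rbar_correct _)). exists del. split; auto.
Qed.

Lemma liminf_at_le d (Om : Cd d -> Prop) x F B del : closure Om x -> 0 < del ->
  (forall w, Om w -> vdist w x < del -> F w <= B) -> Rbar_le (liminf_at Om x F) B.
Proof.
  intros Hx Hd H. apply (proj2 (Lub_Rbar_correct _)). intros s (e & He & Es).
  pose proof (Rmin_pos del e Hd He) as Hp. pose proof (Rmin_l del e). pose proof (Rmin_r del e).
  destruct (Hx _ Hp) as (w & Hw & Hwx).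
  pose proof (proj1 (Glb_Rbar_correct (fun y => exists w, Om w /\ vdist w x < e /\ y = F w)) (F w)) as L.
  rewrite <- Es in L. simpl in *. specialize (H w Hw ltac:(lra)).
  specialize (L ltac:(exists w; repeat split; auto; lra)). lra.
Qed.

Lemma ln_le_of_lt_exp r B : 0 < r -> r <= exp B -> ln r <= B.
Proof. intros Hr H. rewrite <- (ln_exp B). apply ln_le; auto. Qed.

Theorem theorem1p5 (d : nat) (Omega : Cd d -> Prop) :
  is_domain Omega ->
  is_bounded Omega ->
  complete_kob_hyperbolic Omega ->
  dini_smooth_boundary Omega ->
  (forall x, bdry Omega x ->
     exists (U V : Cd d -> Prop) (Phi : Cd d -> Cd d),
       local_convex_chart Omega x U V Phi /\
       visibility (image_chart Omega V Phi)) ->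
  forall (x o : Cd d) (Rad : R),
    bdry Omega x -> Omega o -> 0 < Rad ->
    (forall y, (closure (horo_small Omega o x Rad) y /\ bdry Omega y) <-> y = x) /\
    (forall y, (closure (horo_big Omega o x Rad) y /\ bdry Omega y) <-> y = x).
Proof.
  intros Hdom Hb _ Hdini Hloc x o Rad Hx Ho HRad.
  pose proof Hdom as (_ & HOo & HOc). pose proof (proj1 Hx) as Hcx.
  assert (Hlk : forall a b, Omega a -> Omega b -> linked Omega a b) by (intros; apply domain_linked; auto).
  pose (F := fun z w => kob Omega z w - kob Omega o w).
  (* Bounded Gromov products give F z w >= kob o z - K, and kob o z tends to infinity as [z]
     approaches [y]. The bound holds for every [w] near [x], so it serves the upper and the lower
     limit alike. *)
  assert (Hsep : forall y, bdry Omega y -> y <> x -> exists del, 0 < del /\ forall z, Omega z -> vdist z y < del ->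
    exists del2 B, 0 < del2 /\ / 2 * ln Rad <= B /\ forall w, Omega w -> vdist w x < del2 -> B <= F z w).
  { intros y Hy Hyx. apply vdist_pos in Hyx.
    destruct (local_estimates d Omega x o Hdom Hb Hx Ho (Hdini x Hx) (Hloc x Hx)) as (r & Hr & HE).
    minimum r' r (vdist y x). pose proof (Rmin_pos r (vdist y x) Hr Hyx) as Hr'. fold r' in Hr'.
    destruct (HE r' ltac:(lra)) as (K & HK & _).
    destruct (local_estimates d Omega y o Hdom Hb Hy Ho (Hdini y Hy) (Hloc y Hy)) as (r2 & Hr2 & HE2).
    destruct (HE2 r2 ltac:(lra)) as (K2 & _ & HK2).
    set (B := / 2 * ln Rad).
    (* The exponential makes the logarithmic bound at [y] at least B + K; half of [vdist y x] keeps
       [z] away from [x]. *)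
    minimum del (Rmin (r2 / 16) (vdist y x / 2)) (exp (- 2 * (B + K + K2))).
    exists del. pose proof (exp_pos (- 2 * (B + K + K2))) as Hep.
    pose proof (Rmin_l (r2 / 16) (vdist y x / 2)). pose proof (Rmin_r (r2 / 16) (vdist y x / 2)).
    split; [repeat apply Rmin_pos; lra|]. intros z Hz Hzy.
    exists (r' / 16), B. split; [lra|]. split; [lra|]. intros w Hw Hwx.
    assert (Hzy0 : 0 < vdist z y) by (apply vdist_pos; intros E; subst; apply (proj2 Hy); auto).
    pose proof (HK2 z y Hz ltac:(lra) Hy Hzy0 ltac:(rewrite vdist_self; lra)) as L1.
    pose proof (ln_le_of_lt_exp (vdist z y) (- 2 * (B + K + K2)) Hzy0 ltac:(lra)) as L2.
    pose proof (vdist_triangle d y z x) as T. rewrite (vdist_sym d y z) in T.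
    pose proof (HK w z Hw Hwx Hz ltac:(lra)) as L3. rewrite (kob_sym d Omega w z) in L3 by auto.
    unfold F. lra. }
  (* For z = y t the logarithms of [vdist w xi] in the two estimates cancel, leaving F z w <= / 2 *
     ln t + C + K for every [w] close to [x]. *)
  assert (Hnear : forall e, 0 < e -> exists z, Omega z /\ vdist z x < e /\ exists del B, 0 < del /\ B < / 2 * ln Rad /\
     forall w, Omega w -> vdist w x < del -> F z w <= B).
  { intros e He.
    destruct (local_estimates d Omega x o Hdom Hb Hx Ho (Hdini x Hx) (Hloc x Hx)) as (r & Hr & HE).
    destruct (HE r ltac:(lra)) as (K & _ & HK).
    destruct (dini_approach d Omega x HOo Hx (Hdini x Hx)) as (y & T & C & HT & HA).
    (* The unit margin yields the strict inequality in the definition of the horospheres, and t <=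
       exp (2 (B - C - K)) brings the bound below [B]. *)
    set (B := / 2 * ln Rad - 1). pose proof (exp_pos (2 * (B - C - K))) as Hep.
    minimum t (Rmin T (e / 2)) (exp (2 * (B - C - K))).
    pose proof (Rmin_l T (e / 2)). pose proof (Rmin_r T (e / 2)).
    assert (Ht : 0 < t) by (repeat apply Rmin_pos; lra).
    destruct (HA t ltac:(lra)) as (Oy & Hyx & del & Hdel & HD).
    exists (y t). split; auto. split; [lra|]. exists (Rmin del (r / 16)), B.
    pose proof (Rmin_l del (r / 16)). pose proof (Rmin_r del (r / 16)).
    split; [apply Rmin_pos; lra|]. split; [unfold B; lra|]. intros w Hw Hwx.
    destruct (HD w Hw ltac:(lra)) as (xi & Hxi & Hs & Hxix & Lk & U1).
    pose proof (HK w xi Hw ltac:(lra) Hxi Hs ltac:(lra)) as L1.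
    rewrite ln_div in U1 by lra. rewrite kob_sym in U1 by auto.
    pose proof (ln_le_of_lt_exp t (2 * (B - C - K)) Ht ltac:(lra)). unfold F. lra. }
  split; intros y; split.
  - intros [Hcl Hy]. apply NNPP. intros Hne. destruct (Hsep y Hy Hne) as (del & Hdel & HS).
    destruct (Hcl del Hdel) as (z & [Hz Hlt] & Hzy). destruct (HS z Hz Hzy) as (d2 & B & Hd2 & HB & HF).
    pose proof (limsup_at_ge d Omega x (F z) B d2 Hcx Hd2 HF) as L.
    apply (Rbar_le_not_lt _ _ L). eapply Rbar_lt_le_trans; [apply Hlt|]. exact HB.
  - intros ->. split; auto. intros e He. destruct (Hnear e He) as (z & Hz & Hzx & d2 & B & Hd2 & HB & HF).
    exists z. split; auto. split; auto. eapply Rbar_le_lt_trans; [apply (limsup_at_le d Omega x (F z) B d2); auto|].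
    exact HB.
  - intros [Hcl Hy]. apply NNPP. intros Hne. destruct (Hsep y Hy Hne) as (del & Hdel & HS).
    destruct (Hcl del Hdel) as (z & [Hz Hlt] & Hzy). destruct (HS z Hz Hzy) as (d2 & B & Hd2 & HB & HF).
    pose proof (liminf_at_ge d Omega x (F z) B d2 Hcx Hd2 HF) as L.
    apply (Rbar_le_not_lt _ _ L). eapply Rbar_lt_le_trans; [apply Hlt|]. exact HB.
  - intros ->. split; auto. intros e He. destruct (Hnear e He) as (z & Hz & Hzx & d2 & B & Hd2 & HB & HF).
    exists z. split; auto. split; auto. eapply Rbar_le_lt_trans; [apply (liminf_at_le d Omega x (F z) B d2); auto|].
    exact HB.
Qed.
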